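(* Consider the Biset-Family Edge-Cover problem with a crossing biset-family $\mathcal{F}$ on $V$, $|V|=n$, and a directed graph $G=(V,E)$ with edge costs $c$. There is a polynomial-time algorithm that computes an edge-cover $J\subseteq E$ of $\mathcal{F}$ of cost $c(J)\le \rho\cdot\tau(\mathcal{F})$, where: (i) $\rho=O(\log \nu(\mathcal{F}))=O(\log n)$ for an arbitrary crossing $\mathcal{F}$; (ii) $\rho=O\left(\log\min\left\{\frac{n}{n-k},\,n-k\right\}\right)$ if, for an integer $0\le k\le n-1$, both $\mathcal{F}$ and the co-family of $\mathcal{F}$ are $k$-regular and $|\Gamma(\hat S)|=k$ for all $\hat S\in\mathcal{F}$; (iii) $\rho=O\left(\frac{n}{n-k}\log\frac{n}{n-k}\right)$ if, for an integer $0\le k\le n-1$, both $\mathcal{F}$ and the co-family of $\mathcal{F}$ are $k$-regular and $\gamma(\mathcal{F})\le k$.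
   Context: $V$ is a finite groundset, $n=|V|$. A biset on $V$ is an ordered pair $\hat S=(S,S^+)$ with $S\subseteq S^+\subseteq V$; $S$ is its inner part, $S^+$ its outer part, and $\Gamma(\hat S)=S^+\setminus S$ its boundary. $\hat S$ is proper if $S\neq\emptyset$ and $V\setminus S^+\neq\emptyset$; all biset-families considered consist of proper bisets. The co-biset of $\hat S$ is $(V\setminus S^+,V\setminus S)$, and the co-family of a biset-family $\mathcal{F}$ is the family of co-bisets of its members. Two bisets $\hat X,\hat Y$ intersect if $X\cap Y\neq\emptyset$, and cross if $X\cap Y\ne\emptyset$ and $X^+\cup Y^+\neq V$. Define $\hat X\cap\hat Y=(X\cap Y,X^+\cap Y^+)$ and $\hat X\cup\hat Y=(X\cup Y,X^+\cup Y^+)$. A biset-family $\mathcal{F}$ is crossing (resp. intersecting) if $\hat X\cap\hat Y,\hat X\cup\hat Y\in\mathcal{F}$ for all $\hat X,\hat Y\in\mathcal{F}$ that cross (resp. intersect); it is $k$-regular if $\hat X\cap\hat Y,\hat X\cup\hat Y\in\mathcal{F}$ for all intersecting $\hat X,\hat Y\in\mathcal{F}$ with $|V\setminus(X\cup Y)|\ge k+1$. Let $\gamma(\mathcal{F})=\max_{\hat S\in\mathcal{F}}|\Gamma(\hat S)|$. Biset containment: $\hat X\subseteq\hat Y$ if $X\subset Y$, or $X=Y$ and $X^+\subseteq Y^+$. A core of $\mathcal{F}$ is a member $\hat C\in\mathcal{F}$ that contains no member of $\mathcal{F}\setminus\{\hat C\}$; $\nu(\mathcal{F})$ is the number of cores.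 A directed edge $uv$ covers a biset $\hat S$ if $u\in S$ and $v\in V\setminus S^+$; $\delta_J(\hat S)$ is the set of edges of $J$ covering $\hat S$; $J$ is an edge-cover of $\mathcal{F}$ if it covers every member; the residual family $\mathcal{F}^J$ consists of the members of $\mathcal{F}$ not covered by $J$. Biset-Family Edge-Cover: given a directed graph $G=(V,E)$ with nonnegative edge costs $c_e$ and a biset-family $\mathcal{F}$ on $V$, find a minimum-cost edge-cover $J\subseteq E$ of $\mathcal{F}$. For a biset-family $\mathcal{S}$, $\tau(\mathcal{S})=\min\{\sum_{e\in E}c_ex_e:\ \sum_{e\in\delta_E(\hat S)}x_e\ge1\ \forall \hat S\in\mathcal{S},\ x\ge0\}$. $\mathcal{F}$ may be given implicitly: it is assumed that for any edge set $J$ on $V$ and any $u,v\in V$ one can compute in polynomial time the cores of $\mathcal{F}(u,v)=\{\hat S\in\mathcal{F}^J:u\in S,\,v\in V\setminus S^+\}$ and the cores of its co-family, or determine that $\mathcal{F}(u,v)$ is empty.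
   Formalization: Each O(log y) is read as O(max(1, log y)), since literally the bound is 0 and false for ν(F)=1 or k=0; it is also assumed that E itself covers F, since otherwise no edge-cover J⊆E exists; costs are nonnegative rationals. *)

(* Defs.v *)
From mathcomp Require Import all_boot all_order all_algebra.
From mathcomp Require Import all_classical all_reals all_analysis.
Set Implicit Arguments.
Unset Strict Implicit.
Unset Printing Implicit Defensive.
Import Order.TTheory GRing.Theory Num.Theory.
Local Open Scope ring_scope.

(** * Bisets *)

(* A pair (S, S^+); the inclusion S \subset S^+ is part of [proper_biset]. *)
Notation biset V := ({set V} * {set V})%type.

Section Bisets.
Variable V : finType.

Implicit Types (X Y S : biset V) (F : {set biset V}).
Implicit Types (e : V * V) (J E : {set V * V}).

Definition boundary S : {set V} := S.2 :\: S.1.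
Definition proper_biset S : bool :=
  [&& S.1 \subset S.2, S.1 != finset.set0 & ~: S.2 != finset.set0].
Definition cobiset S : biset V := (~: S.2, ~: S.1).
Definition cofamily F : {set biset V} := [set cobiset S | S in F]%SET.

Definition intersect X Y : bool := X.1 :&: Y.1 != finset.set0.
Definition cross X Y : bool :=
  (X.1 :&: Y.1 != finset.set0) && (X.2 :|: Y.2 != [set: V]%SET).
Definition bicap X Y : biset V := (X.1 :&: Y.1, X.2 :&: Y.2).
Definition bicup X Y : biset V := (X.1 :|: Y.1, X.2 :|: Y.2).

Definition proper_family F : Prop := forall S, S \in F -> proper_biset S.
Definition crossing F : Prop := forall X Y, X \in F -> Y \in F ->
  cross X Y -> bicap X Y \in F /\ bicup X Y \in F.
Definition k_regular (k : nat) F : Prop := forall X Y, X \in F -> Y \in F ->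
  intersect X Y -> (k.+1 <= #|~: (X.1 :|: Y.1)|)%N ->
  bicap X Y \in F /\ bicup X Y \in F.
Definition gamma F : nat := \max_(S in F) #|boundary S|.

Definition bisub X Y : bool :=
  (X.1 \proper Y.1) || (X.1 == Y.1) && (X.2 \subset Y.2).
Definition cores F : {set biset V} :=
  [set C in F | [forall X in F :\ C, ~~ bisub X C]]%SET.
Definition nu F : nat := #|cores F|.

Definition covers e S : bool := (e.1 \in S.1) && (e.2 \in ~: S.2).
Definition delta E S : {set V * V} := [set e in E | covers e S]%SET.
Definition edge_cover J F : Prop :=
  forall S, S \in F -> exists2 e, e \in J & covers e S.
Definition residual F J : {set biset V} :=
  [set S in F | [forall e in J, ~~ covers e S]]%SET.
(* The family F(u,v), which also depends on J. *)
Definition separating F J (u v : V) : {set biset V} :=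
  [set S in residual F J | (u \in S.1) && (v \in ~: S.2)]%SET.

Variable R : realType.
Implicit Types (c x : V * V -> R).

Definition cost c J : R := \sum_(e in J) c e.
Definition fractional_cover E F x : Prop :=
  (forall e, e \in E -> 0 <= x e) /\
  (forall S, S \in F -> 1 <= \sum_(e in delta E S) x e).
(* The infimum is an attained minimum whenever the LP is feasible, that is,
   whenever E is an edge-cover of F; otherwise it is a junk value. *)
Definition tau E c F : R :=
  inf [set z : R | exists2 x : V * V -> R,
    fractional_cover E F x & z = \sum_(e in E) c e * x e]%classic.

End Bisets.

(* [O(log y)] is read as [O(max (1, log y))]: for y = 1 the literal bound
   would be 0. *)
Definition log1 (R : realType) (y : R) : R := Num.max 1 (ln y).

(** * Oracle computations

   WHILE programs over binary trees with integer leaves.  Every assignment and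
   every oracle call is charged the bit size of the values it moves, so no
   stored value outgrows the input size plus the elapsed time, and the model
   simulates and is simulated by oracle Turing machines with polynomial
   overhead.  An operation applied to an operand of the wrong shape returns a
   default value. *)

Inductive data : Type := Leaf of int | Pair of data & data.

Fixpoint dsize (d : data) : nat :=
  match d with
  | Leaf z => (trunc_log 2 `|z|%N).+1
  | Pair a b => (dsize a + dsize b).+1
  end.

Inductive expr : Type :=
| Var of nat
| Lit of int
| MkPair of expr & expr
| Fst of expr
| Snd of expr
| IsPair of expr
| Add of expr & expr
| Sub of expr & expr
| Mul of expr & expr
| Le of expr & expr.

Definition store : Type := nat -> data.
Definition int_of (d : data) : int := if d is Leaf z then z else 0.
Definition data_of_bool (b : bool) : data := Leaf (if b then 1 else 0).
Definition truthy (d : data) : bool := if d is Leaf z then z != 0 else true.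
Definition upd (s : store) (x : nat) (d : data) : store :=
  fun y => if y == x then d else s y.

Fixpoint eval_expr (s : store) (e : expr) : data :=
  match e with
  | Var x => s x
  | Lit z => Leaf z
  | MkPair a b => Pair (eval_expr s a) (eval_expr s b)
  | Fst a => if eval_expr s a is Pair d _ then d else Leaf 0
  | Snd a => if eval_expr s a is Pair _ d then d else Leaf 0
  | IsPair a => data_of_bool (if eval_expr s a is Pair _ _ then true else false)
  | Add a b => Leaf (int_of (eval_expr s a) + int_of (eval_expr s b))
  | Sub a b => Leaf (int_of (eval_expr s a) - int_of (eval_expr s b))
  | Mul a b => Leaf (int_of (eval_expr s a) * int_of (eval_expr s b))
  | Le a b => data_of_bool (int_of (eval_expr s a) <= int_of (eval_expr s b))
  end.

Inductive program : Type :=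
| Assign of nat & expr
| Query of nat & expr
| Seq of program & program
| If of expr & program & program
| While of expr & program.

(* [exec O P s s' t]: with oracle O, started in store s, the program P halts
   in store s' after time t. *)
Inductive exec (O : data -> data) : program -> store -> store -> nat -> Prop :=
| ExecAssign x e s :
    exec O (Assign x e) s (upd s x (eval_expr s e)) (dsize (eval_expr s e)).+1
| ExecQuery x e s :
    exec O (Query x e) s (upd s x (O (eval_expr s e)))
      (dsize (eval_expr s e) + dsize (O (eval_expr s e))).+1
| ExecSeq P Q s s' s'' t t' :
    exec O P s s' t -> exec O Q s' s'' t' ->
    exec O (Seq P Q) s s'' (t + t').+1
| ExecIf e P Q s s' t :
    exec O (if truthy (eval_expr s e) then P else Q) s s' t ->
    exec O (If e P Q) s s' t.+1
| ExecWhileStop e P s :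
    truthy (eval_expr s e) = false -> exec O (While e P) s s 1
| ExecWhileStep e P s s' s'' t t' :
    truthy (eval_expr s e) -> exec O P s s' t ->
    exec O (While e P) s' s'' t' ->
    exec O (While e P) s s'' (t + t').+1.

(* Variable 0 holds the input at the start and the output at the end. *)
Definition computes (O : data -> data) (P : program) (inp out : data)
    (t : nat) : Prop :=
  exists2 s : store, exec O P (upd (fun=> Leaf 0) 0%N inp) s t & s 0%N = out.

(** * Encodings *)

Definition enc_seq (T : Type) (f : T -> data) (l : seq T) : data :=
  foldr (fun a d => Pair (f a) d) (Leaf 0) l.
Definition enc_rat (q : rat) : data := Pair (Leaf (numq q)) (Leaf (denq q)).

Section Encodings.
Variable n : nat.
Implicit Types (E : {set 'I_n * 'I_n}) (F : {set biset 'I_n}).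

Definition enc_vertex (v : 'I_n) : data := Leaf (Posz v).
Definition enc_edge (e : 'I_n * 'I_n) : data :=
  Pair (enc_vertex e.1) (enc_vertex e.2).
Definition enc_edges (J : seq ('I_n * 'I_n)) : data := enc_seq enc_edge J.
Definition enc_set (S : {set 'I_n}) : data := enc_seq enc_vertex (enum S).
Definition enc_biset (S : biset 'I_n) : data :=
  Pair (enc_set S.1) (enc_set S.2).

(* The vertices are listed explicitly, so the input size is at least n. *)
Definition enc_instance E (c : 'I_n * 'I_n -> rat) : data :=
  Pair (enc_seq enc_vertex (enum 'I_n))
       (enc_seq (fun e => Pair (enc_edge e) (enc_rat (c e))) (enum E)).

Definition enc_query (J : seq ('I_n * 'I_n)) (u v : 'I_n) : data :=
  Pair (enc_edges J) (Pair (enc_vertex u) (enc_vertex v)).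

(* Every nonempty family has a core, so empty lists are returned exactly when
   F(u,v) is empty.  Ill-formed queries may be answered arbitrarily. *)
Definition core_oracle F (O : data -> data) : Prop :=
  forall (J : seq ('I_n * 'I_n)) (u v : 'I_n),
  let Fuv := separating F [set e in J]%SET u v in
  exists s s' : seq (biset 'I_n),
  [/\ uniq s /\ s =i cores Fuv,
      uniq s' /\ s' =i cores (cofamily Fuv)
    & O (enc_query J u v) = Pair (enc_seq enc_biset s) (enc_seq enc_biset s')].

End Encodings.

(* Main.v *)
(** For a vertex t, the members of F not covered by J whose inner part contains
    t are closed under intersection and union up to reversing the orientation,
    so a primal-dual procedure with reverse deletion covers them at a cost of at
    most the LP value of the edges covering one of them.  Let T be a minimal
    transversal of the inner parts of the members not covered by J.  An edge
    covers members meeting T in t alone for at most one t, hence some t costs at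
    most LP/|T|; removing t from T and repeating covers everything at cost
    (1 + 1/2 + ... + 1/|T|) LP.  With J empty this gives (i), since
    private members of the elements of T contain distinct cores.

    For (iii), J first covers enough small members.  Start with R = V and, while
    some c in R is thin (no uncovered member meeting R in c alone has between
    q + 1 and 2q inner vertices), pay for the uncovered members with at most q
    inner vertices meeting R in c alone, and remove c from R.  By k-regularity,
    with 4q < n - k, the union of the families paid for is closed under
    intersection and union of intersecting members, so after one reverse deletion the cost is at most LP, while
    pairwise disjoint uncovered members with at most q inner vertices number at
    most 2n/q: each either meets R in a fat vertex or extends to a private
    uncovered set of more than q inner vertices.  After doing the same for the
    co-family, the remaining private members are disjoint rectangles of area
    more than q^2 in V x V, so |T| = O((n/q)^2) with q of order n - k.

    For (ii), if moreover |S^+ \ S| = k, one covers in each round, at cost LP,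
    all members containing a single core.  A small survivor contains two
    disjoint old cores, so the least size of a small member doubles; alternating
    with the co-family, O(log (n - k)) rounds suffice. *)

Require Import Defs.
From mathcomp Require Import all_boot all_order all_algebra.
From mathcomp Require Import all_classical all_reals all_analysis.
From mathcomp Require Import zify ring lra.
From mathcomp Require Import fintype finset.
Set Implicit Arguments.
Unset Strict Implicit.
Unset Printing Implicit Defensive.
Import Order.TTheory GRing.Theory Num.Theory.
Local Open Scope nat_scope.

(** * Families of functions computable in polynomial time *)

(** Thinness makes a size bound survive unions. Two intersecting members with at most [q] inner
    vertices have a union with at most [2q] of them; at a thin vertex no uncovered member meeting
    [R] there alone lies in the gap between, so the union falls back to at most [q]. A fat vertex
    keeps a member from the gap, and such members of different fat vertices are disjoint, so there
    are few. All pieces share one dual solution: reduced costs carry over from piece to piece and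
    edges are deleted only once, at the end. Paying for each piece separately would cost LP per
    piece. The delicate point is hence that pieces created at different times have a union closed
    under intersection and union of intersecting members. The program is told neither [k] nor which
    case applies: it completes every candidate partial cover and returns the cheapest result. The
    guarantee is shown against every feasible fractional solution and passes to the infimum.
    Iterating a polynomial-time step need not be polynomial, so each loop comes with an invariant
    bounding its state, including the bit length of the reduced costs. *)

Record inst := Inst {
  nv : nat;
  Fm : {set biset 'I_nv};
  Ed : {set 'I_nv * 'I_nv};
  icst : 'I_nv * 'I_nv -> rat;
  Or : data -> data;
  inst_proper : proper_family Fm;
  inst_crossing : crossing Fm;
  inst_cost_ge0 : forall e, e \in Ed -> (0 <= icst e)%R;
  inst_oracle : core_oracle Fm Or;
  inst_cover : edge_cover Ed Fm
}.

Definition inst_data I := enc_instance (Ed I) (@icst I).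
Definition isz I := dsize (inst_data I).

Class Enc (A : inst -> Type) := enc : forall I, A I -> data.
Arguments enc {A Enc I} a.

Instance enc_of_vtx : Enc (fun I => 'I_(nv I)) := fun I v => enc_vertex v.
Instance enc_of_nat : Enc (fun=> nat) := fun I m => Leaf (Posz m).
Instance enc_of_int : Enc (fun=> int) := fun I z => Leaf z.
Instance enc_of_bool : Enc (fun=> bool) := fun I b => data_of_bool b.
Instance enc_of_set : Enc (fun I => {set 'I_(nv I)}) := fun I S => enc_set S.
Instance enc_of_pair A B (_ : Enc A) (_ : Enc B) : Enc (fun I => (A I * B I)%type) :=
  fun I p => Pair (enc p.1) (enc p.2).
Instance enc_of_option A (_ : Enc A) : Enc (fun I => option (A I)) :=
  fun I o => if o is Some x then Pair (Leaf 0) (enc x) else Leaf 0.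
Instance enc_of_seq A (_ : Enc A) : Enc (fun I => seq (A I)) :=
  fun I l => enc_seq enc l.

(* A program family indexed by its working variable [b]: it reads its argument
   from [b], leaves its result there and preserves the variables below [b];
   variable 0 always holds the instance. *)
Definition runs (I : inst) (P : nat -> program) (d d' : data) (T : nat) :=
  forall b s, 0 < b -> s 0 = inst_data I -> s b = d ->
  exists s' t, [/\ exec (Or I) (P b) s s' t, s' b = d',
    forall x, x < b -> s' x = s x & t <= T].

(** The summand 2 makes the base at least 2, so that sums, products and powers of polynomial bounds
    are again bounded by powers of the same base. *)
Definition bnd (I : inst) (d : data) := isz I + dsize d + 2.

(** The output size is bounded along with the time: under composition the second program is measured
    in the size of the first one's output. *)
Definition pt A B (_ : Enc A) (_ : Enc B) (f : forall I, A I -> B I) :=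
  exists (P : nat -> program) (k : nat), forall I a,
    dsize (enc (f I a)) <= bnd I (enc a) ^ k /\
    runs I P (enc a) (enc (f I a)) (bnd I (enc a) ^ k).
Arguments pt {A B _ _} f.

Lemma upd_eq s x d : upd s x d x = d. Proof. by rewrite /upd eqxx. Qed.
Lemma upd_ne s x y d : y != x -> upd s x d y = s y.
Proof. by rewrite /upd => /negbTE ->. Qed.

Ltac updt := repeat first [rewrite upd_eq | rewrite upd_ne; last by lia].

Lemma powD N a b i j : 2 <= N -> a <= N ^ i -> b <= N ^ j -> a + b <= N ^ (i + j + 1).
Proof.
move=> N2 ha hb.
have h1 : N ^ i <= N ^ (i + j) by rewrite leq_pexp2l //; lia.
have h2 : N ^ j <= N ^ (i + j) by rewrite leq_pexp2l //; lia.
by rewrite addn1 expnS; nia.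
Qed.
Lemma powM N a b i j : a <= N ^ i -> b <= N ^ j -> a * b <= N ^ (i + j).
Proof. by move=> ha hb; rewrite expnD leq_mul. Qed.
Lemma powC N a : 2 <= N -> a <= N ^ a.
Proof. by move=> N2; apply: ltnW (ltn_expl _ _). Qed.
Lemma powX N a i j : a <= N ^ i -> a ^ j <= N ^ (i * j).
Proof. by move=> h; rewrite expnM; case: j => // j; rewrite leq_exp2r. Qed.
Lemma powW N a i j : 2 <= N -> i <= j -> a <= N ^ i -> a <= N ^ j.
Proof. by move=> N2 ij /leq_trans; apply; rewrite leq_pexp2l //; lia. Qed.

Lemma bnd2 I d : 2 <= bnd I d. Proof. rewrite /bnd; lia. Qed.
Lemma bnd_isz I d : isz I <= bnd I d ^ 1. Proof. rewrite expn1 /bnd; lia. Qed.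
Lemma bnd_dsize I d : dsize d <= bnd I d ^ 1. Proof. rewrite expn1 /bnd; lia. Qed.
Lemma bnd_bnd I d d' k : dsize d' <= bnd I d ^ k -> bnd I d' <= bnd I d ^ (k + 2).
Proof.
move=> h; rewrite addn2 -addn1 -[k.+1]add1n.
have -> : bnd I d' = (isz I + 2) + dsize d' by rewrite /bnd; lia.
by apply: powD (bnd2 _ _) _ h; rewrite expn1 /bnd; lia.
Qed.
Lemma bnd_pow I d d' k j : dsize d' <= bnd I d ^ k -> bnd I d' ^ j <= bnd I d ^ ((k + 2) * j).
Proof. by move=> h; apply: powX; exact: bnd_bnd. Qed.

(** The exponent on the right is left as an existential variable, and the shape of the left-hand
    side builds it. *)
Ltac pw := lazymatch goal with
  | |- is_true ((_ + _)%N <= _) => eapply (@powD (bnd _ _)); [apply bnd2 | pw | pw]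
  | |- is_true ((_ * _)%N <= _) => eapply (@powM (bnd _ _)); pw
  | |- is_true (bnd _ _ ^ _ <= bnd _ _ ^ _) => first [apply leqnn | eapply bnd_pow; pw]
  | |- is_true (_ ^ _ <= _) => eapply (@powX (bnd _ _)); pw
  | |- is_true (isz _ <= _) => apply bnd_isz
  | |- is_true (dsize _ <= _) => first [eassumption | apply bnd_dsize]
  | |- _ => first [eassumption | eapply (@powC (bnd _ _)); apply bnd2]
  end.

(** * Composition, branching and bounded iteration *)

Section Basic.
Variables (A B C D : inst -> Type).
Context {eA : Enc A} {eB : Enc B} {eC : Enc C} {eD : Enc D}.

Lemma pt_ext (f g : forall I, A I -> B I) : (forall I a, f I a = g I a) -> pt f -> pt g.
Proof. by move=> fg [P [k h]]; exists P, k => I a; rewrite -fg. Qed.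

Lemma pt_id : pt (fun I (a : A I) => a).
Proof.
exists (fun b => Assign b (Var b)), 2 => I a; split.
  by apply: powW (bnd_dsize _ _); [exact: bnd2|].
move=> b s b0 s0 sb; exists (upd s b (s b)), (dsize (s b)).+1; split.
- by constructor.
- by updt.
- by move=> x xb; updt.
- rewrite sb /bnd; set N := isz I + _; have := @powC (N + 2) 1; nia.
Qed.

Lemma pt_comp (f : forall I, A I -> B I) (g : forall I, B I -> C I) :
  pt f -> pt g -> pt (fun I a => g I (f I a)).
Proof.
move=> [P [k hP]] [Q [j hQ]]; exists (fun b => Seq (P b) (Q b)).
eexists => I a; have [sf rf] := hP I a; have [sg rg] := hQ I (f I a); split.
  apply: leq_trans (sg) _; apply: leq_trans (bnd_pow _ sf) _.
  apply: (@powW _ _ _ (k + (k + 2) * j + 1 + 1 + 1)) (leqnn _); first exact: bnd2.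
  by lia.
move=> b s b0 s0 sb.
have [s1 [t1 [e1 v1 p1 h1]]] := rf b s b0 s0 sb.
have [s2 [t2 [e2 v2 p2 h2]]] := rg b s1 b0 (etrans (p1 _ b0) s0) v1.
exists s2, (t1 + t2).+1; split=> //; first exact: ExecSeq e1 e2.
  by move=> x xb; rewrite p2 ?p1.
have h3 := leq_trans h2 (bnd_pow j sf).
have := powD (bnd2 _ _) (powD (bnd2 _ _) h1 h3) (powC 1 (bnd2 I (enc a))).
by rewrite addn1.
Qed.

End Basic.

Section Prims.
Variables (A B C D : inst -> Type).
Context {eA : Enc A} {eB : Enc B} {eC : Enc C} {eD : Enc D}.

Lemma pt_expr (op : nat -> expr) (g : forall I, A I -> B I) k :
  (forall I a b s, s 0 = inst_data I -> s b = enc a -> eval_expr s (op b) = enc (g I a)) ->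
  (forall I a, dsize (enc (g I a)) <= bnd I (enc a) ^ k) -> pt g.
Proof.
move=> hop hs; exists (fun b => Assign b (op b)), (k + 1 + 1) => I a; split.
  by apply: powW (hs I a); [exact: bnd2 | lia].
move=> b s b0 s0 sb; exists (upd s b (eval_expr s (op b))), (dsize (eval_expr s (op b))).+1; split.
- by constructor.
- by updt; exact: hop s0 sb.
- by move=> x xb; updt.
- rewrite (hop _ _ _ _ s0 sb) -addn1.
  exact: powD (bnd2 _ _) (hs I a) (powC 1 (bnd2 _ _)).
Qed.

(** The operands are computed in [b+1] and [b+2], above the saved argument. A size bound additive in
    the operands covers pairing and all the arithmetic, multiplication included. *)
Lemma pt_op2 (op : expr -> expr -> expr) (F : data -> data -> data) m
    (f : forall I, A I -> B I) (g : forall I, A I -> C I) (h : forall I, B I -> C I -> D I) :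
  (forall s e1 e2, eval_expr s (op e1 e2) = F (eval_expr s e1) (eval_expr s e2)) ->
  (forall d1 d2, dsize (F d1 d2) <= dsize d1 + dsize d2 + m) ->
  (forall I x y, F (enc x) (enc y) = enc (h I x y)) ->
  pt f -> pt g -> pt (fun I a => h I (f I a) (g I a)).
Proof.
move=> hop hs hF [P [k hP]] [Q [j hQ]].
exists (fun b => Seq (Assign b.+1 (Var b)) (Seq (P b.+1) (Seq (Assign b.+2 (Var b))
  (Seq (Q b.+2) (Assign b (op (Var b.+1) (Var b.+2))))))).
have hT : exists K, forall I (a : A I), dsize (enc a) + 1 + (bnd I (enc a) ^ k + (dsize (enc a) + 1 +
    (bnd I (enc a) ^ j + (bnd I (enc a) ^ k + bnd I (enc a) ^ j + m + 1) + 1) + 1) + 1) + 1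
     <= bnd I (enc a) ^ K.
  by eexists => I a; pw.
case: hT => K hK; exists K => I a; have [sf rf] := hP I a; have [sg rg] := hQ I a.
have hD : dsize (enc (h I (f I a) (g I a))) <= bnd I (enc a) ^ k + bnd I (enc a) ^ j + m.
  rewrite -hF; apply: leq_trans (hs _ _) _; lia.
split; first by have := hK I a; lia.
move=> b s b0 s0 sb.
have [s1 [t1 [e1 v1 p1 h1]]] := rf b.+1 (upd s b.+1 (s b)) isT ltac:(by updt) ltac:(by updt).
have q1 : s1 b = enc a by rewrite p1 //; updt.
have [s2 [t2 [e2 v2 p2 h2]]] := rg b.+2 (upd s1 b.+2 (s1 b)) isT ltac:(by updt; rewrite p1 //; updt) ltac:(by updt).
eexists; eexists; split.
- eapply ExecSeq; first by eapply ExecAssign.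
  eapply ExecSeq; first exact: e1.
  eapply ExecSeq; first by eapply ExecAssign.
  eapply ExecSeq; first exact: e2.
  by eapply ExecAssign.
- updt; rewrite hop /= v2 p2 //; updt; rewrite v1; exact: hF.
- by move=> x xb; updt; rewrite p2; [updt; rewrite p1; [updt|lia]|lia].
- rewrite hop /= v2 p2 //; updt; rewrite v1 hF sb q1; apply: leq_trans (hK I a); lia.
Qed.

Lemma pt_if (c : forall I, A I -> bool) (f g : forall I, A I -> B I) :
  pt c -> pt f -> pt g -> pt (fun I a => if c I a then f I a else g I a).
Proof.
move=> [Q [j hQ]] [P [k hP]] [P' [k' hP']].
exists (fun b => Seq (Assign b.+1 (Var b)) (Seq (Q b.+1) (If (Var b.+1) (P b) (P' b)))).
have hT : exists K, forall I (a : A I), dsize (enc a) + 1 + (bnd I (enc a) ^ j + (bnd I (enc a) ^ k +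
    bnd I (enc a) ^ k' + 1) + 1) + 1 <= bnd I (enc a) ^ K by eexists => I a; pw.
case: hT => K hK; exists K => I a.
have [sc rc] := hQ I a; have [sf rf] := hP I a; have [sg rg] := hP' I a.
split; first by have := hK I a; case: (c I a) => /=; lia.
move=> b s b0 s0 sb.
have [s1 [t1 [e1 v1 p1 h1]]] := rc b.+1 (upd s b.+1 (s b)) isT ltac:(by updt) ltac:(by updt).
have q0 : s1 0 = inst_data I by rewrite p1 //; updt.
have q1 : s1 b = enc a by rewrite p1 //; updt.
have : exists s' t, [/\ exec (Or I) (if c I a then P b else P' b) s1 s' t,
    s' b = enc (if c I a then f I a else g I a), (forall x, x < b -> s' x = s1 x) &
    t <= bnd I (enc a) ^ k + bnd I (enc a) ^ k'].
  case: (c I a); [have := rf b s1 b0 q0 q1 | have := rg b s1 b0 q0 q1];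
  by move=> [s' [t [? ? ? ?]]]; exists s', t; split=> //; lia.
case=> s2 [t2 [e2 v2 p2 h2]].
exists s2; eexists; split; [|exact: v2| |].
- eapply ExecSeq; first by eapply ExecAssign.
  eapply ExecSeq; first exact: e1.
  eapply ExecIf.
  have -> : truthy (eval_expr s1 (Var b.+1)) = c I a by rewrite /= v1; case: (c I a).
  exact: e2.
- by move=> x xb; rewrite p2 // p1; [updt|lia].
- rewrite /= sb; apply: leq_trans (hK I a); lia.
Qed.

(** In the [Some] branch the variable [b] is overwritten by the pair of argument and payload, so the
    branch is an ordinary family on pairs. [IsPair] separates the constructors because [None] is
    encoded by a leaf. *)
Lemma pt_omatch (o : forall I, A I -> option (B I)) (f : forall I, A I -> B I -> C I)
    (g : forall I, A I -> C I) :
  pt o -> pt (fun I (p : A I * B I) => f I p.1 p.2) -> pt g ->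
  pt (fun I a => if o I a is Some x then f I a x else g I a).
Proof.
move=> [Q [j hQ]] [P [k hP]] [P' [k' hP']].
exists (fun b => Seq (Assign b.+1 (Var b)) (Seq (Q b.+1) (If (IsPair (Var b.+1))
   (Seq (Assign b (MkPair (Var b) (Snd (Var b.+1)))) (P b)) (P' b)))).
have hT : exists K, forall I (a : A I), dsize (enc a) + 1 + (bnd I (enc a) ^ j +
   ((dsize (enc a) + bnd I (enc a) ^ j + 1 + 1 + bnd I (enc a) ^ ((1 + j + 1 + 1 + 1 + 2) * k) + 1) +
    bnd I (enc a) ^ k' + 1) + 1) + 1 <= bnd I (enc a) ^ K by eexists => I a; pw.
case: hT => K hK; exists K => I a.
have [sc rc] := hQ I a; have [sg rg] := hP' I a.
have hx2 x : o I a = Some x -> dsize (enc (a, x)) <= dsize (enc a) + bnd I (enc a) ^ j + 1.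
  move=> ox; have : dsize (enc (o I a)) <= bnd I (enc a) ^ j by [].
  rewrite ox /= => hj; lia.
have hx x : o I a = Some x -> dsize (enc (a, x)) <= bnd I (enc a) ^ (1 + j + 1 + 1 + 1).
  move=> /hx2 /leq_trans; apply.
  exact: powD (bnd2 _ _) (powD (bnd2 _ _) (bnd_dsize _ _) (leqnn _)) (powC 1 (bnd2 _ _)).
split.
  have := hK I a; case E : (o I a) => [x|] /=; last by lia.
  have [sf _] := hP I (a, x); have := leq_trans sf (bnd_pow k (hx _ E)) => /=; lia.
move=> b s b0 s0 sb.
have [s1 [t1 [e1 v1 p1 h1]]] := rc b.+1 (upd s b.+1 (s b)) isT ltac:(by updt) ltac:(by updt).
have q0 : s1 0 = inst_data I by rewrite p1 //; updt.
have q1 : s1 b = enc a by rewrite p1 //; updt.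
have : exists s' t, [/\ exec (Or I) (if isSome (o I a) then
      Seq (Assign b (MkPair (Var b) (Snd (Var b.+1)))) (P b) else P' b) s1 s' t,
    s' b = enc (if o I a is Some x then f I a x else g I a), (forall x, x < b -> s' x = s1 x) &
    t <= (dsize (enc a) + bnd I (enc a) ^ j + 1 + 1 + bnd I (enc a) ^ ((1 + j + 1 + 1 + 1 + 2) * k) + 1) + bnd I (enc a) ^ k'].
  case E : (o I a) => [x|] /=; last first.
    by have [s' [t [? ? ? ?]]] := rg b s1 b0 q0 q1; exists s', t; split=> //; lia.
  have [sf rf] := hP I (a, x).
  have q2 : eval_expr s1 (MkPair (Var b) (Snd (Var b.+1))) = enc (a, x).
    by rewrite /= q1 v1 E.
  have u0 : upd s1 b (enc (a, x)) 0 = inst_data I by rewrite upd_ne //; lia.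
  have [s2 [t2 [e2 v2 p2 h2]]] := rf b (upd s1 b (enc (a, x))) b0 u0 (upd_eq _ _ _).
  exists s2; eexists; split.
  - by eapply ExecSeq; [eapply ExecAssign | rewrite q2; exact: e2].
  - by [].
  - by move=> y yb; rewrite p2 //; updt.
  - rewrite q2; have := leq_trans h2 (bnd_pow k (hx _ E)); have := hx2 _ E; lia.
case=> s2 [t2 [e2 v2 p2 h2]].
exists s2; eexists; split; [|exact: v2| |].
- eapply ExecSeq; first by eapply ExecAssign.
  eapply ExecSeq; first exact: e1.
  eapply ExecIf.
  have -> : truthy (eval_expr s1 (IsPair (Var b.+1))) = isSome (o I a).
    by rewrite /= v1; case: (o I a).
  exact: e2.
- by move=> x xb; rewrite p2 // p1; [updt|lia].
- rewrite /= sb; apply: leq_trans (hK I a); lia.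
Qed.

End Prims.

Lemma enc_seq_size T (f : T -> data) (l : seq T) : size l < dsize (enc_seq f l).
Proof. by elim: l => //= x l IH; lia. Qed.
Lemma enc_seq_le T (f : T -> data) (l : seq T) x : List.In x l -> dsize (f x) < dsize (enc_seq f l).
Proof. by elim: l => //= y l IH [->|/IH]; lia. Qed.

Section Foldl.
Variables (A X S : inst -> Type).
Context {eA : Enc A} {eX : Enc X} {eS : Enc S}.
Variables (step : forall I, A I -> S I -> X I -> S I).

(** Layout: [b] holds the argument, [b+1] the accumulator, [b+2] the rest of the list, and [b+3]
    serves the call of the step. *)
Lemma foldl_loop (P : nat -> program) (k : nat) I (a : A I) M L b :
  0 < b ->
  (forall p : A I * (S I * X I),
    runs I P (enc p) (enc (step p.1 p.2.1 p.2.2)) (bnd I (enc p) ^ k)) ->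
  forall r acc s, s 0 = inst_data I -> s b = enc a -> s b.+1 = enc acc -> s b.+2 = enc r ->
  dsize (enc r) <= L ->
  (forall i, dsize (enc (foldl (step a) acc (take i r))) <= M) ->
  exists s' t, [/\ exec (Or I) (While (IsPair (Var b.+2))
     (Seq (Assign b.+3 (MkPair (Var b) (MkPair (Var b.+1) (Fst (Var b.+2)))))
     (Seq (P b.+3) (Seq (Assign b.+1 (Var b.+3)) (Assign b.+2 (Snd (Var b.+2))))))) s s' t,
   s' b.+1 = enc (foldl (step a) acc r), (forall x, x <= b -> s' x = s x) &
   t <= size r * ((dsize (enc a) + (M + L + 1) + 1) + (isz I + (dsize (enc a) + (M + L + 1)) + 2) ^ k + M + L + 7) + 1].
Proof.
move=> b0 hP; elim=> [|x r IH] acc s s0 sb s1 s2 hL hM.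
  exists s, 1; split=> //; eapply ExecWhileStop => /=; by rewrite s2.
have hacc : dsize (enc acc) <= M by have := hM 0.
have hL' : dsize (enc x) + dsize (enc r) < L by exact: hL.
set p := (a, (acc, x)).
have ep : eval_expr s (MkPair (Var b) (MkPair (Var b.+1) (Fst (Var b.+2)))) = enc p.
  by rewrite /= sb s1 s2.
have sp : dsize (enc p) <= dsize (enc a) + (M + L + 1).
  rewrite /p /=; move: hacc hL'; lia.
have u0 : upd s b.+3 (enc p) 0 = inst_data I by updt.
have [s3 [t3 [e3 v3 p3 h3]]] := hP p b.+3 (upd s b.+3 (enc p)) isT u0 (upd_eq _ _ _).
have hstep : dsize (enc (step a acc x)) <= M by have := hM 1; rewrite /= take0.
set s4 := upd s3 b.+1 (enc (step a acc x)).
set s5 := upd s4 b.+2 (enc r).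
have v32 : s3 b.+2 = enc (x :: r) by rewrite p3 //; updt.
have [||||||s6 [t6 [e6 v6 p6 h6]]] := IH (step a acc x) s5.
- by rewrite /s5 /s4; updt; rewrite p3 //; updt.
- by rewrite /s5 /s4; updt; rewrite p3; [updt|lia].
- by rewrite /s5 /s4; updt.
- by rewrite /s5; updt.
- by lia.
- by move=> i; have := hM i.+1.
exists s6; eexists; split.
- eapply ExecWhileStep; first by rewrite /= s2.
    eapply ExecSeq; first by eapply ExecAssign.
    rewrite ep; eapply ExecSeq; first exact: e3.
    eapply ExecSeq; first by eapply ExecAssign.
    by eapply ExecAssign.
  have -> : upd (upd s3 b.+1 (eval_expr s3 (Var b.+3))) b.+2
     (eval_expr (upd s3 b.+1 (eval_expr s3 (Var b.+3))) (Snd (Var b.+2))) = s5.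
    by rewrite /s5 /s4 /=; updt; rewrite v3 v32.
  exact: e6.
- by rewrite v6.
- move=> y yb; rewrite p6 // /s5 /s4; updt; rewrite p3; [updt|lia].
  by rewrite //.
- have -> : eval_expr s3 (Var b.+3) = enc (step a acc x) by rewrite /= v3.
  have -> : eval_expr (upd s3 b.+1 (enc (step a acc x))) (Snd (Var b.+2)) = enc r.
    by rewrite /=; updt; rewrite v32.
  rewrite ep.
  have hb : bnd I (enc p) ^ k <= (isz I + (dsize (enc a) + (M + L + 1)) + 2) ^ k.
    by case: (k) => // k'; rewrite leq_exp2r // /bnd; lia.
  have h3' := leq_trans h3 hb.
  move: h6 h3' sp hstep hL'; rewrite [size (x :: r)]/= mulSn; set Z := _ ^ k.
  set W := (_ + 7)%N; set sr := dsize (enc r); move: (size r * W) => Y; rewrite /W; lia.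
Qed.

(** A polynomial step may still square the size of its accumulator, so a bound for the accumulator
    after every prefix is a hypothesis; each loop of the algorithm supplies it from an invariant of
    its own. *)
Lemma pt_foldl (f0 : forall I, A I -> S I) (l : forall I, A I -> seq (X I)) m :
  pt (fun I (p : A I * (S I * X I)) => step p.1 p.2.1 p.2.2) -> pt f0 -> pt l ->
  (forall I a i, dsize (enc (foldl (step a) (f0 I a) (take i (l I a)))) <= bnd I (enc a) ^ m) ->
  pt (fun I a => foldl (step a) (f0 I a) (l I a)).
Proof.
move=> [P [k hP]] [P0 [k0 hP0]] [Pl [kl hPl]] hM.
exists (fun b => Seq (Assign b.+1 (Var b)) (Seq (P0 b.+1) (Seq (Assign b.+2 (Var b)) (Seq (Pl b.+2)
  (Seq (While (IsPair (Var b.+2))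
     (Seq (Assign b.+3 (MkPair (Var b) (MkPair (Var b.+1) (Fst (Var b.+2)))))
     (Seq (P b.+3) (Seq (Assign b.+1 (Var b.+3)) (Assign b.+2 (Snd (Var b.+2)))))))
  (Assign b (Var b.+1))))))).
have hT : exists K, forall I (a : A I), let N := bnd I (enc a) in
  dsize (enc a) + 1 + (N ^ k0 + (dsize (enc a) + 1 + (N ^ kl + (
   (N ^ kl * ((dsize (enc a) + (N ^ m + N ^ kl + 1) + 1) + (isz I + (dsize (enc a) + (N ^ m + N ^ kl + 1)) + 2) ^ k + N ^ m + N ^ kl + 7) + 1)
   + (N ^ m + 2) + 1) + 1) + 1) + 1) + 1 <= N ^ K.
  eexists => I a; cbv zeta; pw.
case: hT => K hK; exists K => I a; have := hK I a; set N := bnd I (enc a) => /= hKa.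
have [s0' r0] := hP0 I a; have [sl rl] := hPl I a.
have hMf : dsize (enc (foldl (step a) (f0 I a) (l I a))) <= N ^ m.
  by have := hM I a (size (l I a)); rewrite take_size.
split; first by move: hMf hKa; rewrite -/N; lia.
move=> b s b0 s0 sb.
have [s1 [t1 [e1 v1 p1 h1]]] := r0 b.+1 (upd s b.+1 (s b)) isT ltac:(by updt) ltac:(by updt).
have q1 : s1 b = enc a by rewrite p1 //; updt.
have [s2 [t2 [e2 v2 p2 h2]]] := rl b.+2 (upd s1 b.+2 (s1 b)) isT ltac:(by updt; rewrite p1 //; updt) ltac:(by updt).
have [|||||||s3 [t3 [e3 v3 p3 h3]]] := @foldl_loop P k I a (N ^ m) (N ^ kl) b b0 _ (l I a) (f0 I a) s2.
- by move=> p; have [] := hP I p.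
- by rewrite p2 //; updt; rewrite p1 //; updt.
- by rewrite p2 //; updt.
- by rewrite p2 //; updt.
- by rewrite v2.
- by apply: leq_trans sl _.
- by move=> i; exact: hM.
exists (upd s3 b (s3 b.+1)); eexists; split.
- eapply ExecSeq; first by eapply ExecAssign.
  eapply ExecSeq; first exact: e1.
  eapply ExecSeq; first by eapply ExecAssign.
  eapply ExecSeq; first exact: e2.
  eapply ExecSeq; first exact: e3.
  by eapply ExecAssign.
- by updt.
- by move=> x xb; updt; rewrite p3 ?p2; [updt; rewrite p1; [updt|lia]|lia|lia].
- rewrite /= v3 sb q1; apply: leq_trans (hKa).
  have hsz : size (l I a) <= N ^ kl by apply: ltnW (leq_trans (enc_seq_size _ _) sl).
  move: h3; set W := (_ + 7)%N => h3.
  have h3' : t3 <= N ^ kl * W + 1 by apply: leq_trans h3 _; rewrite leq_add2r leq_mul2r hsz orbT.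
  move: h1 h2 hKa h3' hMf; rewrite -/N -/W; move: (N ^ kl * W) => Y.
  move: (N ^ k0) (N ^ kl) (N ^ m) (N ^ K) => k1 k2 k3 k4.
  move: (dsize (enc a)) (dsize (enc (foldl (step a) (f0 I a) (l I a)))) => x y.
  clear; lia.
Qed.

End Foldl.

Lemma dsize_gt0 d : 0 < dsize d. Proof. by case: d. Qed.

Lemma dsize_nat m : dsize (Leaf (Posz m)) <= m.+1.
Proof.
rewrite /= ltnS; case: m => // m.
by apply: leq_trans (trunc_logP (isT : 1 < 2) (ltn0Sn m)); apply: ltnW (ltn_expl _ _).
Qed.

Lemma dsize_enc_seq T (f : T -> data) l :
  dsize (enc_seq f l) = sumn [seq (dsize (f x)).+1 | x <- l] + 1.
Proof. by elim: l => //= x l ->; lia. Qed.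

Lemma enc_seq_bound (T : Type) (f : T -> data) (l : seq T) M :
  (forall x, List.In x l -> dsize (f x) <= M) -> dsize (enc_seq f l) <= size l * M.+1 + 1.
Proof.
rewrite dsize_enc_seq leq_add2r; elim: l => //= x l IH h.
rewrite mulSn leq_add ?ltnS //; first by apply: h; left.
by apply: IH => y hy; apply: h; right.
Qed.

Lemma In_take T (x : T) i l : List.In x (take i l) -> List.In x l.
Proof. by elim: l i => [|y l IH] [|i] //= [->|/IH]; [left|right]. Qed.

(** * Constants, tuples and integer arithmetic *)

Section Lits.
Variable A : inst -> Type.
Context {eA : Enc A}.

Lemma pt_lit (B : inst -> Type) (eB : Enc B) (z : int) (g : forall I, A I -> B I) :
  (forall I a, enc (g I a) = Leaf z) -> pt g.
Proof.
move=> h; apply: (@pt_expr _ _ _ _ (fun=> Lit z) _ (dsize (Leaf z))) => I a; first by move=> b s _ _; rewrite h.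
rewrite h; exact: powC (bnd2 _ _).
Qed.
Lemma pt_nat (m : nat) : pt (fun I (_ : A I) => m). Proof. by apply: (pt_lit (z := Posz m)) => I a. Qed.
Lemma pt_int (z : int) : pt (fun I (_ : A I) => z). Proof. by apply: (pt_lit (z := z)) => I a. Qed.
Lemma pt_bool (b : bool) : pt (fun I (_ : A I) => b).
Proof. by apply: (pt_lit (z := (if b then 1 else 0)%R)) => I a. Qed.
Lemma pt_nil (B : inst -> Type) (eB : Enc B) : pt (fun I (_ : A I) => [::] : seq (B I)).
Proof. by apply: (pt_lit (z := Posz 0)) => I a. Qed.
Lemma pt_none (B : inst -> Type) (eB : Enc B) : pt (fun I (_ : A I) => None : option (B I)).
Proof. by apply: (pt_lit (z := Posz 0)) => I a. Qed.

Variables (B C D : inst -> Type).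
Context {eB : Enc B} {eC : Enc C} {eD : Enc D}.

Lemma pt_pair (f : forall I, A I -> B I) (g : forall I, A I -> C I) :
  pt f -> pt g -> pt (fun I a => (f I a, g I a)).
Proof.
apply: (@pt_op2 _ _ _ _ _ _ _ _ MkPair Pair 1 f g (fun I x y => (x, y))) => // d1 d2 /=; lia.
Qed.
Lemma pt_cons (f : forall I, A I -> B I) (g : forall I, A I -> seq (B I)) :
  pt f -> pt g -> pt (fun I a => f I a :: g I a).
Proof.
apply: (@pt_op2 _ _ _ _ _ _ _ _ MkPair Pair 1 f g (fun I x y => x :: y)) => // d1 d2 /=; lia.
Qed.
Lemma pt_some (f : forall I, A I -> B I) : pt f -> pt (fun I a => Some (f I a)).
Proof.
move=> hf; apply: (pt_comp (g := fun I (p : B I) => Some p) hf).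
apply: (@pt_expr _ _ _ _ (fun b => MkPair (Lit 0) (Var b)) _ 1) => I a; first by move=> b s _ /= ->.
rewrite expn1 /bnd /= ?trunc_log0; lia.
Qed.
Lemma pt_fst (f : forall I, A I -> B I * C I) : pt f -> pt (fun I a => (f I a).1).
Proof.
move=> hf; apply: (pt_comp (g := fun I (p : B I * C I) => p.1) hf).
apply: (@pt_expr _ _ _ _ (fun b => Fst (Var b)) _ 1) => I a; first by move=> b s _ /= ->.
rewrite expn1 /bnd /= ?trunc_log0; lia.
Qed.
Lemma pt_snd (f : forall I, A I -> B I * C I) : pt f -> pt (fun I a => (f I a).2).
Proof.
move=> hf; apply: (pt_comp (g := fun I (p : B I * C I) => p.2) hf).
apply: (@pt_expr _ _ _ _ (fun b => Snd (Var b)) _ 1) => I a; first by move=> b s _ /= ->.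
rewrite expn1 /bnd /= ?trunc_log0; lia.
Qed.

Lemma pt_negb (f : forall I, A I -> bool) : pt f -> pt (fun I a => ~~ f I a).
Proof.
move=> hf; apply: (pt_ext (f := fun I a => if f I a then false else true)).
  by move=> I a; case: (f I a).
by apply: pt_if hf (pt_bool _) (pt_bool _).
Qed.
Lemma pt_andb (f g : forall I, A I -> bool) : pt f -> pt g -> pt (fun I a => f I a && g I a).
Proof. by move=> hf hg; apply: pt_if hf hg (pt_bool _). Qed.

Lemma absz_dsize (z : int) : `|z| < 2 ^ dsize (Leaf z).
Proof. by rewrite /=; case: `|z|%N => // m; apply: trunc_log_ltn. Qed.
Lemma dsize_log (z : int) m : (`|z| < 2 ^ m)%N -> dsize (Leaf z) <= m.+1.
Proof.
rewrite /= ltnS => h; case: (posnP `|z|%N) => [->|z0]; first by [].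
have h1 := leq_ltn_trans (trunc_logP (isT : 1 < 2) z0) h.
by rewrite ltn_exp2l // in h1; apply: ltnW.
Qed.

Lemma pt_add (f g : forall I, A I -> int) : pt f -> pt g -> pt (fun I a => (f I a + g I a)%R).
Proof.
apply: (@pt_op2 _ _ _ _ _ _ _ _ Defs.Add (fun d1 d2 => Leaf (int_of d1 + int_of d2)%R) 1 f g (fun I x y => (x + y)%R)) => // d1 d2.
have h d : `|int_of d|%N < 2 ^ dsize d by case: d => [z|a b] /=; [exact: absz_dsize|rewrite expn_gt0].
have hs : absz (int_of d1 + int_of d2)%R < 2 ^ (dsize d1 + dsize d2).
  have := h d1; have := h d2; have := dsize_gt0 d1; have := dsize_gt0 d2.
  move: (dsize d1) (dsize d2) => [|m1] [|m2] // _ _ h2 h1.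
  apply: leq_ltn_trans (_ : `|int_of d1| + `|int_of d2| < _)%N; first by lia.
  rewrite expnD; move: h1 h2; rewrite !expnS.
  have := expn_gt0 2 m1; have := expn_gt0 2 m2; move: (2 ^ m1) (2 ^ m2); nia.
by apply: leq_trans (dsize_log hs) _; lia.
Qed.
Lemma pt_sub (f g : forall I, A I -> int) : pt f -> pt g -> pt (fun I a => (f I a - g I a)%R).
Proof.
apply: (@pt_op2 _ _ _ _ _ _ _ _ Defs.Sub (fun d1 d2 => Leaf (int_of d1 - int_of d2)%R) 1 f g (fun I x y => (x - y)%R)) => // d1 d2.
have h d : `|int_of d|%N < 2 ^ dsize d by case: d => [z|a b] /=; [exact: absz_dsize|rewrite expn_gt0].
have hs : absz (int_of d1 - int_of d2)%R < 2 ^ (dsize d1 + dsize d2).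
  have := h d1; have := h d2; have := dsize_gt0 d1; have := dsize_gt0 d2.
  move: (dsize d1) (dsize d2) => [|m1] [|m2] // _ _ h2 h1.
  apply: leq_ltn_trans (_ : `|int_of d1| + `|int_of d2| < _)%N; first by lia.
  rewrite expnD; move: h1 h2; rewrite !expnS.
  have := expn_gt0 2 m1; have := expn_gt0 2 m2; move: (2 ^ m1) (2 ^ m2); nia.
by apply: leq_trans (dsize_log hs) _; lia.
Qed.
Lemma pt_mul (f g : forall I, A I -> int) : pt f -> pt g -> pt (fun I a => (f I a * g I a)%R).
Proof.
apply: (@pt_op2 _ _ _ _ _ _ _ _ Defs.Mul (fun d1 d2 => Leaf (int_of d1 * int_of d2)%R) 1 f g (fun I x y => (x * y)%R)) => // d1 d2.
have h d : `|int_of d|%N < 2 ^ dsize d by case: d => [z|a b] /=; [exact: absz_dsize|rewrite expn_gt0].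
have hs : absz (int_of d1 * int_of d2)%R < 2 ^ (dsize d1 + dsize d2).
  by rewrite abszM expnD ltn_mul.
by apply: leq_trans (dsize_log hs) _; lia.
Qed.
Lemma pt_lez (f g : forall I, A I -> int) : pt f -> pt g -> pt (fun I a => (f I a <= g I a)%R).
Proof.
apply: (@pt_op2 _ _ _ _ _ _ _ _ Defs.Le (fun d1 d2 => data_of_bool (int_of d1 <= int_of d2)%R) 2 f g (fun I x y => (x <= y)%R)) => // d1 d2.
by case: (_ <= _)%R; rewrite /= ?trunc_log0 ?trunc_log1; lia.
Qed.
(** Naturals, vertices and sets share their encodings with integers, naturals and lists, so this
    coercion and the next two are copying programs. *)
Lemma pt_intn (f : forall I, A I -> nat) : pt f -> pt (fun I a => Posz (f I a)).
Proof.
move=> hf; apply: (pt_comp (g := fun I (p : nat) => Posz p) hf).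
apply: (@pt_expr _ _ _ _ (fun b => Var b) _ 1) => I a; first by move=> b s _ /= ->.
by rewrite expn1 /bnd -/(dsize (enc a)); apply: leq_trans (leq_addr _ _); apply: leq_addl.
Qed.
Lemma pt_vtxn (f : forall I, A I -> 'I_(nv I)) : pt f -> pt (fun I a => nat_of_ord (f I a)).
Proof.
move=> hf; apply: (pt_comp (g := fun I (p : 'I_(nv I)) => nat_of_ord p) hf).
apply: (@pt_expr _ _ _ _ (fun b => Var b) _ 1) => I a; first by move=> b s _ /= ->.
by rewrite expn1 /bnd -/(dsize (enc a)); apply: leq_trans (leq_addr _ _); apply: leq_addl.
Qed.
Lemma pt_enum (f : forall I, A I -> {set 'I_(nv I)}) : pt f -> pt (fun I a => enum (f I a)).
Proof.
move=> hf; apply: (pt_comp (g := fun I (p : {set 'I_(nv I)}) => enum p) hf).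
apply: (@pt_expr _ _ _ _ (fun b => Var b) _ 1) => I a; first by move=> b s _ /= ->.
by rewrite expn1 /bnd -/(dsize (enc a)); apply: leq_trans (leq_addr _ _); apply: leq_addl.
Qed.
End Lits.

(** Ties go to the earliest element, so a constant key returns the head of the list; [ohd] is
    obtained this way. *)
Definition argmin T (key : T -> int) (l : seq T) : option T :=
  foldl (fun acc x => if acc is Some y then if (key y <= key x)%R then acc else Some x
                      else Some x) None l.

Lemma argmin_In T (key : T -> int) l x : argmin key l = Some x -> List.In x l.
Proof.
rewrite /argmin; set stp := (fun acc _ => _).
suff h acc : foldl stp acc l = Some x -> acc = Some x \/ List.In x l.
  by move=> /h [].
elim: l acc => [|y l IH] acc /=; first by left.
case/IH => [|h]; last by right; right.
rewrite /stp; case: acc => [z|]; last by case=> ->; right; left.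
by case: ifP => _; [left | case=> ->; right; left].
Qed.

Lemma foldl_cons_map T U (f : U -> T) (acc : seq T) s :
  foldl (fun acc x => f x :: acc) acc s = rev (map f s) ++ acc.
Proof. by elim: s acc => //= x s IH acc; rewrite IH rev_cons -cats1 -catA. Qed.
Lemma foldl_cons_rev T (acc s : seq T) : foldl (fun acc x => x :: acc) acc s = rev s ++ acc.
Proof. by have := foldl_cons_map id acc s; rewrite map_id. Qed.

Lemma dsize_enc_rev T (f : T -> data) s : dsize (enc_seq f (rev s)) = dsize (enc_seq f s).
Proof. by rewrite !dsize_enc_seq map_rev sumn_rev. Qed.
Lemma dsize_enc_take T (f : T -> data) i s : dsize (enc_seq f (take i s)) <= dsize (enc_seq f s).
Proof. rewrite !dsize_enc_seq -{2}(cat_take_drop i s) map_cat sumn_cat; lia. Qed.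
Lemma dsize_enc_cat T (f : T -> data) s t : dsize (enc_seq f (s ++ t)) <= dsize (enc_seq f s) + dsize (enc_seq f t).
Proof. rewrite !dsize_enc_seq map_cat sumn_cat; lia. Qed.

Ltac ptp := first [eapply pt_id | eapply pt_fst; ptp | eapply pt_snd; ptp].

(** * Lists, searches and finite sets *)

Section Lists.
Variables A X Y : inst -> Type.
Context {eA : Enc A} {eX : Enc X} {eY : Enc Y}.

Lemma pt_map (h : forall I, A I -> X I -> Y I) (l : forall I, A I -> seq (X I)) :
  pt (fun I (p : A I * X I) => h I p.1 p.2) -> pt l -> pt (fun I a => [seq h I a x | x <- l I a]).
Proof.
move=> hh hl.
have hr : pt (fun I a => foldl (fun acc x => h I a x :: acc) [::] (l I a)).
  have [P [k hP]] := hh; have [Q [kl hQ]] := hl.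
  have [m hm] : exists m, forall I (a : A I), bnd I (enc a) ^ kl *
      (bnd I (enc a) ^ ((1 + kl + 1 + 1 + 1 + 2) * k) + 1) + 1 <= bnd I (enc a) ^ m.
    by eexists => I a; pw.
  apply: (@pt_foldl A X (fun I => seq (Y I)) _ _ _ (fun I a acc x => h I a x :: acc) (fun I _ => [::]) l m) => //.
  - apply: pt_cons; last ptp.
    apply: (pt_comp (g := fun I (p : A I * X I) => h I p.1 p.2) (f := fun I (p : A I * (seq (Y I) * X I)) => (p.1, p.2.2))) hh.
    by apply: pt_pair; [ptp | ptp].
  - exact: pt_nil.
  - move=> I a i; apply: leq_trans (hm I a).
    have [sl _] := hQ I a.
    rewrite foldl_cons_map cats0 [dsize _]dsize_enc_rev.
    have szl : size (l I a) < dsize (enc (l I a)) by exact: enc_seq_size.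
    apply: leq_trans (enc_seq_bound (M := bnd I (enc a) ^ ((1 + kl + 1 + 1 + 1 + 2) * k)) _) _; last first.
      rewrite leq_add2r; apply: leq_mul; last by rewrite [_ + 1 in X in _ <= X]addn1.
      rewrite size_map size_take; apply: leq_trans (ltnW (leq_trans szl sl)).
      by case: ifP => // /ltnW.
    move=> y; rewrite List.in_map_iff => -[x [<- hx0]]; have hx := In_take hx0.
    have [sh _] := hP I (a, x); apply: leq_trans sh _; apply: bnd_pow.
    have -> : dsize (enc (a, x)) = dsize (enc a) + dsize (enc x) + 1 by rewrite addn1.
    apply: powW (powD (bnd2 _ _) (powD (bnd2 _ _) (bnd_dsize I (enc a)) (_ : _ <= _ ^ kl)) (powC 1 (bnd2 _ _))); rewrite ?bnd2 ?leqnn //.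
    by apply: ltnW; apply: leq_trans sl; exact: (enc_seq_le (@enc _ eX I) hx).
(* The first loop leaves the results in reverse order; a second one restores it. *)
apply: (pt_ext (f := fun I a => foldl (fun acc x => x :: acc) [::] (foldl (fun acc x => h I a x :: acc) [::] (l I a)))).
  by move=> I a; rewrite foldl_cons_rev foldl_cons_map !cats0 revK.
have [P [k hP]] := hr.
apply: (@pt_foldl A Y (fun I => seq (Y I)) _ _ _ (fun I a acc x => x :: acc) (fun I _ => [::]) _ k) => //.
- by apply: pt_cons; ptp.
- exact: pt_nil.
- move=> I a i; have [s _] := hP I a; apply: leq_trans s.
  by rewrite foldl_cons_rev cats0 [dsize _]dsize_enc_rev; apply: dsize_enc_take.
Qed.

Lemma pt_rev (l : forall I, A I -> seq (X I)) : pt l -> pt (fun I a => rev (l I a)).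
Proof.
move=> hl; have [P [k hP]] := hl.
apply: (pt_ext (f := fun I a => foldl (fun acc x => x :: acc) [::] (l I a))).
  by move=> I a; rewrite foldl_cons_rev cats0.
apply: (@pt_foldl A X (fun I => seq (X I)) _ _ _ (fun I a acc x => x :: acc) (fun I _ => [::]) _ k) => //.
- by apply: pt_cons; ptp.
- exact: pt_nil.
- move=> I a i; have [s _] := hP I a; apply: leq_trans s.
  by rewrite foldl_cons_rev cats0 [dsize _]dsize_enc_rev; apply: dsize_enc_take.
Qed.

Lemma pt_cat (l1 l2 : forall I, A I -> seq (X I)) : pt l1 -> pt l2 -> pt (fun I a => l1 I a ++ l2 I a).
Proof.
move=> h1 h2; have [P1 [k1 hP1]] := h1; have [P2 [k2 hP2]] := h2.
apply: (pt_ext (f := fun I a => foldl (fun acc x => x :: acc) (l2 I a) (rev (l1 I a)))).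
  by move=> I a; rewrite foldl_cons_rev revK.
apply: (@pt_foldl A X (fun I => seq (X I)) _ _ _ (fun I a acc x => x :: acc) l2 _ (k1 + k2 + 1)) => //.
- by apply: pt_cons; ptp.
- exact: pt_rev.
- move=> I a i; have [s1 _] := hP1 I a; have [s2 _] := hP2 I a.
  apply: leq_trans (powD (bnd2 _ _) s1 s2).
  rewrite foldl_cons_rev; apply: leq_trans (dsize_enc_cat _ _ _) _; rewrite leq_add2r dsize_enc_rev.
  by apply: leq_trans (dsize_enc_take _ _ _) _; rewrite dsize_enc_rev.
Qed.

End Lists.

Section Lists1.
Variables A X Y : inst -> Type.
Context {eA : Enc A} {eX : Enc X} {eY : Enc Y}.

Lemma pt_flatten (l : forall I, A I -> seq (seq (X I))) : pt l -> pt (fun I a => flatten (l I a)).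
Proof.
move=> hl; have [P [k hP]] := hl.
apply: (pt_ext (f := fun I a => foldl (fun acc x => acc ++ x) [::] (l I a))).
  move=> I a; elim/last_ind: (l I a) => // t x IH.
  by rewrite foldl_rcons IH flatten_rcons.
apply: (@pt_foldl A (fun I => seq (X I)) (fun I => seq (X I)) _ _ _ (fun I a acc x => acc ++ x) (fun I _ => [::]) _ k) => //.
- by apply: pt_cat; [ptp | ptp].
- exact: pt_nil.
- move=> I a i; have [s _] := hP I a; apply: leq_trans s; move: (l I a) => s.
  have -> : foldl (fun acc x => acc ++ x) [::] (take i s) = flatten (take i s).
    by elim/last_ind: (take i s) => // t x IH; rewrite foldl_rcons IH flatten_rcons.
  rewrite -{2}(cat_take_drop i s) [X in _ <= X]dsize_enc_seq map_cat sumn_cat.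
  apply: leq_trans (_ : sumn [seq (dsize (enc x)).+1 | x <- take i s] + 1 <= _); last by lia.
  elim: (take i s) => // x t IH; rewrite [flatten _]/= [dsize _]dsize_enc_seq map_cat sumn_cat.
  move: IH; rewrite [dsize _]dsize_enc_seq /= => IH.
  have : dsize (enc x) = sumn [seq (dsize (enc y)).+1 | y <- x] + 1 by exact: dsize_enc_seq.
  move: IH; set s1 := sumn _; set s2 := sumn _; set s3 := sumn _; lia.
Qed.

Lemma pt_size (l : forall I, A I -> seq (X I)) : pt l -> pt (fun I a => size (l I a)).
Proof.
move=> hl; have [P [k hP]] := hl.
have pt_succ (f : forall I, A I * (nat * X I) -> nat) : pt f -> pt (fun I a => (f I a).+1).
  move=> hf; apply: (pt_comp (g := fun I (p : nat) => p.+1) hf).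
  apply: (@pt_expr _ _ _ _ (fun b => Defs.Add (Var b) (Lit 1)) _ 2) => I a.
    by move=> b s _ /= -> /=; rewrite /enc /enc_of_nat; congr Leaf; lia.
  have h : dsize (Leaf (Posz a.+1)) <= dsize (Leaf (Posz a)) + 1.
    have ha := absz_dsize (Posz a).
    have : absz (Posz a.+1) < 2 ^ (dsize (Leaf (Posz a))) \/ a.+1 = 2 ^ (dsize (Leaf (Posz a))).
      by move: ha; rewrite /=; lia.
    case=> [|->]; first by move/dsize_log; rewrite addn1.
    by rewrite /= trunc_expnK // addn1.
  apply: leq_trans h _; rewrite /bnd expnS expn1; set d := dsize _; nia.
apply: (pt_ext (f := fun I a => foldl (fun n x => n.+1) 0 (l I a))).
  by move=> I a; elim/last_ind: (l I a) => // t x IH; rewrite foldl_rcons IH size_rcons.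
apply: (@pt_foldl A X (fun=> nat) _ _ _ (fun I a n x => n.+1) (fun I _ => 0) _ k) => //.
- by apply: pt_succ; ptp.
- exact: pt_nat.
- move=> I a i; have [s _] := hP I a; apply: leq_trans s.
  have -> : foldl (fun n x => n.+1) 0 (take i (l I a)) = size (take i (l I a)).
    by elim/last_ind: (take i _) => // t x IH; rewrite foldl_rcons IH size_rcons.
  apply: leq_trans (dsize_nat _) _.
  have h : size (l I a) < dsize (enc (l I a)) by exact: enc_seq_size.
  apply: leq_trans h; rewrite ltnS size_take; case: ifP => // /ltnW //.
Qed.

Lemma pt_argmin (key : forall I, A I -> X I -> int) (l : forall I, A I -> seq (X I)) :
  pt (fun I (q : A I * X I) => key I q.1 q.2) -> pt l -> pt (fun I a => argmin (key I a) (l I a)).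
Proof.
move=> hk hl; have [P [k hP]] := hl.
apply: (@pt_foldl A X (fun I => option (X I)) _ _ _
  (fun I a acc x => if acc is Some y then if (key I a y <= key I a x)%R then acc else Some x else Some x) (fun I _ => None) _ (k + 1)) => //.
- apply: (@pt_omatch _ _ _ _ _ _ (fun I p => p.2.1) (fun I p y => if (key I p.1 y <= key I p.1 p.2.2)%R then p.2.1 else Some p.2.2) (fun I p => Some p.2.2)).
  + ptp.
  + apply: pt_if.
    * apply: pt_lez.
        apply: (pt_comp (g := fun I (q : A I * X I) => key I q.1 q.2) (f := fun I (p : (A I * (option (X I) * X I)) * X I) => (p.1.1, p.2))) hk.
        by apply: pt_pair; [ptp | ptp].
      apply: (pt_comp (g := fun I (q : A I * X I) => key I q.1 q.2) (f := fun I (p : (A I * (option (X I) * X I)) * X I) => (p.1.1, p.1.2.2))) hk.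
      by apply: pt_pair; [ptp | ptp].
    * ptp.
    * apply: pt_some; ptp.
  + apply: pt_some; ptp.
- exact: pt_none.
- move=> I a i; have [s _] := hP I a.
  rewrite -/(argmin (key I a) (take i (l I a))); case E : (argmin _ _) => [x|].
    have h := enc_seq_le (@enc _ eX I) (In_take (argmin_In E)).
    apply: leq_trans (_ : dsize (enc (l I a)) * 2 <= _).
      have -> : dsize (enc (Some x)) = dsize (enc x) + 2 by rewrite /= trunc_log0 addn2.
      have {}h : dsize (enc x) < dsize (enc (l I a)) by exact: h.
      have := dsize_gt0 (enc x); move: h; clear; lia.
    by rewrite addn1 expnS mulnC leq_mul // bnd2.
  by rewrite /= trunc_log0 expn_gt0 (leq_trans _ (bnd2 _ _)).
Qed.

Lemma pt_behead (l : forall I, A I -> seq (X I)) : pt l -> pt (fun I a => behead (l I a)).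
Proof.
move=> hf; apply: (pt_comp (g := fun I (p : seq (X I)) => behead p) hf).
apply: (@pt_expr _ _ _ _ (fun b => Snd (Var b)) _ 1) => I a; first by move=> b s _ /= ->; case: a.
have h : dsize (enc (behead a)) <= dsize (enc a) by case: a => //= x s; exact: leqW (leq_addl _ _).
by apply: leq_trans h _; rewrite expn1 /bnd -addnA addnCA leq_addr.
Qed.

End Lists1.

Section Lists2.
Variables A X Y : inst -> Type.
Context {eA : Enc A} {eX : Enc X} {eY : Enc Y}.

Lemma pt_filter (p : forall I, A I -> X I -> bool) (l : forall I, A I -> seq (X I)) :
  pt (fun I (q : A I * X I) => p I q.1 q.2) -> pt l -> pt (fun I a => [seq x <- l I a | p I a x]).
Proof.
move=> hp hl; apply: (pt_ext (f := fun I a => flatten [seq if p I a x then [:: x] else [::] | x <- l I a])).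
  by move=> I a; elim: (l I a) => //= x s ->; case: (p I a x).
apply: pt_flatten; apply: (pt_map (h := fun I a x => if p I a x then [:: x] else [::])) => //.
by apply: pt_if => //; [apply: pt_cons; [ptp | apply: pt_nil] | apply: pt_nil].
Qed.

Lemma pt_leqn (f g : forall I, A I -> nat) : pt f -> pt g -> pt (fun I a => f I a <= g I a).
Proof.
move=> hf hg; apply: (pt_ext (f := fun I a => (Posz (f I a) <= Posz (g I a))%R)).
  by move=> I a; rewrite lez_nat.
by apply: pt_lez; apply: pt_intn.
Qed.
Lemma pt_eqn (f g : forall I, A I -> nat) : pt f -> pt g -> pt (fun I a => f I a == g I a).
Proof.
move=> hf hg; apply: (pt_ext (f := fun I a => (f I a <= g I a) && (g I a <= f I a))).
  by move=> I a; rewrite eqn_leq.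
by apply: pt_andb; apply: pt_leqn.
Qed.
End Lists2.

Section Lists3.
Variables A X Y : inst -> Type.
Context {eA : Enc A} {eX : Enc X} {eY : Enc Y}.

Lemma pt_eqv (f g : forall I, A I -> 'I_(nv I)) : pt f -> pt g -> pt (fun I a => f I a == g I a).
Proof. by move=> hf hg; apply: pt_eqn; apply: pt_vtxn. Qed.

End Lists3.

Section Lists4.
Variables A X Y : inst -> Type.
Context {eA : Enc A} {eX : Enc X} {eY : Enc Y}.

Lemma pt_count (p : forall I, A I -> X I -> bool) (l : forall I, A I -> seq (X I)) :
  pt (fun I (q : A I * X I) => p I q.1 q.2) -> pt l -> pt (fun I a => count (p I a) (l I a)).
Proof.
move=> hp hl; apply: (pt_ext (f := fun I a => size [seq x <- l I a | p I a x])).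
  by move=> I a; rewrite size_filter.
by apply: pt_size; apply: pt_filter.
Qed.
Lemma pt_has (p : forall I, A I -> X I -> bool) (l : forall I, A I -> seq (X I)) :
  pt (fun I (q : A I * X I) => p I q.1 q.2) -> pt l -> pt (fun I a => has (p I a) (l I a)).
Proof.
move=> hp hl; apply: (pt_ext (f := fun I a => 1 <= count (p I a) (l I a))).
  by move=> I a; rewrite has_count.
by apply: pt_leqn; [apply: pt_nat | apply: pt_count].
Qed.
End Lists4.

Section Lists5.
Variables A X Y : inst -> Type.
Context {eA : Enc A} {eX : Enc X} {eY : Enc Y}.

Lemma pt_all (p : forall I, A I -> X I -> bool) (l : forall I, A I -> seq (X I)) :
  pt (fun I (q : A I * X I) => p I q.1 q.2) -> pt l -> pt (fun I a => all (p I a) (l I a)).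
Proof.
move=> hp hl; apply: (pt_ext (f := fun I a => ~~ has (fun x => ~~ p I a x) (l I a))).
  by move=> I a; rewrite has_predC negbK.
by apply: pt_negb; apply: (pt_has (p := fun I a x => ~~ p I a x)) => //; apply: pt_negb.
Qed.
Lemma pt_mem (v : forall I, A I -> 'I_(nv I)) (l : forall I, A I -> seq ('I_(nv I))) :
  pt v -> pt l -> pt (fun I a => v I a \in l I a).
Proof.
move=> hv hl; apply: (pt_ext (f := fun I a => has (fun x => x == v I a) (l I a))).
  move=> I a; apply/hasP/idP => [[x xl /eqP <-] // | h]; by exists (v I a).
apply: (pt_has (p := fun I a x => x == v I a)) => //.
apply: pt_eqv; first by ptp.
by apply: (pt_comp (g := v) (f := fun I (q : A I * 'I_(nv I)) => q.1)) => //; ptp.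
Qed.
Lemma pt_inset (v : forall I, A I -> 'I_(nv I)) (S : forall I, A I -> {set 'I_(nv I)}) :
  pt v -> pt S -> pt (fun I a => v I a \in S I a).
Proof.
move=> hv hl; apply: (pt_ext (f := fun I a => v I a \in enum (S I a))).
  by move=> I a; rewrite mem_enum.
by apply: pt_mem => //; apply: pt_enum.
Qed.
Lemma pt_card (S : forall I, A I -> {set 'I_(nv I)}) : pt S -> pt (fun I a => #|S I a|).
Proof.
move=> hl; apply: (pt_ext (f := fun I a => size (enum (S I a)))).
  by move=> I a; rewrite -cardE.
by apply: pt_size; apply: pt_enum.
Qed.
End Lists5.

(** * Bisets and oracle answers *)

Section Bisets.
Variable V : finType.
Implicit Types (X Y Z S C : biset V) (F G : {set biset V}) (e : V * V) (K J : seq (V * V)).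

(** Componentwise containment, in contrast to the lexicographic [bisub] that defines cores. In a
    family closed under intersection a core is also least componentwise ([core_le]). *)
Definition bile X Y := (X.1 \subset Y.1) && (X.2 \subset Y.2).
Definition unc K S := all (fun e => ~~ covers e S) K.
Definition fl e : V * V := (e.2, e.1).

Lemma coversE e S : covers e S = (e.1 \in S.1) && (e.2 \notin S.2).
Proof. by rewrite /covers inE. Qed.

Lemma bile_refl X : bile X X. Proof. by rewrite /bile !subxx. Qed.
Lemma bile_trans Y X Z : bile X Y -> bile Y Z -> bile X Z.
Proof.
by move=> /andP[a b] /andP[c d]; rewrite /bile (subset_trans a c) (subset_trans b d).
Qed.
Lemma bile_anti X Y : bile X Y -> bile Y X -> X = Y.
Proof.
move=> /andP[a b] /andP[c d]; rewrite [X]surjective_pairing [Y]surjective_pairing.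
by congr (_, _); apply/eqP; rewrite eqEsubset ?a ?b.
Qed.
Lemma bile_capl X Y : bile (bicap X Y) X. Proof. by rewrite /bile /= !subsetIl. Qed.
Lemma bile_capr X Y : bile (bicap X Y) Y. Proof. by rewrite /bile /= !subsetIr. Qed.
Lemma bile_cupl X Y : bile X (bicup X Y). Proof. by rewrite /bile /= !subsetUl. Qed.
Lemma bile_bicap X Y Z : bile Z X -> bile Z Y -> bile Z (bicap X Y).
Proof. by move=> /andP[a b] /andP[c d]; rewrite /bile /= !subsetI a b c d. Qed.

Lemma uncP K S : reflect (forall e, e \in K -> ~~ covers e S) (unc K S).
Proof. exact: allP. Qed.
Lemma unc_cat K K' S : unc (K ++ K') S = unc K S && unc K' S.
Proof. exact: all_cat. Qed.
Lemma unc_sub K K' S : {subset K <= K'} -> unc K' S -> unc K S.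
Proof. by move=> h /uncP u; apply/uncP => e /h /u. Qed.
Lemma unc_cap K X Y : unc K X -> unc K Y -> unc K (bicap X Y).
Proof.
move=> /uncP a /uncP b; apply/uncP => e eK; move: (a e eK) (b e eK).
by rewrite !coversE !inE; case: (_ \in X.1); case: (_ \in X.2); case: (_ \in Y.1); case: (_ \in Y.2).
Qed.
Lemma unc_cup K X Y : unc K X -> unc K Y -> unc K (bicup X Y).
Proof.
move=> /uncP a /uncP b; apply/uncP => e eK; move: (a e eK) (b e eK).
by rewrite !coversE !inE; case: (_ \in X.1); case: (_ \in X.2); case: (_ \in Y.1); case: (_ \in Y.2).
Qed.

Lemma biset_sub F S : proper_family F -> S \in F -> S.1 \subset S.2.
Proof. by move=> pF /pF /and3P[]. Qed.
Lemma proper_in F S : proper_family F -> S \in F -> exists u, u \in S.1.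
Proof. by move=> pF /pF /and3P[_ /set0Pn h _]. Qed.
Lemma proper_out F S : proper_family F -> S \in F -> exists v, v \notin S.2.
Proof. by move=> pF /pF /and3P[_ _ /set0Pn [v]]; rewrite inE => h; exists v. Qed.

(** In most uses an edge covers both bisets, and its tail and head serve as [u] and [v]. *)
Lemma crossP F X Y u v : crossing F -> X \in F -> Y \in F -> u \in X.1 -> u \in Y.1 ->
  v \notin X.2 -> v \notin Y.2 -> bicap X Y \in F /\ bicup X Y \in F.
Proof.
move=> cF XF YF uX uY vX vY; apply: cF => //; rewrite /cross.
apply/andP; split; first by apply/set0Pn; exists u; rewrite inE uX.
apply: contraNneq vX => h; have : v \in X.2 :|: Y.2 by rewrite h inE.
by rewrite inE (negbTE vY) orbF.
Qed.

Lemma cobisetK : involutive (@cobiset V).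
Proof. by move=> [a b]; rewrite /cobiset /= !finset.setCK. Qed.
Lemma in_cofamily F S : (S \in cofamily F) = (cobiset S \in F).
Proof.
apply/imsetP/idP => [[X XF ->]|h]; first by rewrite cobisetK.
by exists (cobiset S); rewrite ?cobisetK.
Qed.
Lemma covers_co e S : covers e (cobiset S) = covers (fl e) S.
Proof. by rewrite !coversE /= !inE negbK andbC. Qed.
Lemma flK : involutive fl. Proof. by case. Qed.
Lemma unc_co K S : unc K (cobiset S) = unc (map fl K) S.
Proof. by rewrite /unc all_map; apply: eq_all => e; rewrite /= covers_co. Qed.
Lemma bicap_co X Y : bicap (cobiset X) (cobiset Y) = cobiset (bicup X Y).
Proof. by rewrite /bicap /cobiset /= !finset.setCU. Qed.
Lemma bicup_co X Y : bicup (cobiset X) (cobiset Y) = cobiset (bicap X Y).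
Proof. by rewrite /bicup /cobiset /= !finset.setCI. Qed.
Lemma bile_co X Y : bile (cobiset X) (cobiset Y) = bile Y X.
Proof. by rewrite /bile /= !finset.setCS andbC. Qed.

Lemma proper_co F : proper_family F -> proper_family (cofamily F).
Proof.
move=> pF S; rewrite in_cofamily => /pF /and3P[/= a b c]; apply/and3P; split.
- by rewrite -finset.setCS.
- by rewrite finset.setCK in c.
- by [].
Qed.
Lemma crossing_co F : crossing F -> crossing (cofamily F).
Proof.
move=> cF X Y; rewrite !in_cofamily => XF YF /andP[/set0Pn [v]]; rewrite inE => /andP[vX vY] h.
have [u] : exists u, u \notin X.2 :|: Y.2.
  apply/existsP; move: h; apply: contraR; rewrite negb_exists => /forallP h.
  by apply/eqP/setP => u; have := h u; rewrite negbK => ->; rewrite inE.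
rewrite inE negb_or => /andP[uX uY].
have := @crossP F (cobiset X) (cobiset Y) u v cF XF YF.
by rewrite !inE !negbK bicap_co bicup_co => /(_ uX uY vX vY) [].
Qed.

Definition sep F K (u v : V) S := [&& S \in F, unc K S, u \in S.1 & v \notin S.2].

Lemma sepE F K u v S : (S \in separating F [set e in K]%SET u v) = sep F K u v S.
Proof.
rewrite !inE -andbA; congr (_ && (_ && _)).
by apply/forallP/uncP => [h e eK|h e]; [have := h e; rewrite inE eK | rewrite inE; apply/implyP/h].
Qed.
Lemma sep_cap F K u v X Y : crossing F -> sep F K u v X -> sep F K u v Y -> sep F K u v (bicap X Y).
Proof.
move=> cF /and4P[a b c d] /and4P[a' b' c' d']; apply/and4P; split.
- by have [] := crossP cF a a' c c' d d'.
- exact: unc_cap.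
- by rewrite inE c.
- by rewrite inE (negbTE d).
Qed.
Lemma sep_cup F K u v X Y : crossing F -> sep F K u v X -> sep F K u v Y -> sep F K u v (bicup X Y).
Proof.
move=> cF /and4P[a b c d] /and4P[a' b' c' d']; apply/and4P; split.
- by have [] := crossP cF a a' c c' d d'.
- exact: unc_cup.
- by rewrite inE c.
- by rewrite inE (negbTE d).
Qed.
Lemma sep_co F K u v S : sep (cofamily F) K u v S = sep F (map fl K) v u (cobiset S).
Proof.
rewrite /sep in_cofamily unc_co mapK; last exact: flK.
by rewrite /= !inE negbK; congr (_ && (_ && _)); exact: andbC.
Qed.

Lemma bisub_cap X Y : bisub (bicap X Y) X.
Proof.
rewrite /bisub /= subsetIl andbT; case: eqVneq => [->|h]; first by rewrite orbT.
by rewrite properEneq h subsetIl.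
Qed.

Section Cores.
Variable G : {set biset V}.
Hypothesis Gcap : forall X Y, X \in G -> Y \in G -> bicap X Y \in G.

Lemma core_le C S : C \in cores G -> S \in G -> bile C S.
Proof.
rewrite inE => /andP[CG /forallP h] SG; have := h (bicap C S); rewrite !inE Gcap // bisub_cap /=.
by rewrite andbT implybF negbK => /eqP <-; exact: bile_capr.
Qed.
Lemma core_uniq C C' : C \in cores G -> C' \in cores G -> C = C'.
Proof.
move=> h h'; apply: bile_anti; apply: core_le => //; [move: h' | move: h]; by rewrite inE => /andP[].
Qed.
End Cores.

(** A weight that is strictly monotone for the lexicographic order: the factor [#|V|.+1] lets one
    more inner vertex outweigh any outer part. *)
Lemma bisub_lt X Y : bisub X Y -> X != Y -> #|X.1| * #|V|.+1 + #|X.2| < #|Y.1| * #|V|.+1 + #|Y.2|.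
Proof.
move=> /orP[/proper_card lt _|/andP[/eqP e s] ne].
  have h2 : #|X.2| < #|V|.+1 by rewrite ltnS max_card.
  have : #|X.1|.+1 * #|V|.+1 <= #|Y.1| * #|V|.+1 by rewrite leq_mul2r lt orbT.
  by rewrite mulSn; lia.
rewrite e ltn_add2l; apply: proper_card; rewrite properEneq s andbT.
by apply: contraNneq ne => e2; rewrite [X]surjective_pairing e e2 -surjective_pairing.
Qed.
Lemma bisub_trans Y X Z : bisub X Y -> bisub Y Z -> bisub X Z.
Proof.
move=> /orP[a|/andP[/eqP a a']] /orP[b|/andP[/eqP b b']]; apply/orP.
- by left; apply: proper_trans a b.
- by left; rewrite -b.
- by left; rewrite a.
- by right; rewrite a b eqxx /= (subset_trans a' b').
Qed.
Lemma core_exists G S : S \in G -> exists2 C, C \in cores G & bisub C S.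
Proof.
move=> SG; pose m X := #|X.1| * #|V|.+1 + #|X.2|.
pose P X := (X \in G) && bisub X S.
have P0 : P S by rewrite /P SG /bisub eqxx subxx orbT.
have [C /andP[CG CS] Cmin] := arg_minnP m P0.
exists C => //; rewrite inE CG; apply/forallP => X; apply/implyP; rewrite !inE => /andP[XC XG].
apply/negP => XC'; have := Cmin X; rewrite /P XG (bisub_trans XC' CS) => /(_ isT).
by have := bisub_lt XC' XC; rewrite -/(m X) -/(m C); lia.
Qed.

(* An answer lists the least member of F(u,v) and the co-biset of the greatest one. *)
Definition ask_ok F (ask : seq (V * V) -> V -> V -> option (biset V * biset V)) :=
  forall K u v, match ask K u v with
  | Some (X, Y) => [/\ sep F K u v X, forall S, sep F K u v S -> bile X S,
      sep F K u v (cobiset Y) & forall S, sep F K u v S -> bile S (cobiset Y)]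
  | None => forall S, ~~ sep F K u v S
  end.

(** The oracle of the co-family: the edges and the pair [u], [v] are reversed, and least and
    greatest member exchange their roles. *)
Definition askr (ask : seq (V * V) -> V -> V -> option (biset V * biset V)) K u v :=
  if ask (map fl K) v u is Some p then Some (p.2, p.1) else None.

Lemma askr_ok F ask : ask_ok F ask -> ask_ok (cofamily F) (askr ask).
Proof.
move=> h K u v; rewrite /askr; have := h (map fl K) v u.
case: (ask _ _ _) => [[X Y] [a b c d]|a] /=; last by move=> S; rewrite sep_co.
split.
- by rewrite sep_co.
- by move=> S; rewrite sep_co => /d; rewrite bile_co.
- by rewrite sep_co cobisetK.
- by move=> S; rewrite sep_co => /b; rewrite -bile_co cobisetK.
Qed.

End Bisets.

(** * The algorithm *)

Definition prs T U (s : seq T) (t : seq U) : seq (T * U) :=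
  flatten [seq [seq (x, y) | y <- t] | x <- s].
Definition isub (x y : int) : int := (x - y)%R.
Definition iadd (x y : int) : int := (x + y)%R.
Definition ohd T (l : seq T) : option T := argmin (fun=> Posz 0) l.

Section Alg.
Variable V : finType.
Notation edge := (V * V)%type.
Notation bis := (biset V).
Notation oracle := (seq edge -> V -> V -> option (bis * bis)).
Notation costs := (seq (edge * int)).

(* The piece (K, A, B, q) stands for the family of all S in F not covered by K
   with S.1 meeting A, ~: S.2 meeting B and #|S.1| <= q. *)
Definition piece := (seq edge * (seq V * (seq V * nat)))%type.
Definition pd_state := (costs * seq edge)%type.
Definition pc_state := (seq V * (seq piece * pd_state))%type.

Definition del (T : seq V) (v : V) := [seq t <- T | t != v].
(** These edges cover exactly the proper bisets whose inner part meets [T]. Adding them to a query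
    thus excludes the members meeting [T]. *)
Definition star (T : seq V) : seq edge := prs T (enum V).

Section Ask.
Variables (ask : oracle) (cl : costs).

Definition pcands (J : seq edge) (p : piece) : seq bis :=
  flatten [seq (if ask (p.1 ++ J) ab.1 ab.2 is Some XY then
                  if #|XY.1.1| <= p.2.2.2 then [:: XY.1] else [::]
                else [::]) | ab <- prs p.2.1 p.2.2.1].
Definition findmin J p : option bis := argmin (fun X : bis => Posz #|X.1|) (pcands J p).

(** A dual step: the variable of the chosen biset is raised until the first edge covering it becomes
    tight, and that edge is bought. The costs in the state are the reduced ones. *)
Definition pdstep (p : piece) (st : pd_state) : pd_state :=
  if findmin st.2 p is Some X then
    if argmin (fun er : edge * int => er.2) [seq er <- st.1 | covers er.1 X] is Some er0 then
      ([seq (er.1, if covers er.1 X then isub er.2 er0.2 else er.2) | er <- st.1],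
       st.2 ++ [:: er0.1])
    else st
  else st.
(** The list [cl] is a counter: each effective step buys a new edge, so as many steps as there are
    edges suffice. *)
Definition pdrun p st := foldl (fun st _ => pdstep p st) st cl.

Definition chk (pcs : seq piece) J := all (fun p => if findmin J p is Some _ then false else true) pcs.
(** The first component lists the edges still to be examined, latest first, with [e] at its head;
    the second one collects the edges kept. *)
Definition rdstep pcs (st : seq edge * seq edge) e :=
  if chk pcs (behead st.1 ++ st.2) then (behead st.1, st.2) else (behead st.1, e :: st.2).
Definition rdel pcs J := (foldl (rdstep pcs) (rev J, [::]) (rev J)).2.

(** The piece of the members whose outer part avoids [t]; its two other conditions hold for every
    proper biset. *)
Definition tpiece (K : seq edge) (t : V) : piece := (K, (enum V, ([:: t], #|V|))).
Definition rootcover K t := rdel [:: tpiece K t] (pdrun (tpiece K t) (cl, [::])).2.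

(** [XY.2] is the co-biset of the greatest member, so the test is whether the inner part of that
    member contains [w]. *)
Definition inmax K c v w := if ask K c v is Some XY then ~~ (w \in XY.2.2) else false.
(* Tests that no member of F^J meets R in c alone and has more than q but at
   most 2q inner vertices.  The x counted for fixed v and w belong to the inner
   part of every member of F^J through c and w that meets R in c alone and
   avoids v, and these members are closed under union. *)
Definition thin J R q c :=
  all (fun v => count (fun w => count (fun x =>
      ~~ inmax (J ++ star (del R c) ++ [:: (x, v)]) c v w) (enum V) <= q + q) (enum V) <= q) (enum V).
Definition cpiece J R c q : piece := (J ++ star (del R c), ([:: c], (enum V, q))).
Definition pcstep q (st : pc_state) : pc_state :=
  if ohd [seq c <- st.1 | thin st.2.2.2 st.1 q c] is Some c then
    (del st.1 c, (cpiece st.2.2.2 st.1 c q :: st.2.1, pdrun (cpiece st.2.2.2 st.1 c q) st.2.2))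
  else st.
Definition pcrun q := foldl (fun st _ => pcstep q st) (enum V, ([::], (cl, [::]))) (enum V).
Definition pcover q := rdel (pcrun q).2.1 (pcrun q).2.2.2.

Definition istrans J T :=
  all (fun uv => if ask (J ++ star T) uv.1 uv.2 is Some _ then false else true) (prs (enum V) (enum V)).
Definition mtstep J T v := if istrans J (del T v) then del T v else T.
Definition mintrans J := foldl (mtstep J) (enum V) (enum V).

Definition mins J : seq bis :=
  flatten [seq (if ask J uv.1 uv.2 is Some XY then [:: XY.1] else [::]) | uv <- prs (enum V) (enum V)].
Definition ncores J := [seq C <- mins J | all (fun D => if bile D C then bile C D else true) (mins J)].
(* A member of F^J whose inner part contains the first vertex of the core C is
   not covered by [kcore cs C] iff C is the only core below it. *)
Definition kcore (cs : seq bis) (C : bis) : seq edge :=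
  flatten [seq (if bile D C then [::] else
                if ohd (enum D.1) is Some d then prs [:: d] [seq v <- enum V | ~~ (v \in D.2)] else [::]) | D <- cs]
  ++ (if ohd (enum C.1) is Some c then prs [:: c] (enum C.2) else [::]).
End Ask.

Definition flc (cl : costs) : costs := [seq (fl er.1, er.2) | er <- cl].
Definition costof (cl : costs) (J : seq edge) : int := foldl (fun s er => if er.1 \in J then iadd s er.2 else s) (Posz 0) cl.
(** Drops duplicates and foreign edges. The length never exceeds the number of edges, which keeps
    the iterated procedures polynomial. *)
Definition ecanon (cl : costs) (J : seq edge) : seq edge := [seq er.1 | er <- [seq er <- cl | er.1 \in J]].

(** A member whose inner part contains [t] has a co-biset whose outer part avoids [t], which is the
    situation of [rootcover]. *)
Definition rcover (ask : oracle) (cl : costs) K t : seq edge :=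
  map (@fl V) (rootcover (askr ask) (flc cl) (map (@fl V) K) t).

Section Ask2.
Variables (ask : oracle) (cl : costs).

Definition gastep (st : seq V * seq edge) :=
  if argmin (fun tJ : V * seq edge => costof cl tJ.2)
       [seq (t, rcover ask cl (st.2 ++ star (del st.1 t)) t) | t <- st.1] is Some tJ then
    (del st.1 tJ.1, ecanon cl (st.2 ++ tJ.2)) else st.
Definition gacover J0 := (foldl (fun st _ => gastep st) (mintrans ask J0, ecanon cl J0) (enum V)).2.

Definition round J :=
  ecanon cl (J ++ flatten [seq (if ohd (enum (C : bis).1) is Some c then
     rcover ask cl (J ++ kcore (ncores ask J) C) c else [::]) | C <- ncores ask J]).
End Ask2.

Definition dround ask cl J :=
  map (@fl V) (round (askr ask) (flc cl) (map (@fl V) (round ask cl J))).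
Definition rounds ask cl := foldl (fun J _ => dround ask cl J) [::] (enum V).
Definition pcboth ask cl q := pcover ask cl q ++ map (@fl V) (pcover (askr ask) (flc cl) q).
Definition bestcover ask cl (qs : seq nat) : seq edge :=
  odflt [::] (argmin (costof cl)
    [seq gacover ask cl J | J <- [:: [::], rounds ask cl & [seq pcboth ask cl q | q <- qs]]]).

End Alg.

(** * The algorithm runs in polynomial time *)

Notation vtx I := 'I_(nv I).
Notation edg I := (vtx I * vtx I)%type.
Notation bst I := (biset (vtx I)).

Section App.
Variables A B C D E : inst -> Type.
Context {eA : Enc A} {eB : Enc B} {eC : Enc C} {eD : Enc D} {eE : Enc E}.

Lemma pt_app2 (g : forall I, B I -> C I -> E I) f1 f2 :
  pt (fun I (p : B I * C I) => g I p.1 p.2) -> pt f1 -> pt f2 ->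
  pt (fun I (a : A I) => g I (f1 I a) (f2 I a)).
Proof. by move=> hg h1 h2; have := pt_comp (pt_pair h1 h2) hg. Qed.
Lemma pt_app3 (g : forall I, B I -> C I -> D I -> E I) f1 f2 f3 :
  pt (fun I (p : B I * (C I * D I)) => g I p.1 p.2.1 p.2.2) -> pt f1 -> pt f2 -> pt f3 ->
  pt (fun I (a : A I) => g I (f1 I a) (f2 I a) (f3 I a)).
Proof. by move=> hg h1 h2 h3; have := pt_comp (pt_pair h1 (pt_pair h2 h3)) hg. Qed.
Lemma pt_ohd (l : forall I, A I -> seq (B I)) : pt l -> pt (fun I a => ohd (l I a)).
Proof. by move=> h; apply: (pt_argmin (key := fun I _ _ => Posz 0)) => //; apply: pt_int. Qed.
Lemma pt_addn (f g : forall I, A I -> nat) : pt f -> pt g -> pt (fun I a => f I a + g I a).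
Proof.
apply: (@pt_op2 _ _ _ _ _ _ _ _ Defs.Add (fun d1 d2 => Leaf (int_of d1 + int_of d2)%R) 1 f g (fun I x y => x + y)) => // d1 d2.
have h d : `|int_of d|%N < 2 ^ dsize d by case: d => [z|a b] /=; [exact: absz_dsize|rewrite expn_gt0].
have hs : absz (int_of d1 + int_of d2)%R < 2 ^ (dsize d1 + dsize d2).
  have := h d1; have := h d2; have := dsize_gt0 d1; have := dsize_gt0 d2.
  move: (dsize d1) (dsize d2) => [|m1] [|m2] // _ _ h2 h1.
  apply: leq_ltn_trans (_ : `|int_of d1| + `|int_of d2| < _)%N; first by lia.
  rewrite expnD; move: h1 h2; rewrite !expnS.
  have := expn_gt0 2 m1; have := expn_gt0 2 m2; move: (2 ^ m1) (2 ^ m2); nia.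
by apply: leq_trans (dsize_log hs) _; lia.
Qed.
End App.

Section App2.
Variables A B C D : inst -> Type.
Context {eA : Enc A} {eB : Enc B} {eC : Enc C} {eD : Enc D}.
Lemma pt_prs (s : forall I, A I -> seq (B I)) (t : forall I, A I -> seq (C I)) :
  pt s -> pt t -> pt (fun I a => prs (s I a) (t I a)).
Proof.
move=> hs ht; rewrite /prs; apply: pt_flatten.
apply: (pt_map (h := fun I a x => [seq (x, y) | y <- t I a])) => //.
apply: (pt_map (h := fun I (p : A I * B I) y => (p.2, y))); first by apply: pt_pair; ptp.
by apply: pt_comp ht; ptp.
Qed.
Lemma pt_subset (s t : forall I, A I -> {set vtx I}) : pt s -> pt t -> pt (fun I a => s I a \subset t I a).
Proof.
move=> hs ht; apply: (pt_ext (f := fun I a => all (fun v => v \in t I a) (enum (s I a)))).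
  move=> I a; apply/allP/subsetP => h v; first by move=> vs; apply: h; rewrite mem_enum.
  by rewrite mem_enum => /h.
apply: (pt_all (p := fun I a v => v \in t I a)); last exact: pt_enum.
apply: pt_inset; first by ptp.
by apply: pt_comp ht; ptp.
Qed.
Lemma pt_eqe (f g : forall I, A I -> edg I) : pt f -> pt g -> pt (fun I a => f I a == g I a).
Proof.
move=> hf hg; apply: (pt_ext (f := fun I a => ((f I a).1 == (g I a).1) && ((f I a).2 == (g I a).2))).
  by move=> I a; rewrite -pair_eqE /pair_eq; case: (f I a) => ? ?; case: (g I a).
by apply: pt_andb; apply: pt_eqv; first [apply: pt_fst | apply: pt_snd].
Qed.
End App2.

Section App3.
Variables A B C D : inst -> Type.
Context {eA : Enc A} {eB : Enc B} {eC : Enc C} {eD : Enc D}.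
Lemma pt_bile (f g : forall I, A I -> bst I) : pt f -> pt g -> pt (fun I a => bile (f I a) (g I a)).
Proof.
by move=> hf hg; apply: pt_andb; apply: pt_subset; first [apply: pt_fst | apply: pt_snd].
Qed.
Lemma pt_covers (f : forall I, A I -> edg I) (g : forall I, A I -> bst I) :
  pt f -> pt g -> pt (fun I a => covers (f I a) (g I a)).
Proof.
move=> hf hg; apply: (pt_ext (f := fun I a => ((f I a).1 \in (g I a).1) && ~~ ((f I a).2 \in (g I a).2))).
  by move=> I a; rewrite coversE.
by apply: pt_andb; [|apply: pt_negb]; apply: pt_inset; first [apply: pt_fst | apply: pt_snd].
Qed.
Lemma pt_meme (v : forall I, A I -> edg I) (l : forall I, A I -> seq (edg I)) :
  pt v -> pt l -> pt (fun I a => v I a \in l I a).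
Proof.
move=> hv hl; apply: (pt_ext (f := fun I a => has (fun x => x == v I a) (l I a))).
  move=> I a; apply/hasP/idP => [[x xl /eqP <-] // | h]; by exists (v I a).
apply: (pt_has (p := fun I a x => x == v I a)) => //.
apply: pt_eqe; first by ptp.
by apply: (pt_comp (g := v) (f := fun I (q : A I * edg I) => q.1)) => //; ptp.
Qed.
Lemma pt_fl (f : forall I, A I -> edg I) : pt f -> pt (fun I a => fl (f I a)).
Proof. by move=> hf; apply: pt_pair; first [apply: pt_fst | apply: pt_snd]. Qed.
End App3.

(** Types all of whose values have size polynomial in the instance alone. Lists are not among them,
    so [bd_seq] takes their length as a separate bound. *)
Class Bd (A : inst -> Type) (eA : Enc A) : Prop :=
  bdE : exists k, forall I (a : A I), dsize (enc a) <= (isz I + 2) ^ k.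
Arguments Bd A {eA}.

Lemma nv_isz I : nv I < isz I.
Proof.
rewrite /isz /inst_data /enc_instance /=; set d := dsize (enc_seq _ (enum (Ed I))).
have := enc_seq_size (@enc_vertex (nv I)) (enum 'I_(nv I)); rewrite size_enum_ord; lia.
Qed.

Lemma bd_pow (M N k : nat) : 2 <= N -> M <= N ^ k -> M.+1 <= N ^ (k + 1 + 1).
Proof. by move=> N2 h; rewrite -addn1; apply: powD N2 h (powC 1 N2). Qed.

Instance bd_vtx : Bd (fun I => vtx I).
Proof.
exists 1 => I v; rewrite expn1; apply: leq_trans (dsize_nat v) _.
by have := ltn_ord v; have := nv_isz I; lia.
Qed.
Instance bd_set : Bd (fun I => {set vtx I}).
Proof.
have [k hk] := bd_vtx; exists (1 + (k + 1 + 1) + 1 + 1) => I S.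
have N2 : 2 <= isz I + 2 by lia.
apply: leq_trans (enc_seq_bound (M := (isz I + 2) ^ k) _) _; first by move=> v _; exact: hk.
rewrite addn1; apply: bd_pow => //; apply: powM; last by apply: bd_pow.
rewrite -cardE expn1; apply: leq_trans (max_card _) _; rewrite card_ord.
by have := nv_isz I; lia.
Qed.
Instance bd_pair A B (eA : Enc A) (eB : Enc B) (bA : Bd A) (bB : Bd B) : Bd (fun I => A I * B I)%type.
Proof.
have [k hk] := bA; have [j hj] := bB; exists (k + j + 1 + 1 + 1) => I [a b].
have N2 : 2 <= isz I + 2 by lia.
by apply: bd_pow => //; exact: powD N2 (hk I a) (hj I b).
Qed.

Lemma bd_seq A (eA : Enc A) (bA : Bd A) : exists k, forall I (l : seq (A I)) N,
  isz I + 2 <= N -> size l <= N -> dsize (enc l) <= N ^ k.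
Proof.
have [k hk] := bA; exists (1 + (k + 1 + 1) + 1 + 1) => I l N hN hl.
have N2 : 2 <= N by lia.
apply: leq_trans (enc_seq_bound (M := N ^ k) _) _.
  move=> v _; apply: leq_trans (hk I v) _; by case: (k) => // j; rewrite leq_exp2r.
by rewrite addn1; apply: bd_pow => //; apply: powM; [rewrite expn1 | apply: bd_pow].
Qed.

Lemma bd_seq_bnd A B (eA : Enc A) (eB : Enc B) (bB : Bd B) j :
  exists k, forall I (a : A I) (l : seq (B I)),
  size l <= bnd I (enc a) ^ j -> dsize (enc l) <= bnd I (enc a) ^ k.
Proof.
have [k hk] := bd_seq bB; exists (j.+1 * k) => I a l hl.
rewrite expnM; apply: hk.
  rewrite expnS; apply: leq_trans (_ : bnd I (enc a) <= _); first by rewrite /bnd; lia.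
  by rewrite leq_pmulr // expn_gt0 (leq_trans _ (bnd2 _ _)).
by apply: leq_trans hl _; rewrite leq_exp2l ?bnd2 //.
Qed.

Definition ilist I : seq (edg I * (int * int)) :=
  [seq (e, (numq (icst e), denq (icst e))) | e <- enum (Ed I)].

Lemma enc_seq_map T U (f : T -> data) (g : U -> T) (l : seq U) :
  enc_seq f (map g l) = enc_seq (fun x => f (g x)) l.
Proof. by elim: l => //= x l ->. Qed.

(** The encoding of this pair is literally the input, which variable 0 keeps throughout. *)
Lemma pt_inst A (eA : Enc A) : pt (fun I (_ : A I) => (enum (vtx I), ilist I)).
Proof.
have h I : enc (enum (vtx I), ilist I) = inst_data I.
  by rewrite /inst_data /enc_instance; congr Pair; exact: enc_seq_map.
apply: (@pt_expr _ _ _ _ (fun=> Var 0) _ 1) => I a; first by move=> b s s0 _; rewrite h.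
by rewrite h expn1 /bnd -/(isz I) -addnA leq_addr.
Qed.
Lemma pt_V A (eA : Enc A) : pt (fun I (_ : A I) => enum (vtx I)).
Proof. exact: pt_fst (pt_inst _). Qed.
Lemma pt_ilist A (eA : Enc A) : pt (fun I (_ : A I) => ilist I).
Proof. exact: pt_snd (pt_inst _). Qed.

Lemma orc_ex I (q : seq (edg I) * edg I) : exists r : seq (bst I) * seq (bst I),
  [/\ uniq r.1 /\ r.1 =i cores (separating (Fm I) [set e in q.1]%SET q.2.1 q.2.2),
      uniq r.2 /\ r.2 =i cores (cofamily (separating (Fm I) [set e in q.1]%SET q.2.1 q.2.2))
    & Or I (enc q) = enc r].
Proof.
case: q => J [u v]; have [s [s' [h1 h2 h3]]] := @inst_oracle I J u v.
by exists (s, s'); split.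
Qed.
(** The bisets behind an oracle answer, chosen classically; the program handles only their
    encoding. *)
Definition orc I q := sval (cid (@orc_ex I q)).

Lemma sep_closed I (q : seq (edg I) * edg I) X Y :
  let G := separating (Fm I) [set e in q.1]%SET q.2.1 q.2.2 in
  X \in G -> Y \in G -> bicap X Y \in G.
Proof. by move=> G; rewrite !sepE; apply: sep_cap; exact: inst_crossing. Qed.
Lemma sep_coclosed I (q : seq (edg I) * edg I) X Y :
  let G := cofamily (separating (Fm I) [set e in q.1]%SET q.2.1 q.2.2) in
  X \in G -> Y \in G -> bicap X Y \in G.
Proof.
move=> G; rewrite !in_cofamily !sepE => hX hY.
by rewrite -(cobisetK (bicap X Y)) -bicup_co cobisetK; apply: sep_cup => //; exact: inst_crossing.
Qed.

(** The separating family and its co-family are closed under intersection, so each has at most one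
    core. This bounds the size of an answer. *)
Lemma orc_size I q : size (@orc I q).1 <= 1 /\ size (@orc I q).2 <= 1.
Proof.
rewrite /orc; case: (cid _) => -[r1 r2] /= [[u1 m1] [u2 m2] _]; split.
- case: r1 u1 m1 => [|x [|y l]] // /andP[xn _] m1.
  have e : x = y by apply: (core_uniq (sep_closed (q := q))); rewrite -m1 !inE eqxx ?orbT.
  by rewrite e inE eqxx in xn.
- case: r2 u2 m2 => [|x [|y l]] // /andP[xn _] {}m1.
  have e : x = y by apply: (core_uniq (sep_coclosed (q := q))); rewrite -m1 !inE eqxx ?orbT.
  by rewrite e inE eqxx in xn.
Qed.

Lemma pt_orc : pt (fun I q => @orc I q).
Proof.
have [k hk] := bd_seq (bd_pair bd_set bd_set).
exists (fun b => Query b (Var b)), (1 + (k + k + 1 + 1 + 1) + 1 + 1 + 1) => I q.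
have [_ _ hq] := svalP (cid (orc_ex q)); rewrite -/(orc q) in hq.
move: hq; set dq := enc q; set r := orc q => hq; have N2 := bnd2 I dq.
have hs : dsize (enc r) <= bnd I dq ^ (k + k + 1 + 1 + 1).
  have [s1 s2] := @orc_size I q.
  have hN : isz I + 2 <= bnd I dq by rewrite /bnd; lia.
  apply: bd_pow => //; apply: powD => //; apply: hk => //; exact: leq_trans (_ : 1 <= _); lia.
split.
  by apply: powW hs => //; lia.
move=> b s b0 s0 sb; exists (upd s b (Or I (s b))); eexists; split.
- by eapply ExecQuery.
- by rewrite sb -hq; updt.
- by move=> x xb; updt.
- rewrite /= sb -/dq hq; apply: bd_pow => //; exact: powD N2 (bnd_dsize _ _) hs.
Qed.
Definition asks I (K : seq (edg I)) u v : option (bst I * bst I) :=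
  if ohd (orc (K, (u, v))).1 is Some X then
    if ohd (orc (K, (u, v))).2 is Some Y then Some (X, Y) else None
  else None.

Lemma ohdE T (l : seq T) : ohd l = if l is x :: _ then Some x else None.
Proof. by case: l => // x l; rewrite /ohd /argmin /=; elim: l x => //= y l IH x; rewrite lexx IH. Qed.

Lemma asks_ok I : ask_ok (Fm I) (@asks I).
Proof.
move=> K u v; rewrite /asks; set q := (K, (u, v)).
rewrite /orc; case: (cid _) => -[r1 r2] /= [[u1 m1] [u2 m2] _]; rewrite !ohdE.
case: r1 u1 m1 => [|X r1] _ m1.
  move=> S; apply/negP => hS; have : S \in separating (Fm I) [set e in K]%SET u v by rewrite sepE.
  by case/core_exists => C; rewrite -m1.
have hX : X \in cores (separating (Fm I) [set e in K]%SET u v) by rewrite -m1 mem_head.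
have sX : sep (Fm I) K u v X by move: hX; rewrite inE => /andP[]; rewrite sepE.
case: r2 u2 m2 => [|Y r2] _ m2.
  move=> S; apply/negP => hS.
  have : cobiset S \in cofamily (separating (Fm I) [set e in K]%SET u v).
    by rewrite in_cofamily cobisetK sepE.
  by case/core_exists => C; rewrite -m2.
have hY : Y \in cores (cofamily (separating (Fm I) [set e in K]%SET u v)) by rewrite -m2 mem_head.
split=> //.
- by move=> S hS; apply: (core_le (sep_closed (q := q)) hX); rewrite sepE.
- by move: hY; rewrite inE => /andP[]; rewrite in_cofamily sepE.
- move=> S hS; rewrite -bile_co cobisetK; apply: (core_le (sep_coclosed (q := q)) hY).
  by rewrite in_cofamily cobisetK sepE.
Qed.

Lemma pt_asks : pt (fun I (q : seq (edg I) * edg I) => asks q.1 q.2.1 q.2.2).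
Proof.
rewrite /asks.
have h : pt (fun I (q : seq (edg I) * edg I) => orc (q.1, (q.2.1, q.2.2))).
  by apply: (pt_comp (g := orc)); [apply: pt_pair; [|apply: pt_pair]; ptp | exact: pt_orc].
apply: (pt_omatch (f := fun I (q : seq (edg I) * edg I) X => if ohd (orc (q.1, (q.2.1, q.2.2))).2 is Some Y then Some (X, Y) else None)
  (g := fun I q => None)); last exact: pt_none.
  by apply: pt_ohd; apply: pt_fst.
apply: (pt_omatch (f := fun I (q : (seq (edg I) * edg I) * bst I) Y => Some (q.2, Y)) (g := fun I q => None)); last exact: pt_none.
  apply: pt_ohd; apply: pt_snd; apply: (pt_comp (f := fun I (q : (seq (edg I) * edg I) * bst I) => q.1)) h; ptp.
by apply: pt_some; apply: pt_pair; ptp.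
Qed.

Lemma pt_cardV A (eA : Enc A) : pt (fun I (_ : A I) => #|vtx I|).
Proof.
apply: (pt_ext (f := fun I a => size (enum (vtx I)))); first by move=> I a; rewrite -cardE.
by apply: pt_size; apply: pt_V.
Qed.

Ltac pthook := fail.
Ltac pts := cbv beta; lazymatch goal with
  | |- pt (fun I a => (_, _)) => eapply pt_pair; pts
  | |- pt (fun I a => [::]) => eapply pt_nil
  | |- pt (fun I a => None) => eapply pt_none
  | |- pt (fun I a => match _ with Some x => _ | None => _ end) => eapply pt_omatch; pts
  | |- pt (fun I a => if _ then _ else _) => eapply pt_if; pts
  | |- pt (fun I a => flatten _) => eapply pt_flatten; pts
  | |- pt (fun I a => seq.filter _ _) => eapply pt_filter; pts
  | |- pt (fun I a => map _ _) => eapply pt_map; pts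
  | |- pt (fun I a => prs _ _) => eapply pt_prs; pts
  | |- pt (fun I a => _ ++ _) => eapply pt_cat; pts
  | |- pt (fun I a => _ :: _) => eapply pt_cons; pts
  | |- pt (fun I a => Some _) => eapply pt_some; pts
  | |- pt (fun I a => argmin _ _) => eapply pt_argmin; pts
  | |- pt (fun I a => ohd _) => eapply pt_ohd; pts
  | |- pt (fun I a => all _ _) => eapply pt_all; pts
  | |- pt (fun I a => count _ _) => eapply pt_count; pts
  | |- pt (fun I a => rev _) => eapply pt_rev; pts
  | |- pt (fun I a => behead _) => eapply pt_behead; pts
  | |- pt (fun I a => ~~ _) => eapply pt_negb; pts
  | |- pt (fun I a => bile _ _) => eapply pt_bile; pts
  | |- pt (fun I a => covers _ _) => eapply pt_covers; pts
  | |- pt (fun I a => fl _) => eapply pt_fl; pts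
  | |- pt (fun I a => _ <= _) => eapply pt_leqn; pts
  | |- pt (fun I a => _ + _) => eapply pt_addn; pts
  | |- pt (fun I a => Posz 0) => eapply pt_int
  | |- pt (fun I a => Posz _) => eapply pt_intn; pts
  | |- pt (fun I a => nat_of_ord _) => eapply pt_vtxn; pts
  | |- pt (fun I a => isub _ _) => eapply pt_sub; pts
  | |- pt (fun I a => iadd _ _) => eapply pt_add; pts
  | |- pt (fun I a => (_ * _)%R) => eapply pt_mul; pts
  | |- pt (fun I a => _ == _) => eapply pt_eqv; pts
  | |- pt (fun I a => _.1) => eapply pt_fst; pts
  | |- pt (fun I a => _.2) => eapply pt_snd; pts
  | |- pt (fun I a => let (_, y) := _ in y) => eapply pt_snd; pts
  | |- pt (fun I a => let (x, _) := _ in x) => eapply pt_fst; pts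
  | |- pt (fun I => snd) => eapply pt_snd; eapply pt_id
  | |- pt (fun I => fst) => eapply pt_fst; eapply pt_id
  | |- pt (fun I a => a) => eapply pt_id
  | |- pt (fun I a => in_mem _ (mem (pred_of_set _))) => eapply pt_inset; pts
  | |- pt (fun I a => in_mem _ _) => eapply pt_meme; pts
  | |- pt (fun I a => card _) => first [eapply pt_cardV | eapply pt_card; pts]
  | |- pt (fun I a => enum_mem _) => first [eapply pt_V | eapply pt_enum; pts]
  | |- pt (fun I a => true) => eapply pt_bool
  | |- pt (fun I a => false) => eapply pt_bool
  | |- pt (fun I a => 0) => eapply pt_nat
  | |- _ => pthook
  end.

(** * Time bounds for primal-dual runs, partial covers and transversals *)

Section Alg.
Variable askf : forall I, seq (edg I) -> vtx I -> vtx I -> option (bst I * bst I).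
Variable clf : forall I, seq (edg I * int).
Hypothesis Hask : pt (fun I (q : seq (edg I) * edg I) => askf q.1 q.2.1 q.2.2).
Hypothesis Hcl : forall A (eA : Enc A), pt (fun I (_ : A I) => clf I).

Notation pieces I := (piece (vtx I)).
Notation pdst I := (pd_state (vtx I)).
Notation pcst I := (pc_state (vtx I)).

Ltac hook0 := lazymatch goal with
  | |- pt (fun I a => clf I) => eapply Hcl
  | |- pt (fun I a => askf _ _ _) => eapply (pt_app3 (g := fun I K u v => @askf I K u v)); [exact Hask | pts | pts | pts]
  end.
Ltac pthook ::= hook0.

Lemma pt_pcands : pt (fun I (q : seq (edg I) * (seq (edg I) * (seq (vtx I) * (seq (vtx I) * nat)))) => pcands (@askf I) q.1 q.2).
Proof. rewrite /pcands. pts. Qed.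

Ltac hook1 := lazymatch goal with
  | |- pt (fun I a => pcands _ _ _) => eapply (pt_app2 (g := fun I J p => pcands (@askf I) J p)); [exact pt_pcands | pts | pts]
  | |- _ => hook0
  end.
Ltac pthook ::= hook1.

Lemma pt_findmin : pt (fun I (q : seq (edg I) * pieces I) => findmin (@askf I) q.1 q.2).
Proof. rewrite /findmin. pts. Qed.

Ltac hook2 := lazymatch goal with
  | |- pt (fun I a => findmin _ _ _) => eapply (pt_app2 (g := fun I J p => findmin (@askf I) J p)); [exact pt_findmin | pts | pts]
  | |- _ => hook1
  end.
Ltac pthook ::= hook2.

Lemma pt_chk : pt (fun I (q : seq (pieces I) * seq (edg I)) => chk (@askf I) q.1 q.2).
Proof. rewrite /chk. pts. Qed.

Ltac hook3 := lazymatch goal with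
  | |- pt (fun I a => chk _ _ _) => eapply (pt_app2 (g := fun I pcs J => chk (@askf I) pcs J)); [exact pt_chk | pts | pts]
  | |- _ => hook2
  end.
Ltac pthook ::= hook3.

Lemma pt_pdstep : pt (fun I (q : pieces I * pdst I) => pdstep (@askf I) q.1 q.2).
Proof. rewrite /pdstep. pts. Qed.

(** One parameter bounds both lengths and the bit length of the reduced costs. A step subtracts two
    such costs, which raises the bit length by at most one. *)
Definition pdb I m (st : pdst I) :=
  [/\ size st.1 <= m, size st.2 <= m & all (fun er => absz er.2 < 2 ^ m) st.1].

Lemma pdb_step I m p (st : pdst I) : pdb m st -> pdb m.+1 (pdstep (@askf I) p st).
Proof.
case: st => red J [/= h1 h2 h3]; rewrite /pdstep /=.
have h0 : pdb m.+1 (red, J).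
  split; rewrite /= ?leqW //; apply: sub_all h3 => er /= /leq_trans; apply.
  by rewrite leq_exp2l.
case: (findmin _ _ _) => [X|] //; case E : (argmin _ _) => [er0|] //; split => /=.
- by rewrite size_map leqW.
- by rewrite size_cat addn1 ltnS.
- have hin := argmin_In E.
  have er0in : absz er0.2 < 2 ^ m.
    have : er0 \in [seq er <- red | covers er.1 X] by elim: [seq _ <- _ | _] hin => //= x l IH [->|/IH]; rewrite inE ?eqxx // => ->; rewrite orbT.
    by rewrite mem_filter => /andP[_ /(allP h3)].
  rewrite all_map; apply: sub_all h3 => er /= h; rewrite expnS.
  by rewrite /isub; case: ifP => _; move: h er0in; move: (2 ^ m) => M; lia.
Qed.

Lemma pdb_size : exists k, forall I (N : nat) m (st : pdst I), isz I + 2 <= N -> m <= N ->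
  pdb m st -> dsize (enc st) <= N ^ k.
Proof.
have [k2 h2] := bd_seq (bd_pair bd_vtx bd_vtx).
have [k1 h1] := bd_pair bd_vtx bd_vtx.
exists ((1 + ((k1 + 1 + 1 + 1 + 1 + 1 + 1) + 1 + 1) + 1 + 1) + k2 + 1 + 1 + 1) => I N m [red J] hN hm [/= s1 s2 hall].
have N2 : 2 <= N by lia.
apply: bd_pow => //; apply: powD => //; last by apply: h2 => //; apply: leq_trans s2 hm.
apply: leq_trans (enc_seq_bound (M := N ^ (k1 + 1 + 1 + 1 + 1 + 1 + 1)) _) _; last first.
  rewrite addn1; apply: bd_pow => //; apply: powM; last by apply: bd_pow.
  by rewrite expn1; apply: leq_trans s1 hm.
move=> [e z] hin.
have hz : dsize (Leaf z) <= m.+1.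
  apply: dsize_log; elim: red hall hin {s1} => //= x l IH /andP[hx hl] [xe|/IH]; last exact.
  by rewrite xe in hx.
have -> : dsize (enc (e, z)) = (dsize (enc e) + dsize (Leaf z)).+1 by [].
have he : dsize (enc e) <= N ^ k1.
  by apply: leq_trans (h1 I e) _; case: (k1) => // j; rewrite leq_exp2r.
apply: (@bd_pow _ N (k1 + 1 + 1 + 1 + 1)) => //.
apply: leq_trans (_ : N ^ k1 + N + 1 <= _).
  move: he hz hm; clear; move: (dsize _) (dsize _) (N ^ k1); lia.
by apply: (powD N2 (powD N2 (leqnn _) _)); rewrite expn1 //; lia.
Qed.

Lemma pdb_enc I (st : pdst I) : pdb (dsize (enc st)) st.
Proof.
case: st => red J; have -> : dsize (enc (red, J)) = (dsize (enc red) + dsize (enc J)).+1 by [].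
have hr : size red < dsize (enc red) by exact: enc_seq_size.
have hJ : size J < dsize (enc J) by exact: enc_seq_size.
split => /=.
- by apply: leq_trans (ltnW hr) _; rewrite leqW // leq_addr.
- by apply: leq_trans (ltnW hJ) _; rewrite leqW // leq_addl.
have : all (fun er : edg I * int => absz er.2 < 2 ^ dsize (enc red)) red.
  apply/allP => er er_in.
  have hin : List.In er red by elim: red er_in {hr} => //= x l IH; rewrite inE => /orP[/eqP ->|/IH]; [left|right].
  have h : dsize (enc er) < dsize (enc red) by exact: (enc_seq_le _ hin).
  apply: leq_trans (absz_dsize er.2) _; rewrite leq_exp2l //.
  have : dsize (enc er) = (dsize (enc er.1) + dsize (Leaf er.2)).+1 by [].
  move: h; clear; move: (dsize _) (dsize _) (dsize _) (dsize _); lia.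
by apply: sub_all => er /leq_trans; apply; rewrite leq_exp2l // leqW // leq_addr.
Qed.

Lemma pdb_run I m p (st : pdst I) (s : seq (edg I * int)) : pdb m st ->
  pdb (m + size s) (foldl (fun st _ => pdstep (@askf I) p st) st s).
Proof.
elim: s m st => [|x s IH] m st h /=; first by rewrite addn0.
by rewrite addnS -addSn; apply: IH; apply: pdb_step.
Qed.

Lemma size_clf : exists k, forall I d, size (clf I) <= bnd I d ^ k.
Proof.
have [P [k hP]] := Hcl enc_of_nat; exists k => I d.
have [h _] := hP I 0.
have hs : size (clf I) < dsize (enc (clf I)) by exact: enc_seq_size.
apply: leq_trans (ltnW hs) (leq_trans h _).
by case: (k) => // j; rewrite leq_exp2r // /bnd /= trunc_log0; have := dsize_gt0 d; lia.
Qed.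

Lemma bnd_sum I d m k : m <= bnd I d ^ k -> isz I + 2 <= bnd I d ^ (k + 1) /\ m <= bnd I d ^ (k + 1).
Proof.
move=> h; have N2 := bnd2 I d; split; last by apply: powW h; [|lia].
by apply: (@powW _ _ 1) => //; [lia | rewrite expn1 /bnd; lia].
Qed.

Lemma pt_pdrun : pt (fun I (q : pieces I * pdst I) => pdrun (@askf I) (@clf I) q.1 q.2).
Proof.
have [j hj] := size_clf; have [k hk] := pdb_size.
apply: (@pt_foldl _ _ _ _ _ _ (fun I (q : pieces I * pdst I) st _ => pdstep (@askf I) q.1 st)
  (fun I q => q.2) (fun I q => clf I) (((1 + j + 1) + 1) * k)).
- by apply: (pt_app2 (g := fun I p st => pdstep (@askf I) p st)); [exact: pt_pdstep | pts | pts].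
- by pts.
- by pts.
- move=> I [p st] i /=; set N := bnd I _.
  have h : dsize (enc st) + size (take i (clf I)) <= N ^ (1 + j + 1).
    apply: powD; first exact: bnd2.
      rewrite expn1 /N /bnd; have -> : dsize (enc (p, st)) = (dsize (enc p) + dsize (enc st)).+1 by [].
      by clear; move: (dsize _) (dsize _); lia.
    by apply: leq_trans (hj I (enc (p, st))); rewrite size_take; case: ifP => // /ltnW.
  have [h1 h2] := bnd_sum h.
  rewrite expnM; apply: hk h1 h2 _; apply: pdb_run; exact: pdb_enc.
Qed.

Lemma size_rdstep I pcs (s : seq (edg I)) (st : seq (edg I) * seq (edg I)) :
  size (foldl (rdstep (@askf I) pcs) st s).1 <= size st.1 /\
  size (foldl (rdstep (@askf I) pcs) st s).2 <= size st.2 + size s.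
Proof.
elim: s st => [|x s IH] st /=; first by rewrite addn0.
have [h1 h2] := IH (rdstep (@askf I) pcs st x); move: h1 h2; rewrite /rdstep.
by case: ifP => _ /=; rewrite size_behead; set a := size _; set b := size (_ : seq _); lia.
Qed.

Lemma pt_rdel : pt (fun I (q : seq (pieces I) * seq (edg I)) => rdel (@askf I) q.1 q.2).
Proof.
have [k hk] := @bd_seq_bnd (fun I => seq (pieces I) * seq (edg I))%type _ _ _ (bd_pair bd_vtx bd_vtx) 1.
rewrite /rdel; apply: pt_snd.
apply: (@pt_foldl _ _ (fun I => seq (edg I) * seq (edg I))%type _ _ _ (fun I (q : seq (pieces I) * seq (edg I)) st e => rdstep (@askf I) q.1 st e)
  (fun I q => (rev q.2, [::])) (fun I q => rev q.2) (k + k + 1 + 1 + 1)).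
- by rewrite /rdstep; pts.
- by pts.
- by pts.
- move=> I [pcs J] i; cbv beta; rewrite [(_, _).2]/=.
  have [/= h1 h2] := size_rdstep pcs (take i (rev J)) (rev J, [::]).
  move: h1 h2; case: (foldl _ _ _) => r kp /= h1 h2.
  have hJ : size J <= bnd I (enc (pcs, J)) ^ 1.
    rewrite expn1 /bnd; have hs : size J < dsize (enc J) by exact: enc_seq_size.
    have -> : dsize (enc (pcs, J)) = (dsize (enc pcs) + dsize (enc J)).+1 by [].
    by move: hs; clear; move: (dsize _) (dsize _); lia.
  apply: bd_pow; first exact: bnd2.
  apply: powD; first exact: bnd2.
    by apply: hk; apply: leq_trans hJ; rewrite size_rev in h1.
  apply: hk; apply: leq_trans hJ; apply: leq_trans h2 _.
  by rewrite size_take size_rev; case: ifP => // /ltnW.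
Qed.

Ltac hook4 := lazymatch goal with
  | |- pt (fun I a => rdel _ _ _) => eapply (pt_app2 (g := fun I pcs J => rdel (@askf I) pcs J)); [exact pt_rdel | pts | pts]
  | |- pt (fun I a => pdrun _ _ _ _) => eapply (pt_app2 (g := fun I p st => pdrun (@askf I) (@clf I) p st)); [exact pt_pdrun | pts | pts]
  | |- _ => hook3
  end.
Ltac pthook ::= hook4.

Lemma pt_rootcover : pt (fun I (q : seq (edg I) * vtx I) => rootcover (@askf I) (@clf I) q.1 q.2).
Proof. rewrite /rootcover /tpiece. pts. Qed.

Lemma pt_thin : pt (fun I (q : seq (edg I) * (seq (vtx I) * (nat * vtx I))) =>
  thin (@askf I) q.1 q.2.1 q.2.2.1 q.2.2.2).
Proof. rewrite /thin /inmax /star /del. pts. Qed.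

Ltac hook5 := lazymatch goal with
  | |- pt (fun I a => @?x I a != @?y I a) => change (pt (fun I a => ~~ (x I a == y I a))); pts
  | |- pt (fun I a => thin _ _ _ _ _) =>
     eapply (pt_comp (g := fun I (q : seq (edg I) * (seq (vtx I) * (nat * vtx I))) =>
        thin (@askf I) q.1 q.2.1 q.2.2.1 q.2.2.2)
        (f := fun I a => (_, (_, (_, _))))); [pts | exact pt_thin]
  | |- _ => hook4
  end.
Ltac pthook ::= hook5.

Lemma pt_pcstep : pt (fun I (q : nat * pcst I) => pcstep (@askf I) (@clf I) q.1 q.2).
Proof. rewrite /pcstep /cpiece /star /del. pts. Qed.

(** The edge list of a stored piece consists of edges bought so far, at most [m], and of a star, at
    most [nv I * nv I]. *)
Definition pcb I i m q (st : pcst I) :=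
  [/\ size st.1 <= nv I, size st.2.1 <= i, pdb m st.2.2 &
   all (fun p : pieces I => [&& size p.1 <= m + nv I * nv I, size p.2.1 <= 1,
     size p.2.2.1 <= nv I & p.2.2.2 == q]) st.2.1].

Lemma size_prs T U (s : seq T) (t : seq U) : size (prs s t) = size s * size t.
Proof. by rewrite /prs size_flatten /shape; elim: s => //= x s; rewrite mulSn size_map => ->. Qed.

Lemma size_del (T : finType) (s : seq T) v : size (del s v) <= size s.
Proof. by rewrite /del size_filter count_size. Qed.

Lemma pcb_step I i m q (st : pcst I) : pcb i m q st ->
  pcb i.+1 (m + size (clf I)) q (pcstep (@askf I) (@clf I) q st).
Proof.
case: st => R [pcs st] [/= h1 h2 h3 h4]; rewrite /pcstep /=.
have h4' m' : m <= m' -> all (fun p : pieces I => [&& size p.1 <= m' + nv I * nv I, size p.2.1 <= 1,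
     size p.2.2.1 <= nv I & p.2.2.2 == q]) pcs.
  move=> hm; apply: sub_all h4 => p /and4P[a b c d]; rewrite b c d !andbT.
  by apply: leq_trans a _; rewrite leq_add2r.
case: (ohd _) => [c|] /=.
  split => /=.
  - exact: leq_trans (size_del _ _) h1.
  - by [].
  - exact: pdb_run.
  - rewrite h4' ?leq_addr // andbT size_enum_ord leqnn eqxx /= andbT size_cat size_prs size_enum_ord.
    case: h3 => _ hJ _; apply: leq_add; first by apply: leq_trans hJ (leq_addr _ _).
    by rewrite leq_mul2r (leq_trans (size_del _ _) h1) orbT.
split=> //=; rewrite ?leqW // ?h4' ?leq_addr //.
case: h3 => a b c; split; rewrite ?(leq_trans a) ?(leq_trans b) ?leq_addr //.
by apply: sub_all c => er /leq_trans; apply; rewrite leq_exp2l // leq_addr.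
Qed.

Lemma pcb_run I (s : seq (vtx I)) i m q (st : pcst I) : pcb i m q st ->
  pcb (i + size s) (m + size s * size (clf I)) q (foldl (fun st _ => pcstep (@askf I) (@clf I) q st) st s).
Proof.
elim: s i m st => [|x s IH] i m st h /=; first by rewrite addn0 mul0n addn0.
have -> : i + (size s).+1 = i.+1 + size s by rewrite addnS.
have -> : m + (size s).+1 * size (clf I) = m + size (clf I) + size s * size (clf I) by rewrite mulSn addnA.
by apply: IH; apply: pcb_step.
Qed.

Lemma pcb_size : exists k, forall I (N : nat) i m q (st : pcst I), isz I + 2 <= N ->
  i <= N -> m + nv I * nv I <= N -> dsize (Leaf (Posz q)) <= N -> pcb i m q st -> dsize (enc st) <= N ^ k.
Proof.
have [k1 h1] := bd_seq bd_vtx.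
have [k2 h2] := bd_seq (bd_pair bd_vtx bd_vtx).
have [k3 h3] := pdb_size.
pose kp := k2 + (k1 + (k1 + 1 + 1 + 1 + 1) + 1 + 1 + 1) + 1 + 1 + 1.
exists (k1 + ((1 + (kp + 1 + 1) + 1 + 1) + k3 + 1 + 1 + 1) + 1 + 1 + 1) => I N i m q [R [pcs st]] hN hi hm hq [/= s1 s2 s3 s4].
have N2 : 2 <= N by lia.
have hn : nv I <= N by apply: ltnW; apply: leq_trans (nv_isz I) _; lia.
apply: bd_pow => //; apply: powD => //; first by apply: h1 => //; apply: leq_trans hn.
apply: bd_pow => //; apply: powD => //; last first.
  by apply: h3 s3 => //; apply: leq_trans hm; apply: leq_addr.
apply: leq_trans (enc_seq_bound (M := N ^ kp) _) _; last first.
  rewrite addn1; apply: bd_pow => //; apply: powM; last by apply: bd_pow.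
  by rewrite expn1; apply: leq_trans s2 hi.
move=> [K [A [B q']]] hin.
have : [&& size K <= m + nv I * nv I, size A <= 1, size B <= nv I & q' == q].
  elim: pcs hin s4 {s2} => //= p l IH [->|/IH h] /andP[] //.
case/and4P => hK hA hB /eqP ->.
rewrite /kp; apply: bd_pow => //; apply: powD => //.
  by apply: h2 => //; apply: leq_trans hK hm.
apply: bd_pow => //; apply: powD => //; first by apply: h1 => //; apply: leq_trans hA _; lia.
apply: bd_pow => //; apply: powD => //.
by apply: h1 => //; apply: leq_trans hB hn.
Qed.

Lemma pt_pcrun : pt (fun I (q : nat) => pcrun (@askf I) (@clf I) q).
Proof.
have [j hj] := size_clf; have [k hk] := pcb_size.
have [P [kc hPc]] := Hcl enc_of_nat.
pose e := (j + kc + 1) + (1 + j + 1) + 2 + 1 + 1 + 1 + 1.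
rewrite /pcrun; apply: (@pt_foldl _ _ _ _ _ _ (fun I (q : nat) st (_ : vtx I) => pcstep (@askf I) (@clf I) q st)
  (fun I q => (enum (vtx I), ([::], (clf I, [::])))) (fun I q => enum (vtx I)) (e * k)).
- by apply: (pt_app2 (g := fun I q st => pcstep (@askf I) (@clf I) q st)); [exact: pt_pcstep | pts | pts].
- by pts.
- by pts.
- move=> I q i; set N := bnd I _; have N2 : 2 <= N by exact: bnd2.
  have hnN : nv I <= N by rewrite /N /bnd; have := nv_isz I; lia.
  have [m0 hm0] : exists m0, m0 = size (clf I) + dsize (enc (clf I)) by eexists.
  have h0 : pcb 0 m0 q (enum (vtx I), ([::], (clf I, [::]))).
    split => //=; first by rewrite size_enum_ord.
    split => //=; first by rewrite hm0 leq_addr.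
    have [_ _] := pdb_enc (clf I, [::] : seq (edg I)).
    have -> : dsize (enc (clf I, [::] : seq (edg I))) = (dsize (enc (clf I)) + 1).+1 by rewrite /= trunc_log0.
    move=> _; apply/allP => er er_in.
    have hin : List.In er (clf I) by elim: (clf I) er_in => //= x l IH; rewrite inE => /orP[/eqP ->|/IH]; [left|right].
    have h : dsize (enc er) < dsize (enc (clf I)) by exact: (enc_seq_le _ hin).
    apply: leq_trans (absz_dsize er.2) _; rewrite leq_exp2l //.
    have : dsize (enc er) = (dsize (enc er.1) + dsize (Leaf er.2)).+1 by [].
    by move: h; rewrite hm0; clear; move: (dsize _) (dsize _) (dsize _) (dsize _); lia.
  have h1 := pcb_run (take i (enum (vtx I))) h0.
  have hs : size (take i (enum (vtx I))) <= N.
    by apply: leq_trans hnN; rewrite size_take size_enum_ord; case: ifP => // /ltnW.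
  have hcl : dsize (enc (clf I)) <= N ^ kc.
    have [h _] := hPc I q; exact: h.
  have hM : m0 + size (take i (enum (vtx I))) * size (clf I) + nv I * nv I <= N ^ (j + kc + 1 + (1 + j + 1) + (1 + 1) + 1 + 1).
    apply: (@powW _ _ (j + kc + 1 + (1 + j) + 1 + (1 + 1) + 1)) => //; first by lia.
    apply: powD => //; last by apply: powM; rewrite expn1.
    apply: powD => //; first by rewrite hm0; apply: powD => //; exact: hj.
    by apply: powM; [rewrite expn1 | exact: hj].
  have hE x y : x <= N ^ y -> y <= e -> x <= N ^ e by move=> a b; apply: powW a.
  rewrite expnM; apply: (hk I (N ^ e) _ _ q _ _ _ _ _ h1).
  + by apply: (hE _ 1); [rewrite expn1 /N /bnd; lia | rewrite /e; lia].
  + by apply: (hE _ 1); [rewrite expn1 add0n | rewrite /e; lia].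
  + by apply: hE hM _; rewrite /e; lia.
  + by apply: (hE _ 1); [rewrite expn1 /N /bnd; exact: leq_trans (leq_addl _ _) (leq_addr _ _) | rewrite /e; lia].
Qed.

Ltac hook6 := lazymatch goal with
  | |- pt (fun I a => pcrun _ _ _) => eapply (pt_comp (g := fun I q => pcrun (@askf I) (@clf I) q)); [pts | exact pt_pcrun]
  | |- _ => hook5
  end.
Ltac pthook ::= hook6.

Lemma pt_pcover : pt (fun I (q : nat) => pcover (@askf I) (@clf I) q).
Proof. rewrite /pcover. pts. Qed.

Lemma pt_istrans : pt (fun I (q : seq (edg I) * seq (vtx I)) => istrans (@askf I) q.1 q.2).
Proof. rewrite /istrans /star. pts. Qed.

Lemma size_mtfold I J (s T : seq (vtx I)) : size (foldl (mtstep (@askf I) J) T s) <= size T.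
Proof.
elim: s T => //= v s IH T; apply: leq_trans (IH _) _; rewrite /mtstep.
by case: ifP => // _; exact: size_del.
Qed.

Lemma pt_mintrans : pt (fun I (J : seq (edg I)) => mintrans (@askf I) J).
Proof.
have [k hk] := bd_seq bd_vtx.
rewrite /mintrans; apply: (@pt_foldl _ _ (fun I => seq (vtx I)) _ _ _ (fun I J T v => mtstep (@askf I) J T v)
  (fun I q => enum (vtx I)) (fun I q => enum (vtx I)) k).
- rewrite /mtstep /del; apply: pt_if; [|pts|pts].
  by eapply (pt_app2 (g := fun I J T => istrans (@askf I) J T)); [exact pt_istrans | pts | pts].
- by pts.
- by pts.
- move=> I J i; apply: hk; first by rewrite /bnd; lia.
  apply: leq_trans (size_mtfold _ _ _) _; rewrite size_enum_ord /bnd.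
  by have := nv_isz I; lia.
Qed.

Lemma pt_mins : pt (fun I (J : seq (edg I)) => mins (@askf I) J).
Proof. rewrite /mins. pts. Qed.

Lemma pt_ncores : pt (fun I (J : seq (edg I)) => ncores (@askf I) J).
Proof.
have h A (eA : Enc A) (f : forall I, A I -> seq (edg I)) : pt f -> pt (fun I a => mins (@askf I) (f I a)).
  by move=> hf; exact: pt_comp hf pt_mins.
rewrite /ncores; apply: pt_filter; [apply: pt_all; [pts | apply: h; pts] | exact: pt_mins].
Qed.
End Alg.

Lemma pt_kcore : pt (fun I (q : seq (bst I) * bst I) => kcore q.1 q.2).
Proof. rewrite /kcore. pts. Qed.

(** * Clearing the denominators of the costs *)

Section Scale.
Variable V : finType.
Definition eq_edge (e e' : V * V) := (e.1 == e'.1) && (e.2 == e'.2).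
Definition imul (x y : int) : int := (x * y)%R.
(** The denominator of [e] itself is left out: it cancels against the cost of [e] when that is
    multiplied by all denominators. *)
Definition dprod (e : V * V) (l : seq ((V * V) * (int * int))) : int :=
  foldl (fun p y => if eq_edge y.1 e then p else imul p y.2.2) (Posz 1) l.
(* Multiplying every cost by the product of all denominators keeps the costs integral. *)
Definition scaled (l : seq ((V * V) * (int * int))) : seq ((V * V) * int) :=
  [seq (x.1, imul x.2.1 (dprod x.1 l)) | x <- l].
End Scale.
Definition clS I := scaled (ilist I).

Lemma pt_imul A (eA : Enc A) (f g : forall I, A I -> int) : pt f -> pt g -> pt (fun I a => imul (f I a) (g I a)).
Proof. exact: pt_mul. Qed.

Ltac hookS := lazymatch goal with
  | |- pt (fun I a => eq_edge _ _) => eapply pt_andb; eapply pt_eqv; pts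
  | |- pt (fun I a => imul _ _) => eapply pt_imul; pts
  | |- pt (fun I a => ilist _) => eapply pt_ilist
  end.
Ltac pthook ::= hookS.

(** Bit lengths add under multiplication, so the encoding size of the list bounds that of the
    running product. *)
Lemma foldl_mul_size T (f : T -> data) (h : int -> T -> int) l p :
  (forall x p, absz (h p x) <= absz p * 2 ^ dsize (f x)) ->
  absz (foldl h p l) <= absz p * 2 ^ dsize (enc_seq f l).
Proof.
move=> hh; elim: l p => [|y l IH] p; first by rewrite leq_pmulr ?expn_gt0.
apply: leq_trans (IH _) _; rewrite [dsize (enc_seq f (y :: l))]/= expnS expnD.
apply: leq_trans (leq_mul (hh y p) (leqnn _)) _.
by rewrite -mulnA leq_mul2l leq_pmull ?orbT.
Qed.
Lemma foldl_add_size T (f : T -> data) (h : int -> T -> int) l p :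
  (forall x p, absz (h p x) <= absz p + 2 ^ dsize (f x)) ->
  absz (foldl h p l) < absz p + 2 ^ dsize (enc_seq f l).
Proof.
move=> hh; elim: l p => [|y l IH] p; first by rewrite -[X in X < _]addn0 ltn_add2l expn_gt0.
apply: leq_trans (IH _) _; rewrite [dsize (enc_seq f (y :: l))]/= expnS expnD.
have := hh y p; have := expn_gt0 2 (dsize (enc_seq f l)); have := expn_gt0 2 (dsize (f y)).
move: (2 ^ _) (2 ^ _) => a b a0 b0 h1; nia.
Qed.

Lemma ilist_isz I : dsize (enc (ilist I)) <= isz I.
Proof.
have -> : isz I = dsize (enc (enum (vtx I), ilist I)).
  by rewrite /isz /inst_data /enc_instance; congr dsize; congr Pair; symmetry; exact: enc_seq_map.
exact: leqW (leq_addl _ _).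
Qed.

Lemma pt_dprod : pt (fun I (e : edg I) => dprod e (ilist I)).
Proof.
apply: (@pt_foldl _ _ (fun=> int) _ _ _ (fun I (e : edg I) (p : int) y => if eq_edge y.1 e then p else imul p y.2.2)
  (fun I e => Posz 1) (fun I e => ilist I) 3).
- by pts.
- exact: pt_int.
- by pts.
- move=> I e i; set N := bnd I _.
  have h1 : dsize (enc (take i (ilist I))) <= isz I.
    by apply: leq_trans (dsize_enc_take _ _ _) (ilist_isz I).
  have h : absz (foldl (fun (p : int) y => if eq_edge y.1 e then p else imul p y.2.2) (Posz 1) (take i (ilist I)))
      < 2 ^ (dsize (Leaf (Posz 1)) + dsize (enc (take i (ilist I)))).
    apply: leq_ltn_trans (foldl_mul_size _ _ _) _; last first.
      have X0 : 0 < 2 ^ dsize (enc (take i (ilist I))) by rewrite expn_gt0.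
      rewrite expnD; apply: (leq_trans _ (leq_mul (absz_dsize 1) (leqnn _))).
      exact: (leq_add X0 (leqnn _)).
    move=> y p; case: ifP => _; first by rewrite leq_pmulr ?expn_gt0.
    rewrite /imul abszM leq_mul2l; apply/orP; right; apply: leq_trans (ltnW (absz_dsize _)) _.
    by rewrite leq_exp2l //; exact: leqW (leq_trans (leqW (leq_addl _ _)) (leq_addl _ _)).
  apply: leq_trans (dsize_log h) _.
  have h2 : dsize (Leaf (Posz 1)) = 1 by rewrite /= trunc_log1.
  have hN : isz I + 2 <= N by rewrite /N /bnd; lia.
  rewrite h2; apply: leq_trans (_ : N <= _); first by move: h1 hN; clear; move: (dsize _); lia.
  by rewrite -{1}[N]expn1 leq_exp2l //; apply: bnd2.
Qed.

Lemma pt_clS A (eA : Enc A) : pt (fun I (_ : A I) => clS I).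
Proof.
rewrite /clS /scaled; apply: pt_map; last by pts.
apply: pt_pair; first by pts.
apply: pt_imul; first by pts.
by apply: (pt_comp (g := fun I (e : edg I) => dprod e (ilist I)) (f := fun I (q : A I * (edg I * (int * int))) => q.2.1)); [pts | exact: pt_dprod].
Qed.

Section Alg2.
Variable askf : forall I, seq (edg I) -> vtx I -> vtx I -> option (bst I * bst I).
Variable clf : forall I, seq (edg I * int).
Hypothesis Hask : pt (fun I (q : seq (edg I) * edg I) => askf q.1 q.2.1 q.2.2).
Hypothesis Hcl : forall A (eA : Enc A), pt (fun I (_ : A I) => clf I).

Ltac hookA0 := lazymatch goal with
  | |- pt (fun I a => clf I) => eapply Hcl
  | |- pt (fun I a => askf _ _ _) => eapply (pt_app3 (g := fun I K u v => @askf I K u v)); [exact Hask | pts | pts | pts]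
  | |- pt (fun I a => kcore _ _) => eapply (pt_app2 (g := fun I cs C => kcore cs C)); [exact pt_kcore | pts | pts]
  | |- pt (fun I a => ncores _ _) => eapply (pt_comp (g := fun I J => ncores (@askf I) J)); [pts | exact (pt_ncores Hask)]
  | |- pt (fun I a => pcover _ _ _) => eapply (pt_comp (g := fun I q => pcover (@askf I) (@clf I) q)); [pts | exact (pt_pcover Hask Hcl)]
  | |- pt (fun I a => mintrans _ _) => eapply (pt_comp (g := fun I J => mintrans (@askf I) J)); [pts | exact (pt_mintrans Hask)]
  | |- _ => hookS
  end.
Ltac pthook ::= hookA0.

Lemma pt_askr : pt (fun I (q : seq (edg I) * edg I) => askr (@askf I) q.1 q.2.1 q.2.2).
Proof. rewrite /askr. pts. Qed.
Lemma pt_flc A (eA : Enc A) : pt (fun I (_ : A I) => flc (@clf I)).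
Proof. rewrite /flc. pts. Qed.

Lemma pt_rcover : pt (fun I (q : seq (edg I) * vtx I) => rcover (@askf I) (@clf I) q.1 q.2).
Proof.
rewrite /rcover; apply: pt_map; first by pts.
apply: (pt_app2 (g := fun I K t => rootcover (askr (@askf I)) (flc (@clf I)) K t)); [|pts|pts].
exact: (pt_rootcover pt_askr pt_flc).
Qed.

Lemma pt_costof : pt (fun I (J : seq (edg I)) => costof (@clf I) J).
Proof.
have [P [k hP]] := Hcl enc_of_nat.
apply: (@pt_foldl _ _ (fun=> int) _ _ _ (fun I (J : seq (edg I)) s er => if er.1 \in J then iadd s er.2 else s)
  (fun I J => Posz 0) (fun I J => clf I) (k + 1)).
- by pts.
- exact: pt_int.
- by pts.
- move=> I J i; match goal with |- context [bnd _ ?d] => set dJ := d end; set N := bnd I dJ.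
  have hk : dsize (enc (clf I)) <= N ^ k.
    have [h _] := hP I 0; apply: leq_trans h _.
    case: (k) => // j; rewrite leq_exp2r // /N /bnd /= trunc_log0; have := dsize_gt0 dJ.
    by move: (dsize _) => x; lia.
  have hs : absz (foldl (fun s er => if er.1 \in J then iadd s er.2 else s) (Posz 0) (take i (clf I)))
      < absz (Posz 0) + 2 ^ dsize (enc (take i (clf I))).
    apply: foldl_add_size => y z; apply: leq_trans (_ : absz z + absz y.2 <= _).
      by rewrite /iadd; case: ifP => _; lia.
    rewrite leq_add2l; apply: leq_trans (ltnW (absz_dsize _)) _; rewrite leq_exp2l //.
    exact: leqW (leq_addl _ _).
  rewrite [absz 0]/= add0n in hs; apply: leq_trans (dsize_log hs) _.
  rewrite addn1 expnS; have := leq_trans (dsize_enc_take _ i (clf I)) hk.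
  have N2 : 2 <= N by exact: bnd2.
  have : 0 < N ^ k by rewrite expn_gt0 (leq_trans _ N2).
  clear -N2; move: (dsize _) (N ^ k) => x y; nia.
Qed.

Lemma pt_ecanon : pt (fun I (J : seq (edg I)) => ecanon (@clf I) J).
Proof. rewrite /ecanon. pts. Qed.

Lemma size_ecanon I J : size (ecanon (@clf I) J) <= size (clf I).
Proof. by rewrite /ecanon size_map size_filter count_size. Qed.

Ltac hookA1 := lazymatch goal with
  | |- pt (fun I a => rcover _ _ _ _) => eapply (pt_app2 (g := fun I K t => rcover (@askf I) (@clf I) K t)); [exact pt_rcover | pts | pts]
  | |- pt (fun I a => costof _ _) => eapply (pt_comp (g := fun I J => costof (@clf I) J)); [pts | exact pt_costof]
  | |- pt (fun I a => ecanon _ _) => eapply (pt_comp (g := fun I J => ecanon (@clf I) J)); [pts | exact pt_ecanon]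
  | |- pt (fun I a => @?x I a != @?y I a) => change (pt (fun I a => ~~ (x I a == y I a))); pts
  | |- _ => hookA0
  end.
Ltac pthook ::= hookA1.

Lemma pt_gastep : pt (fun I (st : seq (vtx I) * seq (edg I)) => gastep (@askf I) (@clf I) st).
Proof. rewrite /gastep /star /del. pts. Qed.

Lemma ga_size I (s : seq (vtx I)) (st : seq (vtx I) * seq (edg I)) : size st.1 <= nv I -> size st.2 <= size (clf I) ->
  size (foldl (fun st _ => gastep (@askf I) (@clf I) st) st s).1 <= nv I /\
  size (foldl (fun st _ => gastep (@askf I) (@clf I) st) st s).2 <= size (clf I).
Proof.
elim: s st => //= v s IH st h1 h2; apply: IH; rewrite /gastep; case: (argmin _ _) => [tJ|] //=.
  exact: leq_trans (size_del _ _) h1.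
exact: size_ecanon.
Qed.

Lemma pt_gacover : pt (fun I (J : seq (edg I)) => gacover (@askf I) (@clf I) J).
Proof.
have [j hj] := size_clf Hcl.
have [k1 h1] := bd_seq bd_vtx.
have [k2 h2] := @bd_seq_bnd (fun I => seq (edg I)) _ _ _ (bd_pair bd_vtx bd_vtx) j.
rewrite /gacover; apply: pt_snd.
apply: (@pt_foldl _ _ (fun I => seq (vtx I) * seq (edg I))%type _ _ _ (fun I (q : seq (edg I)) st v => gastep (@askf I) (@clf I) st)
  (fun I J => (mintrans (@askf I) J, ecanon (@clf I) J)) (fun I q => enum (vtx I)) (k1 + k2 + 1 + 1 + 1)).
- by eapply (pt_comp (g := fun I st => gastep (@askf I) (@clf I) st)); [pts | exact pt_gastep].
- by pts.
- by pts.
- move=> I J i; cbv beta.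
  have [||] := @ga_size I (take i (enum (vtx I))) (mintrans (@askf I) J, ecanon (@clf I) J).
  + by apply: leq_trans (size_mtfold _ _ _ _) _; rewrite size_enum_ord.
  + exact: size_ecanon.
  case: (foldl _ _ _) => T J' /= hT hJ'.
  apply: bd_pow; first exact: bnd2.
  apply: powD; first exact: bnd2.
    apply: h1; first by rewrite /bnd; lia.
    by apply: leq_trans hT _; have := nv_isz I; rewrite /bnd; lia.
  by apply: h2; apply: leq_trans hJ' (hj _ _).
Qed.

Lemma pt_round : pt (fun I (J : seq (edg I)) => round (@askf I) (@clf I) J).
Proof. rewrite /round. pts. Qed.
End Alg2.

Definition qlist I := [seq (nat_of_ord v).+1 | v <- enum (vtx I)].
Definition solve I : seq (edg I) := bestcover (@asks I) (clS I) (qlist I).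

Ltac hookB := lazymatch goal with
  | |- pt (fun I a => round (@asks _) (clS _) _) => eapply (pt_comp (g := fun I J => round (@asks I) (clS I) J)); [pts | exact (pt_round pt_asks pt_clS)]
  | |- pt (fun I a => round (askr (@asks _)) (flc (clS _)) _) =>
      eapply (pt_comp (g := fun I J => round (askr (@asks I)) (flc (clS I)) J)); [pts | exact (pt_round (pt_askr pt_asks) (pt_flc pt_clS))]
  | |- pt (fun I a => pcover (@asks _) (clS _) _) => eapply (pt_comp (g := fun I J => pcover (@asks I) (clS I) J)); [pts | exact (pt_pcover pt_asks pt_clS)]
  | |- pt (fun I a => pcover (askr (@asks _)) (flc (clS _)) _) =>
      eapply (pt_comp (g := fun I J => pcover (askr (@asks I)) (flc (clS I)) J)); [pts | exact (pt_pcover (pt_askr pt_asks) (pt_flc pt_clS))]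
  | |- pt (fun I a => gacover (@asks _) (clS _) _) => eapply (pt_comp (g := fun I J => gacover (@asks I) (clS I) J)); [pts | exact (pt_gacover pt_asks pt_clS)]
  | |- pt (fun I a => costof (clS _) _) => eapply (pt_comp (g := fun I J => costof (clS I) J)); [pts | exact (pt_costof pt_clS)]
  end.
Ltac pthook ::= hookB.

Lemma pt_dround : pt (fun I (J : seq (edg I)) => dround (@asks I) (clS I) J).
Proof. rewrite /dround. pts. Qed.

Lemma size_dround I J : size (dround (@asks I) (clS I) J) <= size (clS I).
Proof.
rewrite /dround size_map; apply: leq_trans (@size_ecanon (fun I => flc (clS I)) I _) _.
by rewrite size_map.
Qed.

Lemma pt_rounds A (eA : Enc A) : pt (fun I (_ : A I) => rounds (@asks I) (clS I)).
Proof.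
have [j hj] := size_clf pt_clS.
have [k2 h2] := @bd_seq_bnd A _ _ _ (bd_pair bd_vtx bd_vtx) j.
apply: (@pt_foldl _ _ (fun I => seq (edg I)) _ _ _ (fun I q J v => dround (@asks I) (clS I) J)
  (fun I J => [::]) (fun I q => enum (vtx I)) k2).
- by eapply (pt_comp (g := fun I J => dround (@asks I) (clS I) J)); [pts | exact pt_dround].
- by pts.
- by pts.
- move=> I a i; apply: h2; apply: leq_trans (hj _ (enc a)).
  case/lastP: (take i _) => [|s x] //; rewrite foldl_rcons; exact: size_dround.
Qed.

Lemma pt_succ A (eA : Enc A) (f : forall I, A I -> nat) : pt f -> pt (fun I a => (f I a).+1).
Proof.
move=> hf; apply: (pt_ext (f := fun I a => f I a + 1)); first by move=> I a; rewrite addn1.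
by apply: pt_addn => //; apply: pt_nat.
Qed.

Lemma pt_solve : pt (fun I (_ : nat) => solve I).
Proof.
rewrite /solve /bestcover /qlist /pcboth /odflt /oapp.
apply: pt_omatch; [|pts|pts].
apply: pt_argmin; first by pts.
apply: pt_map; first by pts.
apply: pt_cons; first by pts.
apply: pt_cons; first exact: pt_rounds.
apply: pt_map; first by pts.
by apply: pt_map; [apply: pt_succ; pts | pts].
Qed.

Lemma solve_program : exists (A : program) (p : {poly nat}), forall I,
  exists t, computes (Or I) A (inst_data I) (enc_edges (solve I)) t /\ t <= p.[isz I]%R.
Proof.
have [P [k hP]] := pt_solve.
exists (Seq (Assign 1 (Lit 0)) (Seq (P 1) (Assign 0 (Var 1)))).
(* One power pays for the run and one for copying the output; [bnd] of the dummy argument 0 is the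
   input size plus 3. *)
exists (('X + 3%:R%:P) ^+ k + (('X + 3%:R%:P) ^+ k) + 10%:R%:P)%R => I.
have [hs hr] := hP I 0.
have [s [t [e v p ht]]] := hr 1 (upd (upd (fun=> Leaf 0) 0 (inst_data I)) 1 (Leaf 0)) isT erefl erefl.
eexists; split.
  exists (upd s 0 (eval_expr s (Var 1))); last by rewrite upd_eq /= v.
  eapply ExecSeq; first by eapply ExecAssign.
  eapply ExecSeq; first exact: e.
  by eapply ExecAssign.
have hb : bnd I (Leaf (Posz 0)) = isz I + 3 by rewrite /bnd /= trunc_log0; lia.
have {}hs : dsize (enc_edges (solve I)) <= (isz I + 3) ^ k by rewrite -hb; exact: hs.
have {}ht : t <= (isz I + 3) ^ k by rewrite -hb; exact: ht.
have hv : eval_expr s (Var 1) = enc_edges (solve I) by rewrite /= v.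
rewrite hv [eval_expr _ (Lit 0)]/= [dsize (Leaf 0)]/= trunc_log0 !hornerE /= !natrXE.
have hN : (isz I + 1 + 1 + 1)%R = (isz I + 3)%N by rewrite -[LHS]/((((isz I + 1)%N + 1)%N + 1)%N); lia.
rewrite hN; move: hs ht; set x := (_ + 3) ^ k; move: (dsize _) => y hs ht.
rewrite -[X in _ < X]/(x + x + 1 + 1 + 1 + 1 + 1 + 1 + 1 + 1 + 1 + 1); move: hs ht; clear; lia.
Qed.

(** * The primal-dual procedure *)

Lemma argminP (T : eqType) (key : T -> int) (l : seq T) :
  if argmin key l is Some x then x \in l /\ (forall y, y \in l -> (key x <= key y)%R) else l = [::].
Proof.
rewrite /argmin; set stp := (fun acc _ => _).
have h s acc : if foldl stp acc s is Some x then
    (x \in s \/ acc = Some x) /\ (forall y, y \in s \/ acc = Some y -> (key x <= key y)%R)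
    else s = [::] /\ acc = None.
  elim: s acc => [|y s IH] acc /=.
    by case: acc => [x|] //; split; [right | move=> y [//|[->]]].
  have := IH (stp acc y); case E : (foldl _ _ _) => [x|]; last first.
    by case=> _; rewrite /stp; case: acc {E} => [z|//]; case: ifP.
  case=> h1 h2; split.
    case: h1 => [xs|]; first by left; rewrite inE xs orbT.
    rewrite /stp; case: (acc) => [z|]; last by case=> ->; left; rewrite mem_head.
    by case: ifP => _ [->]; [right | left; rewrite mem_head].
  move=> z; rewrite inE => hz.
  have hz' : [\/ z \in s, z = y | acc = Some z] by case: hz => [/orP[/eqP|]|]; [constructor 2|constructor 1|constructor 3].
  have hs w : stp acc y = Some w -> (key x <= key w)%R by move=> hw; apply: h2; right.
  case: hz' => [zs|->|accz]; first by apply: h2; left.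
  - move: hs; rewrite /stp; case: (acc) => [w|]; last by apply.
    by case: ifP => [wy|_] hs; [apply: le_trans (hs _ erefl) wy | apply: hs].
  - move: hs; rewrite /stp accz; case: ifP => [_|/negbT]; first by apply.
    by rewrite -ltNge => /ltW yz hs; apply: le_trans (hs _ erefl) yz.
have := h l None; case: (foldl _ _ _) => [x|[]//] [h1 h2].
by split=> [|y yl]; [case: h1 | apply: h2; left].
Qed.

Lemma ohdP (T : eqType) (l : seq T) : if ohd l is Some x then is_true (x \in l) else l = [::].
Proof. by have := argminP (fun=> Posz 0) l; rewrite -/(ohd l); case: (ohd l) => // x []. Qed.

Lemma mem_prs (T U : eqType) (s : seq T) (t : seq U) p :
  (p \in prs s t) = (p.1 \in s) && (p.2 \in t).
Proof.
case: p => x y /=; apply/flattenP/andP => [[l /mapP[a ain ->] /mapP[b bin [-> ->]]]|[xs yt]].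
  by split.
by exists [seq (x, y) | y <- t]; [apply: map_f | apply: map_f].
Qed.

Lemma mem_del (V : finType) (T : seq V) v t : (t \in del T v) = (t != v) && (t \in T).
Proof. by rewrite mem_filter. Qed.

Section PD.
Variable V : finType.
Notation edge := (V * V)%type.
Notation bis := (biset V).
Variables (F : {set bis}) (ask : seq edge -> V -> V -> option (bis * bis)).
Hypotheses (pF : proper_family F) (cF : crossing F) (hask : ask_ok F ask).
Variables (E : seq edge) (c : edge -> int).
Hypotheses (uE : uniq E) (c0 : forall e, e \in E -> (0 <= c e)%R).
Hypothesis covE : forall S, S \in F -> has (fun e => covers e S) E.
Let cl := [seq (e, c e) | e <- E].

Definition inpc (p : piece V) (X : bis) :=
  [&& X \in F, unc p.1 X, has (fun a => a \in X.1) p.2.1, has (fun b => b \notin X.2) p.2.2.1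
    & #|X.1| <= p.2.2.2].

Lemma unc_star T X : X \in F -> unc (star T) X = ~~ has (fun t => t \in X.1) T.
Proof.
move=> XF; apply/uncP/hasPn => [h t tT|h [t v]].
  have [v vX] := proper_out pF XF.
  by have := h (t, v); rewrite mem_prs /= tT mem_enum => /(_ isT); rewrite coversE /= vX andbT.
by rewrite mem_prs /= => /andP[/h tX _]; rewrite coversE /= (negbTE tX).
Qed.

Lemma pcandsP J p X : reflect (exists a b, [/\ a \in p.2.1, b \in p.2.2.1,
   exists Y, ask (p.1 ++ J) a b = Some (X, Y) & #|X.1| <= p.2.2.2]) (X \in pcands ask J p).
Proof.
apply: (iffP flattenP) => [[l /mapP[[a b]]]|[a [b [ain bin [Y eY] hX]]]].
  rewrite mem_prs /= => /andP[ain bin] ->; case E1 : (ask _ _ _) => [[X' Y]|] //.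
  by case: ifP => //= hq; rewrite inE => /eqP ->; exists a, b; split=> //; exists Y.
exists [:: X]; last by rewrite inE.
by apply/mapP; exists (a, b); rewrite ?mem_prs /= ?ain ?bin // eY /= hX.
Qed.

Lemma pcands_in J p X : X \in pcands ask J p -> inpc p X && unc J X.
Proof.
case/pcandsP => a [b [ain bin [Y eY] hX]]; have := hask (p.1 ++ J) a b; rewrite eY => -[/and4P[h1 h2 h3 h4] _ _ _].
move: h2; rewrite unc_cat => /andP[h2 ->]; rewrite andbT; apply/and5P; split=> //; apply/hasP; by [exists a | exists b].
Qed.

Lemma findmin_none J p X : findmin ask J p = None -> inpc p X -> ~~ unc J X.
Proof.
move=> h /and5P[XF uX /hasP[a ap aX] /hasP[b bp bX] hq]; apply/negP => uJ.
have := argminP (fun X : bis => Posz #|X.1|) (pcands ask J p); rewrite -/(findmin ask J p) h => e.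
have := hask (p.1 ++ J) a b; case E1 : (ask _ _ _) => [[Z Y]|]; last first.
  by move=> /(_ X); rewrite /sep XF unc_cat uX uJ aX bX.
case=> _ /(_ X); rewrite /sep XF unc_cat uX uJ aX bX => /(_ isT) /andP[ZX _] _ _.
have : Z \in pcands ask J p.
  by apply/pcandsP; exists a, b; split=> //; [exists Y | apply: leq_trans (subset_leq_card ZX) hq].
by rewrite e.
Qed.

Lemma findmin_some J p S : findmin ask J p = Some S -> inpc p S /\ unc J S.
Proof.
have := argminP (fun X : bis => Posz #|X.1|) (pcands ask J p); rewrite -/(findmin ask J p) => h e.
by move: h; rewrite e => -[/pcands_in /andP[]].
Qed.

(** Having the fewest inner vertices does not yet make [S] least. But the candidates are least
    members for pairs of vertices: a [Y] below [S] yields a candidate [Z] below [Y], which has the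
    same inner part as [S] by minimality, and then [S] lies below [Z] by the choice of its own
    pair. *)
Lemma findmin_min J p S Y : findmin ask J p = Some S -> inpc p Y -> unc J Y -> bile Y S -> bile S Y.
Proof.
have := argminP (fun X : bis => Posz #|X.1|) (pcands ask J p); rewrite -/(findmin ask J p) => h e.
move: h; rewrite e => -[/pcandsP[a0 [b0 [a0p b0p [Y0 eY0] hS]]] hmin].
move=> /and5P[YF uY /hasP[a ap aY] /hasP[b bp bY] hq] uJ YS.
have := hask (p.1 ++ J) a b; case E1 : (ask _ _ _) => [[Z Z']|]; last first.
  by move=> /(_ Y); rewrite /sep YF unc_cat uY uJ aY bY.
case=> /and4P[ZF uZ aZ bZ] /(_ Y); rewrite /sep YF unc_cat uY uJ aY bY => /(_ isT) ZY _ _.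
have Zin : Z \in pcands ask J p.
  apply/pcandsP; exists a, b; split=> //; first by exists Z'.
  by case/andP: ZY => ZY1 _; apply: leq_trans (subset_leq_card ZY1) hq.
have := hmin _ Zin; rewrite lez_nat => cSZ.
have ZS := bile_trans ZY YS.
have e1 : Z.1 = S.1 by case/andP: ZS => s1 _; apply/eqP; rewrite eqEcard s1.
have := hask (p.1 ++ J) a0 b0; rewrite eY0 => -[/and4P[SF uS a0S b0S] /(_ Z)].
rewrite /sep ZF uZ e1 a0S /=; case/andP: ZS => _ s2.
have -> : b0 \notin Z.2 by apply: contra b0S => /(subsetP s2).
by move=> /(_ isT) SZ _ _; apply: bile_trans SZ ZY.
Qed.

Lemma chkP pcs K : reflect (forall p X, p \in pcs -> inpc p X -> ~~ unc K X) (chk ask pcs K).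
Proof.
apply: (iffP allP) => [h p X pin pX|h p pin].
  by apply: findmin_none pX; have := h p pin; case: findmin.
by case E1 : findmin => [S|] //; have [/h a b] := findmin_some E1; have := a pin; rewrite b.
Qed.

(* A dual solution together with the order in which its tight edges were bought. *)
Definition item := (bis * int * edge)%type.
Implicit Types (tr : seq item) (it : item).
Definition bought tr := [seq it.2 | it <- tr].
Definition ysum tr e : int := (\sum_(it <- tr | covers e it.1.1) it.1.2)%R.

(** [ysum] is the dual load of an edge, and the third clause is dual feasibility. The last clause
    says of each item that its biset was uncovered when charged and that its edge was tight when
    bought. *)
Definition pdinv tr (st : pd_state V) :=
  [/\ st.1 = [seq (e, (c e - ysum tr e)%R) | e <- E], st.2 = bought tr,
      forall e, e \in E -> (0 <= c e - ysum tr e)%R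
    & forall tr1 it tr2, tr = tr1 ++ it :: tr2 ->
      [/\ it.2 \in E, covers it.2 it.1.1, (0 <= it.1.2)%R, unc (bought tr1) it.1.1 &
          ysum (tr1 ++ [:: it]) it.2 = c it.2]].

Lemma pdinv0 : pdinv [::] (cl, [::]).
Proof.
split=> //=; last by case.
  by rewrite /cl; apply: eq_map => e; rewrite /ysum big_nil subr0.
by move=> e /c0; rewrite /ysum big_nil subr0.
Qed.

Lemma ysum_cat tr1 tr2 e : ysum (tr1 ++ tr2) e = (ysum tr1 e + ysum tr2 e)%R.
Proof. exact: big_cat. Qed.
Lemma ysum1 it e : ysum [:: it] e = (if covers e it.1.1 then it.1.2 else 0)%R.
Proof. by rewrite /ysum big_cons big_nil addr0. Qed.

Lemma pdstep_none p st : findmin ask st.2 p = None -> pdstep ask p st = st.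
Proof. by rewrite /pdstep => ->. Qed.

Lemma mem_split (T : eqType) (s : seq T) x : x \in s -> exists s1 s2, s = s1 ++ x :: s2.
Proof. by case/splitPr => s1 s2; exists s1, s2. Qed.

Lemma cat_rcons_split (T : Type) (s s1 s2 : seq T) x y :
  s ++ [:: x] = s1 ++ y :: s2 -> (exists s2', s = s1 ++ y :: s2') \/ (s1 = s /\ y = x).
Proof.
elim: s s1 => [|z s IH] [|z1 s1] /=.
- by case=> ->; right.
- by case=> _; case: s1.
- by case=> <- _; left; exists s.
- by case=> -> /IH [[s2' ->]|[-> ->]]; [left; exists s2' | right].
Qed.

Lemma pdstep_inv tr st p S : pdinv tr st -> findmin ask st.2 p = Some S ->
  exists y e, pdinv (tr ++ [:: ((S, y), e)]) (pdstep ask p st).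
Proof.
case: st => red J [/= hred hJ hr htr] hS; rewrite /pdstep /= hS.
have [/and5P[SF _ _ _ _] uS] := findmin_some hS.
have := argminP (fun er : edge * int => er.2) [seq er <- red | covers er.1 S].
case: (argmin _ _) => [[e0 r0]|] /=; last first.
  have /hasP[e eE eS] := covE SF.
  move=> h; have : (e, (c e - ysum tr e)%R) \in [seq er <- red | covers er.1 S].
    by rewrite mem_filter /= eS hred; apply/mapP; exists e.
  by rewrite h.
rewrite mem_filter /= => -[/andP[e0S]]; rewrite hred => /mapP[e' e'E [e0e er0]] hmin.
rewrite -hred in hmin; exists r0, e0; split => /=.
- rewrite -map_comp; apply: eq_map => e /=; rewrite ysum_cat ysum1 /= /isub.
  by case: ifP => _; rewrite ?addr0 // opprD addrA.
- by rewrite hJ /bought map_cat.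
- move=> e eE; rewrite ysum_cat ysum1 /=; case: ifP => eS; last by rewrite addr0; exact: hr.
  rewrite opprD addrA subr_ge0; apply: (hmin (e, (c e - ysum tr e)%R)).
  by rewrite mem_filter /= eS hred; apply/mapP; exists e.
- move=> tr1 it tr2 ee; case: (cat_rcons_split ee) => [[s2' etr]|[-> ->]]; first exact: htr etr.
  split=> //=; [by rewrite e0e | by rewrite er0; exact: hr | |].
    by rewrite -hJ.
  by rewrite ysum_cat ysum1 /= e0S er0 e0e addrC subrK.
Qed.

Lemma bought_uniq tr st : pdinv tr st -> uniq (bought tr) /\ {subset bought tr <= E}.
Proof.
case=> _ _ _ h; split; last first.
  by move=> e /mapP[it /mem_split[tr1 [tr2 etr]] ->]; have [] := h _ _ _ etr.
have : forall s1 s2, tr = s1 ++ s2 -> uniq (bought s1).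
  move=> s1; elim/last_ind: s1 => // s1 it IH s2 e.
  rewrite /bought map_rcons rcons_uniq (IH (it :: s2)) ?andbT; last by rewrite -cat_rcons.
  have [] := h s1 it s2; first by rewrite e cat_rcons.
  move=> _ a _ /uncP b _.
  by apply: contraL a => /b.
by move/(_ tr [::]); rewrite cats0; apply.
Qed.

Lemma pdrun_inv tr st p : pdinv tr st ->
  exists tr', [/\ pdinv (tr ++ tr') (pdrun ask cl p st), findmin ask (pdrun ask cl p st).2 p = None
    & forall t1 it t2, tr' = t1 ++ it :: t2 -> findmin ask (bought (tr ++ t1)) p = Some it.1.1].
Proof.
move=> h0.
have H (s : seq (edge * int)) : exists tr', [/\ pdinv (tr ++ tr') (foldl (fun st _ => pdstep ask p st) st s),
    findmin ask (foldl (fun st _ => pdstep ask p st) st s).2 p = None \/ size s <= size tr'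
    & forall t1 it t2, tr' = t1 ++ it :: t2 -> findmin ask (bought (tr ++ t1)) p = Some it.1.1].
  elim/last_ind: s => [|s x [tr' [h1 h2 h3]]].
    by exists [::]; rewrite cats0; split=> //=; [right | case].
  rewrite foldl_rcons; set st' := foldl _ _ _ in h1 h2 *.
  case E1 : (findmin ask st'.2 p) => [S|]; last first.
    by rewrite pdstep_none //; exists tr'; split=> //; left.
  have [y [e h4]] := pdstep_inv h1 E1.
  exists (tr' ++ [:: ((S, y), e)]); rewrite catA; split=> //.
    case: h2 => [|h2]; first by rewrite E1.
    by right; rewrite size_rcons size_cat addn1 ltnS.
  move=> t1 it t2 ee; case: (cat_rcons_split ee) => [[s2' etr]|[-> ->]]; first exact: h3 etr.
  by case: h1 => _ <- _ _.
have [tr' [h1 h2 h3]] := H cl; exists tr'; split=> //.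
(* A biset still uncovered after [size E] purchases would leave no edge unbought, yet some edge of
   [E] covers it. *)
case: h2 => // hs; case E1 : findmin => [S|] //; exfalso.
have [/and5P[SF _ _ _ _]] := findmin_some E1; case: (h1) => _ -> _ _ /uncP uS.
have [u sub] := bought_uniq h1.
have /hasP[e eE eS] := covE SF.
have : e \in bought (tr ++ tr').
  have hs' : size E <= size (bought (tr ++ tr')) by move: hs; rewrite !size_map size_cat; lia.
  by have [_ ->] := uniq_min_size u sub hs'.
by move/uS; rewrite eS.
Qed.

(** The witness [W] of a kept edge [e] is a biset that the deletion of [e] would have uncovered.
    When [e] was examined, all edges bought before it were still present, so none of them covers
    [W]. *)
Lemma rdel_spec pcs J : uniq J -> chk ask pcs J ->
  [/\ {subset rdel ask pcs J <= J}, uniq (rdel ask pcs J), chk ask pcs (rdel ask pcs J)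
   & forall e, e \in rdel ask pcs J -> exists p W, [/\ p \in pcs, inpc p W,
       unc (take (index e J) J) W & forall f, f \in rdel ask pcs J -> f != e -> ~~ covers f W]].
Proof.
move=> uJ cJ.
have chk_eq K K' : K =i K' -> chk ask pcs K -> chk ask pcs K'.
  move=> e /chkP h; apply/chkP => p X pin pX; apply: contra (h p X pin pX).
  by apply: unc_sub => f; rewrite e.
suff H (l r kept : seq edge) : J = l ++ r -> {subset kept <= r} -> uniq kept -> chk ask pcs (l ++ kept) ->
   (forall e, e \in kept -> exists p W, [/\ p \in pcs, inpc p W,
       unc (take (index e J) J) W & forall f, f \in kept -> f != e -> ~~ covers f W]) ->
   let J' := (foldl (rdstep ask pcs) (rev l, kept) (rev l)).2 in
  [/\ {subset J' <= J}, uniq J', chk ask pcs J'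
   & forall e, e \in J' -> exists p W, [/\ p \in pcs, inpc p W,
       unc (take (index e J) J) W & forall f, f \in J' -> f != e -> ~~ covers f W]].
  by apply: (H J [::] [::]); rewrite ?cats0.
elim/last_ind: l r kept => [|l e IH] r kept eJ sub uk ck hk.
  by split=> //= f /sub; rewrite eJ.
rewrite rev_rcons.
have -> : foldl (rdstep ask pcs) (e :: rev l, kept) (e :: rev l) =
  foldl (rdstep ask pcs) (if chk ask pcs (rev l ++ kept) then (rev l, kept) else (rev l, e :: kept)) (rev l) by [].
rewrite cat_rcons in eJ.
have e_l : e \notin l /\ e \notin r.
  by move: uJ; rewrite eJ cat_uniq /= => /and3P[_ /norP[a _] /andP[b _]].
have ie : index e J = size l by rewrite eJ index_cat (negbTE e_l.1) /= eqxx addn0.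
case: ifP => hc.
  apply: (IH (e :: r)) => //.
  - by move=> f /sub fr; rewrite inE fr orbT.
  - by apply: chk_eq hc => f; rewrite !mem_cat mem_rev.
apply: (IH (e :: r)) => //.
- by move=> f; rewrite !inE => /orP[->//|/sub ->]; rewrite orbT.
- by rewrite /= uk andbT; apply/negP => /sub; apply/negP; exact: e_l.2.
- by apply: chk_eq ck => f; rewrite !mem_cat mem_rcons !inE -orbA orbCA.
- move=> f; rewrite inE => /orP[/eqP ->|fk].
    move/negbT: hc => /allPn[p pin]; case E1 : findmin => [W|] // _.
    have [pW] := findmin_some E1; rewrite unc_cat => /andP[u1 /uncP u2].
    exists p, W; split=> //.
      rewrite ie eJ take_size_cat //; apply: unc_sub u1 => g; by rewrite mem_rev.
    by move=> g; rewrite inE => /orP[/eqP ->|/u2 //]; rewrite eqxx.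
  have [p [W [pin pW uW hW]]] := hk f fk; exists p, W; split=> // g.
  (* The edge [e], kept now, was bought before [f], so it is among the edges known not to cover the
     witness of [f]. *)
  rewrite inE => /orP[/eqP -> _|gk]; last exact: hW.
  move/uncP: uW; apply.
  have fr := sub f fk.
  have hf : f \notin l by move: uJ; rewrite eJ cat_uniq /= => /and3P[_ /norP[_ /hasPn a] _]; exact: a.
  have fe : (e == f) = false by apply/negbTE; apply: contraNneq e_l.2 => ->.
  rewrite eJ index_cat (negbTE hf) /= fe take_cat ifN ?mem_cat; last by rewrite -leqNgt leq_addr.
  by rewrite addKn /= mem_head orbT.
Qed.

(** * At most one kept edge per charged biset, and weak duality *)

Section Exact.
Variables (A : bis -> Prop) (tr : seq item) (st : pd_state V) (J' : seq edge).
Hypothesis Acap : forall X Y u, A X -> A Y -> u \in X.1 -> u \in Y.1 -> A (bicap X Y) /\ A (bicup X Y).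
Hypothesis inv : pdinv tr st.
Hypothesis minS : forall tr1 it tr2 X u, tr = tr1 ++ it :: tr2 -> A X -> unc (bought tr1) X ->
  u \in it.1.1.1 -> u \in X.1 -> bile it.1.1 X.
Hypothesis uJ' : uniq J'.
Hypothesis subJ' : {subset J' <= bought tr}.
Hypothesis covJ' : forall X, A X -> ~~ unc J' X.
Hypothesis wit : forall e, e \in J' -> exists W, [/\ A W, unc (take (index e (bought tr)) (bought tr)) W
  & forall f, f \in J' -> f != e -> ~~ covers f W].

(** A charged biset is uncovered by all earlier purchases, so an edge covering it was bought at its
    charge or later. *)
Lemma bought_before tr1 it tr2 e : tr = tr1 ++ it :: tr2 -> e \in bought tr -> covers e it.1.1 ->
  {subset bought tr1 <= take (index e (bought tr)) (bought tr)}.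
Proof.
move=> etr ein ecov f fin.
have [_ _ _ /(_ _ _ _ etr) [_ _ _ /uncP u _]] := inv.
have en1 : e \notin bought tr1 by apply: contraL ecov => /u.
rewrite etr /bought map_cat index_cat (negbTE en1) take_cat ifN ?mem_cat ?fin //.
by rewrite -leqNgt leq_addr.
Qed.

(** The witnesses of [e] and [f] both contain the charged biset, so they intersect, and their union
    is covered by an edge of [J']. That edge covers one of the witnesses, hence is [e] or [f]; but
    the head of either lies in the outer part of the other's witness. *)
Lemma one_edge it e f : it \in tr -> e \in J' -> f \in J' -> covers e it.1.1 -> covers f it.1.1 -> e = f.
Proof.
move=> itin eJ fJ ce cf; have [tr1 [tr2 etr]] := mem_split itin.
have [We [AWe uWe hWe]] := wit eJ; have [Wf [AWf uWf hWf]] := wit fJ.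
apply/eqP/negPn/negP => ne.
have tail g W : g \in J' -> A W -> unc (take (index g (bought tr)) (bought tr)) W ->
   (forall h, h \in J' -> h != g -> ~~ covers h W) -> covers g it.1.1 ->
   [/\ covers g W, g.1 \in W.1, g.2 \notin W.2 & bile it.1.1 W].
  move=> gJ AW uW hW cg.
  have cgW : covers g W.
    have := covJ' AW; rewrite /unc -has_predC => /hasP[h hJ /=]; rewrite negbK => ch.
    by case: (eqVneq h g) ch => [-> //|/(hW _ hJ)/negbTE ->].
  move: (cgW) (cg); rewrite !coversE => /andP[a b] /andP[c' d]; split=> //; first by rewrite a.
  by apply: (minS etr AW _ c' a); apply: unc_sub (bought_before etr (subJ' gJ) cg) uW.
have [ceW e1 e2 Se] := tail e We eJ AWe uWe hWe ce.
have [cfW f1 f2 Sf] := tail f Wf fJ AWf uWf hWf cf.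
have eS : e.1 \in it.1.1.1 by move: ce; rewrite coversE => /andP[].
have fS : f.1 \in it.1.1.1 by move: cf; rewrite coversE => /andP[].
have eWf : e.1 \in Wf.1 by case/andP: Sf => /subsetP a _; exact: a.
have fWe : f.1 \in We.1 by case/andP: Se => /subsetP a _; exact: a.
have [_ AU] := Acap AWe AWf e1 eWf.
have := covJ' AU; rewrite /unc -has_predC => /hasP[g gJ /=]; rewrite negbK coversE !inE.
have e2f : e.2 \in Wf.2 by have := hWf e eJ ne; rewrite coversE eWf /= negbK.
have f2e : f.2 \in We.2 by have := hWe f fJ; rewrite eq_sym => /(_ ne); rewrite coversE fWe /= negbK.
case/andP => /orP[g1|g1] /norP[g2 g3].
  have := hWe g gJ; case: (eqVneq g e) => [eg _|_ /(_ isT)]; last by rewrite coversE g1 g2.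
  by rewrite eg e2f in g3.
have := hWf g gJ; case: (eqVneq g f) => [eg _|_ /(_ isT)]; last by rewrite coversE g1 g3.
by rewrite eg f2e in g2.
Qed.

(** A tight edge stays tight, because the bisets charged later are uncovered by it. *)
Lemma cost_ysum e : e \in bought tr -> c e = ysum tr e.
Proof.
case/mapP => it /splitPr H ->; case: H inv => tr1 tr2 [_ _ _ h].
have [_ _ _ _ <-] := h tr1 it tr2 erefl.
have -> : tr1 ++ it :: tr2 = (tr1 ++ [:: it]) ++ tr2 by rewrite -catA.
rewrite [RHS]ysum_cat; suff -> : ysum tr2 it.2 = 0%R by rewrite addr0.
rewrite /ysum big1_seq // => j /andP[cj jin].
case/splitPr: jin h => s1 s2 h.
have [] := h (tr1 ++ it :: s1) j s2; first by rewrite -catA.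
move=> _ _ _ /uncP u _; have := u it.2; rewrite cj => u'; suff : false by [].
by apply: u'; rewrite /bought map_f // mem_cat mem_head orbT.
Qed.

Lemma cost_dual : (\sum_(e <- J') c e <= \sum_(it <- tr) it.1.2)%R.
Proof.
have -> : (\sum_(e <- J') c e)%R = (\sum_(it <- tr) \sum_(e <- J' | covers e it.1.1) it.1.2)%R.
  transitivity (\sum_(e <- J') ysum tr e)%R.
    by rewrite big_seq [RHS]big_seq; apply: eq_bigr => e /subJ'; exact: cost_ysum.
  by rewrite /ysum (exchange_big_dep xpredT).
rewrite big_seq [X in (_ <= X)%R]big_seq; apply: ler_sum => it itin.
have y0 : (0 <= it.1.2)%R.
  case/splitPr: itin inv => s1 s2 [_ _ _ h]; by have [] := h s1 it s2 erefl.
rewrite -big_filter.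
have : size [seq e <- J' | covers e it.1.1] <= 1.
  have hu := filter_uniq (fun e => covers e it.1.1) uJ'.
  have hm e : e \in [seq e <- J' | covers e it.1.1] -> e \in J' /\ covers e it.1.1.
    by rewrite mem_filter => /andP[].
  case: [seq _ <- _ | _] hu hm => [|e [|f l]] // /andP[ef _] hm.
  have [a b] := hm e (mem_head _ _).
  have [a' b'] : f \in J' /\ covers f it.1.1 by apply: hm; rewrite inE mem_head orbT.
  by rewrite (one_edge itin a a' b b') inE eqxx in ef.
case: [seq _ <- _ | _] => [|e [|f l]] // _; first by rewrite big_nil.
by rewrite big_cons big_nil addr0.
Qed.

(** [PA] confines the LP value to edges that cover a member of [A]. Bounds for families without
    common covering edges can then be added up to a single LP. *)
Lemma dual_lp (R : realType) (x : edge -> R) (PA : pred edge) :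
  (forall it, it \in tr -> A it.1.1) ->
  (forall e, e \in E -> (0 <= x e)%R) ->
  (forall X, A X -> (1 <= \sum_(e <- E | covers e X) x e)%R) ->
  (forall e X, e \in E -> A X -> covers e X -> PA e) ->
  ((\sum_(it <- tr) it.1.2)%:~R <= \sum_(e <- E | PA e) (c e)%:~R * x e)%R.
Proof.
move=> trA x0 xc hPA.
rewrite rmorph_sum /=.
apply: (@le_trans _ _ (\sum_(it <- tr) \sum_(e <- E | covers e it.1.1) it.1.2%:~R * x e)%R).
  rewrite big_seq [X in (_ <= X)%R]big_seq; apply: ler_sum => it itin.
  have y0 : (0 <= (it.1.2%:~R : R))%R.
    by case/splitPr: itin inv {trA} => s1 s2 [_ _ _ h]; have [_ _ h0 _ _] := h s1 it s2 erefl; rewrite ler0z.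
  by rewrite -mulr_sumr ler_peMr // xc //; exact: trA.
rewrite (exchange_big_dep xpredT) //= [X in (_ <= X)%R]big_mkcond /= big_seq [X in (_ <= X)%R]big_seq.
apply: ler_sum => e eE; rewrite -mulr_suml -rmorph_sum /= -/(ysum tr e).
case: ifP => hp.
  by apply: ler_wpM2r; [exact: x0 | rewrite ler_int -subr_ge0; case: inv => _ _ h _; exact: h].
rewrite /ysum big1_seq ?mul0r // => it /andP[ce /trA Ait].
by rewrite (hPA e it.1.1 eE Ait ce) in hp.
Qed.
End Exact.
End PD.

(** The fractional solution [plp] is arbitrary, so every bound proved for a [prob] holds for all
    feasible solutions at once. *)
Record prob (V : finType) (R : realType) := Prob {
  pfam : {set biset V};
  pask : seq (V * V) -> V -> V -> option (biset V * biset V);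
  pedg : seq (V * V);
  pcst : V * V -> int;
  plp : V * V -> R;
  p_proper : proper_family pfam;
  p_crossing : crossing pfam;
  p_ask : ask_ok pfam pask;
  p_uniq : uniq pedg;
  p_cst0 : forall e, e \in pedg -> (0 <= pcst e)%R;
  p_lp0 : forall e, e \in pedg -> (0 <= plp e)%R;
  p_lp1 : forall S, S \in pfam -> (1 <= \sum_(e <- pedg | covers e S) plp e)%R }.
Arguments p_proper {V R} p.
Arguments p_crossing {V R} p.
Arguments p_ask {V R} p.
Arguments p_uniq {V R} p.

Section Prob.
Variables (V : finType) (R : realType).
Notation edge := (V * V)%type.
Notation bis := (biset V).
Implicit Types (P : prob V R) (X Y S : bis) (K J : seq edge) (PA : pred edge).

Definition pcl P := [seq (e, pcst P e) | e <- pedg P].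
Definition lpval P PA : R := (\sum_(e <- pedg P | PA e) (pcst P e)%:~R * plp P e)%R.
Definition ecost P J : int := (\sum_(e <- J) pcst P e)%R.

Lemma p_cov P S : S \in pfam P -> has (fun e => covers e S) (pedg P).
Proof.
move=> SF; apply: contraT => /hasPn h; have := p_lp1 SF.
by rewrite big1_seq ?ler10 // => e /andP[ce /h]; rewrite ce.
Qed.

Lemma flip_lp1 P S : S \in cofamily (pfam P) ->
  (1 <= \sum_(e <- map (@fl V) (pedg P) | covers e S) plp P (fl e))%R.
Proof.
rewrite in_cofamily => /p_lp1; congr (_ <= _)%R; rewrite big_map.
by apply: eq_big => [e|e _]; rewrite ?covers_co ?flK.
Qed.

Definition flip P : prob V R := @Prob V R (cofamily (pfam P)) (askr (pask P)) (map (@fl V) (pedg P))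
  (fun e => pcst P (fl e)) (fun e => plp P (fl e))
  (proper_co (p_proper P)) (crossing_co (p_crossing P)) (askr_ok (p_ask P))
  (etrans (map_inj_uniq (inv_inj (@flK V)) _) (p_uniq P))
  (fun e h => p_cst0 (etrans (esym (mem_map (inv_inj (@flK V)) _ _)) (etrans (congr1 (fun z => z \in _) (flK e)) h)))
  (fun e h => p_lp0 (etrans (esym (mem_map (inv_inj (@flK V)) _ _)) (etrans (congr1 (fun z => z \in _) (flK e)) h)))
  (@flip_lp1 P).

Lemma pcl_flip P : pcl (flip P) = flc (pcl P).
Proof. by rewrite /pcl /flc /= -!map_comp; apply: eq_map => e; rewrite /= flK. Qed.
Lemma lpval_flip P PA : lpval (flip P) PA = lpval P (fun e => PA (fl e)).
Proof. by rewrite /lpval big_map; apply: eq_bigr => e _ /=; rewrite flK. Qed.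
Lemma ecost_flip P J : ecost (flip P) J = ecost P (map (@fl V) J).
Proof. by rewrite /ecost big_map. Qed.
Lemma mem_fl K e : (e \in map (@fl V) K) = (fl e \in K).
Proof. by rewrite -{1}(flK e) mem_map //; exact: inv_inj (@flK V). Qed.

Lemma lpval_ge0 P PA : (0 <= lpval P PA)%R.
Proof.
rewrite /lpval big_seq_cond; apply: sumr_ge0 => e /andP[eE _].
by rewrite mulr_ge0 ?ler0z ?p_cst0 ?p_lp0.
Qed.

Lemma inpc_tpiece P K t X :
  inpc (pfam P) (tpiece K t) X = [&& X \in pfam P, unc K X & t \notin X.2].
Proof.
rewrite /inpc /= orbF max_card andbT; case XF : (X \in _) => //=; congr (_ && _).
have [u uX] := proper_in (p_proper P) XF.
by rewrite (_ : has _ _ = true) //; apply/hasP; exists u; rewrite ?mem_enum.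
Qed.

(** [A] is a predicate rather than a piece because it is applied both to a single piece and to a
    union of pieces. *)
Lemma pd_exact P (A : bis -> Prop) tr st J' PA :
  (forall X Y u, A X -> A Y -> u \in X.1 -> u \in Y.1 -> A (bicap X Y) /\ A (bicup X Y)) ->
  pdinv (pedg P) (pcst P) tr st ->
  (forall it, it \in tr -> A it.1.1) ->
  (forall tr1 it tr2 X u, tr = tr1 ++ it :: tr2 -> A X -> unc (bought tr1) X ->
    u \in it.1.1.1 -> u \in X.1 -> bile it.1.1 X) ->
  uniq J' -> {subset J' <= bought tr} -> (forall X, A X -> X \in pfam P) ->
  (forall X, A X -> ~~ unc J' X) ->
  (forall e, e \in J' -> exists W, [/\ A W, unc (take (index e (bought tr)) (bought tr)) W
    & forall f, f \in J' -> f != e -> ~~ covers f W]) ->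
  (forall e X, e \in pedg P -> A X -> covers e X -> PA e) ->
  ((ecost P J')%:~R <= lpval P PA)%R.
Proof.
move=> Acap inv trA minS uJ' sub AF cov wit hPA.
apply: le_trans (dual_lp inv trA (@p_lp0 _ _ P) _ hPA); last by move=> X /AF; exact: p_lp1.
by rewrite ler_int; exact: (cost_dual Acap inv minS uJ' sub cov wit).
Qed.

(** Two members whose outer parts avoid [t] cross as soon as they intersect, so the piece is closed
    as [pd_exact] requires. *)
Lemma rootcoverP P K t PA :
  (forall e S, e \in pedg P -> S \in pfam P -> unc K S -> t \notin S.2 -> covers e S -> PA e) ->
  let J := rootcover (pask P) (pcl P) K t in
  [/\ uniq J, {subset J <= pedg P}, forall S, S \in pfam P -> unc K S -> t \notin S.2 -> ~~ unc J S
    & ((ecost P J)%:~R <= lpval P PA)%R].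
Proof.
move=> hPA; rewrite /rootcover.
have hE := @p_cov P.
have [tr [inv fm hm]] := pdrun_inv (p_ask P) (p_uniq P) hE (tpiece K t) (pdinv0 (@p_cst0 _ _ P)).
rewrite cat0s in inv; rewrite -/(pcl P) in inv fm.
set st := pdrun _ _ _ _ in inv fm *.
have est : st.2 = bought tr by case: inv.
have [ub subE] := bought_uniq inv.
have ck : chk (pask P) [:: tpiece K t] st.2 by rewrite /chk /= fm.
rewrite -est in ub; have [s1 s2 s3 s4] := rdel_spec (p_ask P) ub ck.
pose A X := inpc (pfam P) (tpiece K t) X.
have AE X : A X -> [&& X \in pfam P, unc K X & t \notin X.2] by rewrite /A inpc_tpiece.
have covA X : A X -> ~~ unc (rdel (pask P) [:: tpiece K t] st.2) X.
  by move=> AX; move/(chkP (p_ask P)): s3; apply; [exact: mem_head | exact: AX].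
have Acap X Y u : A X -> A Y -> u \in X.1 -> u \in Y.1 -> A (bicap X Y) /\ A (bicup X Y).
  rewrite /A !inpc_tpiece => /and3P[XF uX tX] /and3P[YF uY tY] hX hY.
  have [-> ->] := crossP (p_crossing P) XF YF hX hY tX tY.
  by rewrite unc_cap // unc_cup //= !inE (negbTE tX) (negbTE tY).
split=> //.
- by move=> e /s1; rewrite est; exact: subE.
- by move=> S SF uS tS; apply: covA; rewrite /A inpc_tpiece SF uS tS.
- apply: (pd_exact Acap inv) => //.
  + move=> it /mem_split[t1 [t2 etr]].
    by have [] := findmin_some (p_ask P) (hm _ _ _ etr).
  + move=> t1 it t2 X u etr AX uX uS uX1; have fS := hm _ _ _ etr.
    have [AS uncS] := findmin_some (p_ask P) fS.
    have [AI _] := Acap _ _ _ AS AX uS uX1.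
    apply: bile_trans (bile_capr it.1.1 X).
    by apply: (findmin_min (p_ask P) fS AI); [exact: unc_cap | exact: bile_capl].
  + by move=> e /s1; rewrite est.
  + by move=> X /AE /and3P[].
  + move=> e /s4[p [W [+ pW uW hW]]]; rewrite inE => /eqP ep; exists W; split=> //.
      by rewrite /A -ep.
    by rewrite -est.
  + by move=> e X eE /AE /and3P[]; exact: hPA.
Qed.

Lemma rcoverP P K t PA :
  (forall e S, e \in pedg P -> S \in pfam P -> unc K S -> t \in S.1 -> covers e S -> PA e) ->
  let J := rcover (pask P) (pcl P) K t in
  [/\ uniq J, {subset J <= pedg P}, forall S, S \in pfam P -> unc K S -> t \in S.1 -> ~~ unc J S
    & ((ecost P J)%:~R <= lpval P PA)%R].
Proof.
move=> hPA; rewrite /rcover -pcl_flip.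
have [|a b c d] := @rootcoverP (flip P) (map (@fl V) K) t (fun e => PA (fl e)).
  move=> e S /=; rewrite mem_fl in_cofamily => eE SF uS tS ce.
  apply: (hPA (fl e) (cobiset S)) => //; rewrite ?covers_co ?flK //.
    by rewrite unc_co.
  by rewrite inE.
split.
- by rewrite map_inj_uniq //; exact: inv_inj (@flK V).
- by move=> e; rewrite mem_fl => /b; rewrite mem_fl flK.
- move=> S SF uS tS; rewrite -unc_co; apply: c.
  + by rewrite in_cofamily cobisetK.
  + by rewrite unc_co mapK //; exact: flK.
  + by rewrite /= inE negbK.
- move: d; rewrite ecost_flip lpval_flip /lpval; congr (_ <= _)%R.
  by apply: eq_bigl => e; rewrite flK.
Qed.

End Prob.

(** * Covering through a minimal transversal *)

Section GA.
Variables (V : finType) (R : realType) (P : prob V R).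
Notation edge := (V * V)%type.
Notation bis := (biset V).
Implicit Types (X Y S : bis) (K J : seq edge) (PA : pred edge) (T : seq V).
Local Notation F := (pfam P).
Local Notation ask := (pask P).
Local Notation E := (pedg P).
Local Notation cl := (pcl P).
Local Notation LP := (lpval P xpredT).

(** The cost as the program computes it: an edge repeated in [J] counts once, unlike in [ecost]. *)
Definition ccost J : int := costof cl J.

Lemma ccostE J : ccost J = (\sum_(e <- E | e \in J) pcst P e)%R.
Proof.
rewrite /ccost /costof /pcl.
have h s z : foldl (fun (s : int) (er : edge * int) => if er.1 \in J then iadd s er.2 else s) z
    [seq (e, pcst P e) | e <- s] = (z + \sum_(e <- s | e \in J) pcst P e)%R.
  elim: s z => [|e s IH] z /=; first by rewrite big_nil addr0.
  by rewrite IH big_cons; case: ifP => _ //; rewrite /iadd addrA.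
by rewrite h add0r.
Qed.

Lemma ccost_ecost J : uniq J -> {subset J <= E} -> ccost J = ecost P J.
Proof.
move=> uJ sJ; rewrite ccostE /ecost -big_filter; apply: perm_big; apply: uniq_perm => //.
  by rewrite filter_uniq // p_uniq.
by move=> e; rewrite mem_filter; case eJ : (e \in J) => //=; exact: sJ.
Qed.

Lemma ccost_eq J K : J =i K -> ccost J = ccost K.
Proof. by move=> h; rewrite !ccostE; apply: eq_bigl => e; rewrite h. Qed.

Lemma ccost_cat J K : (ccost (J ++ K) <= ccost J + ccost K)%R.
Proof.
rewrite !ccostE !(big_mkcond (fun e => e \in _)) -big_split big_seq [X in (_ <= X)%R]big_seq.
apply: ler_sum => e eE; rewrite mem_cat; have := p_cst0 eE.
by case: (_ \in J); case: (_ \in K) => /= h; rewrite ?addr0 ?add0r // lerDl.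
Qed.

Lemma mem_ecanon J e : (e \in ecanon cl J) = (e \in E) && (e \in J).
Proof.
apply/mapP/andP => [[[f z]]|[eE eJ]].
  by rewrite mem_filter /= => /andP[fJ /mapP[g gE [eg _]]] /= ->; split=> //; rewrite eg.
by exists (e, pcst P e) => //; rewrite mem_filter /= eJ; apply/mapP; exists e.
Qed.

Lemma ecanon_sub J : {subset ecanon cl J <= E}.
Proof. by move=> e; rewrite mem_ecanon => /andP[]. Qed.

Lemma ecanon_eq J : {subset J <= E} -> ecanon cl J =i J.
Proof. by move=> h e; rewrite mem_ecanon; case eJ : (e \in J); rewrite ?andbF // h. Qed.

Lemma ecanon_uniq J : uniq (ecanon cl J).
Proof.
rewrite /ecanon /pcl filter_map -map_comp (_ : map _ _ = [seq e <- E | e \in J]).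
  by rewrite filter_uniq // p_uniq.
by rewrite -[RHS]map_id; apply: eq_map.
Qed.

Lemma unc_eq J K X : J =i K -> unc J X = unc K X.
Proof. by move=> h; rewrite /unc; apply: eq_all_r. Qed.

Lemma istransP J T : reflect (forall S, S \in F -> unc J S -> has (fun t => t \in S.1) T)
  (istrans ask J T).
Proof.
apply: (iffP allP) => [h S SF uS|h [u v] _ /=].
  have [u uS1] := proper_in (p_proper P) SF; have [v vS] := proper_out (p_proper P) SF.
  have := h (u, v); rewrite mem_prs /= !mem_enum => /(_ isT).
  have := @p_ask _ _ P (J ++ star T) u v; case: (ask _ _ _) => // /(_ S).
  rewrite /sep SF unc_cat uS (unc_star (p_proper P)) //= uS1 vS !andbT.
  by rewrite negbK.
have := @p_ask _ _ P (J ++ star T) u v; case: (ask _ _ _) => // -[X Y] [/and4P[XF + _ _] _ _ _].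
by rewrite unc_cat (unc_star (p_proper P)) // => /andP[uX]; rewrite (h X XF uX).
Qed.

Lemma istrans_sub J T T' : {subset T <= T'} -> istrans ask J T -> istrans ask J T'.
Proof.
move=> h /istransP hT; apply/istransP => S SF uS; have /hasP[t tT tS] := hT S SF uS.
by apply/hasP; exists t => //; exact: h.
Qed.

(** One pass is enough: the transversal only shrinks, and a vertex that cannot be removed from a
    larger set cannot be removed from a smaller one. *)
Lemma mintransP J : [/\ uniq (mintrans ask J), istrans ask J (mintrans ask J) &
  forall t, t \in mintrans ask J -> ~~ istrans ask J (del (mintrans ask J) t)].
Proof.
rewrite /mintrans.
have H s : let T := foldl (mtstep ask J) (enum V) s in [/\ uniq T, istrans ask J T &
   forall t, t \in T -> t \in s -> ~~ istrans ask J (del T t)].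
  elim/last_ind: s => [|s v]; rewrite ?foldl_rcons => /=.
    split; rewrite ?enum_uniq //; apply/istransP => S SF _.
    have [u uS1] := proper_in (p_proper P) SF.
    by apply/hasP; exists u; rewrite ?mem_enum.
  set T := foldl _ _ s => -[h1 h2 h3]; rewrite /mtstep; case: ifP => hv.
    split=> //; first by rewrite filter_uniq.
    move=> t; rewrite mem_del => /andP[tv tT]; rewrite mem_rcons inE (negbTE tv) /= => ts.
    apply: contra (h3 t tT ts); apply: istrans_sub => w; rewrite !mem_del.
    by case/andP => -> /andP[_ ->].
  split=> // t tT; rewrite mem_rcons inE => /orP[/eqP ->|ts]; [by rewrite hv | exact: h3].
have [h1 h2 h3] := H (enum V); split=> // t tT; apply: h3 => //; by rewrite mem_enum.
Qed.

Lemma mintrans_private J t : t \in mintrans ask J -> exists S, [/\ S \in F, unc J S, t \in S.1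
  & forall t', t' \in mintrans ask J -> t' \in S.1 -> t' = t].
Proof.
have [_ /istransP h1 h2] := mintransP J; move=> tT; have := h2 t tT.
have [hS|hS] := pselect (exists S, [/\ S \in F, unc J S & ~~ has (fun t => t \in S.1) (del (mintrans ask J) t)]); last first.
  move/negP; case; apply/istransP => S SF uS; apply/negPn/negP => hh; apply: hS; by exists S.
case: hS => S [SF uS /hasPn hn] _; exists S.
have ht t' : t' \in mintrans ask J -> t' \in S.1 -> t' = t.
  move=> t'T t'S; apply/eqP/negPn/negP => ne; have := hn t'; rewrite mem_del ne t'T => /(_ isT).
  by rewrite t'S.
split=> //; have /hasP[t' t'T t'S] := h1 S SF uS; by rewrite -(ht t' t'T t'S).
Qed.

Definition harm n : R := (\sum_(i < n) (i.+1%:R)^-1)%R.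

Definition only J T t : pred edge := fun e =>
  [exists S : bis, [&& S \in F, unc J S, t \in S.1, ~~ has (fun t' => t' \in S.1) (del T t) & covers e S]].

(* Two members covered by the same edge cross, and their intersection is again
   a member, so it meets T. *)
Lemma only_disj J T t t' e : istrans ask J T -> only J T t e -> only J T t' e -> t = t'.
Proof.
move=> /istransP hT /existsP[X /and5P[XF uX tX /hasPn hX ce]] /existsP[Y /and5P[YF uY tY /hasPn hY ce']].
move: ce ce'; rewrite !coversE => /andP[a b] /andP[a' b'].
have [h _] := crossP (p_crossing P) XF YF a a' b b'.
have /hasP[u uT] := hT _ h (unc_cap uX uY); rewrite inE => /andP[uX1 uY1].
have ht w (Z : bis) : (forall x, x \in del T w -> x \notin Z.1) -> u \in Z.1 -> u = w.
  move=> h1 h2; apply/eqP/negPn/negP => ne; have := h1 u; rewrite mem_del ne uT h2.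
  by move/(_ isT).
by rewrite -(ht t X hX uX1) -(ht t' Y hY uY1).
Qed.

Lemma only_sum J T : uniq T -> istrans ask J T -> (\sum_(t <- T) lpval P (only J T t) <= LP)%R.
Proof.
move=> uT hT; rewrite /lpval (exchange_big_dep xpredT) //= big_seq [X in (_ <= X)%R]big_seq.
apply: ler_sum => e eE; rewrite -big_filter.
have h0 : (0 <= (pcst P e)%:~R * plp P e)%R by rewrite mulr_ge0 ?ler0z ?p_cst0 ?p_lp0.
have : size [seq t <- T | only J T t e] <= 1.
  have hu := filter_uniq (fun t => only J T t e) uT.
  have hm t : t \in [seq t <- T | only J T t e] -> only J T t e by rewrite mem_filter => /andP[].
  case: [seq _ <- _ | _] hu hm => [|t [|t' l]] // /andP[tt _] hm.
  have a := hm t (mem_head _ _).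
  have b : only J T t' e by apply: hm; rewrite inE mem_head orbT.
  by rewrite (only_disj hT a b) mem_head in tt.
case: [seq _ <- _ | _] => [|t [|t' l]] // _; first by rewrite big_nil.
by rewrite big_cons big_nil addr0.
Qed.

Lemma rcover_cost J T t : let K := rcover ask cl (J ++ star (del T t)) t in
  [/\ {subset K <= E}, ((ccost K)%:~R <= lpval P (only J T t))%R
   & forall S, S \in F -> unc J S -> t \in S.1 -> ~~ has (fun t' => t' \in S.1) (del T t) -> ~~ unc K S].
Proof.
have [|a b c d] := @rcoverP V R P (J ++ star (del T t)) t (only J T t).
  move=> e S eE SF; rewrite unc_cat (unc_star (p_proper P)) // => /andP[uS hS] tS ce.
  by apply/existsP; exists S; rewrite SF uS tS hS ce.
split=> //; first by rewrite ccost_ecost.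
by move=> S SF uS tS hS; apply: c => //; rewrite unc_cat uS (unc_star (p_proper P)).
Qed.

(** A potential: the harmonic number of [size T] times LP is the remaining budget, and one step
    spends at most LP divided by [size T]. *)
Definition gainv B (st : seq V * seq edge) :=
  [/\ uniq st.1, {subset st.2 <= E}, istrans ask st.2 st.1
    & ((ccost st.2)%:~R + harm (size st.1) * LP <= B)%R].

Lemma gastepP B st : gainv B st ->
  gainv B (gastep ask cl st) /\ size (gastep ask cl st).1 = (size st.1).-1.
Proof.
case: st => T J [/= uT sJ hT hB]; rewrite /gastep /=.
set f := fun t => (t, _).
have := argminP (fun tJ : V * seq edge => costof cl tJ.2) [seq f t | t <- T].
case: (argmin _ _) => [[t0 J0]|]; last first.
  by case: T @f uT hT hB => // t T f.
case=> /mapP[t tT [e1 e2]] hmin; subst t0.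
have [K1 K2 K3] := rcover_cost J T t; rewrite -e2 in K1 K2 K3.
have sT : size (del T t) = (size T).-1.
  rewrite /del -rem_filter // size_rem //.
split=> //; split => /=.
- by rewrite filter_uniq.
- exact: ecanon_sub.
- apply/istransP => S SF; rewrite (@unc_eq _ (J ++ J0)); last first.
    by apply: ecanon_eq => e; rewrite mem_cat => /orP[/sJ|/K1].
  rewrite unc_cat => /andP[uJ uJ0]; apply/negPn/negP => hn.
  have /hasP[t1 t1T t1S] := (elimT (istransP _ _) hT) S SF uJ.
  have et : t1 = t.
    apply/eqP/negPn/negP => ne; move/hasPn: hn => /(_ t1); rewrite mem_del ne t1T t1S.
    by move=> /(_ isT).
  by move: (K3 S SF uJ); rewrite -{1}et t1S => /(_ isT hn); rewrite uJ0.
- apply: le_trans hB; rewrite sT.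
  have T0 : 0 < size T by case: (T) tT.
  rewrite (@ccost_eq _ (J ++ J0)); last first.
    by apply: ecanon_eq => e; rewrite mem_cat => /orP[/sJ|/K1].
  have hc : ((ccost (J ++ J0))%:~R <= (ccost J)%:~R + (ccost J0)%:~R :> R)%R.
    by rewrite -intrD ler_int ccost_cat.
  have hh : harm (size T) = (harm (size T).-1 + (size T)%:R^-1)%R.
    by rewrite /harm; case: (size T) T0 => // m _; rewrite big_ord_recr.
  (* The cheapest of the [size T] covers costs at most their average, and by [only_sum] together
     they cost at most LP. *)
  have hm : ((ccost J0)%:~R <= (size T)%:R^-1 * LP)%R.
    rewrite mulrC ler_pdivlMr ?ltr0n //.
    apply: le_trans (only_sum uT hT); rewrite mulr_natr (_ : _ *+ _ = \sum_(t <- T) (ccost J0)%:~R)%R; last first.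
      by rewrite big_const_seq count_predT iter_addr_0.
    rewrite big_seq [X in (_ <= X)%R]big_seq; apply: ler_sum => t' t'T.
    have [K1' K2' K3'] := rcover_cost J T t'.
    apply: le_trans K2'; rewrite ler_int.
    by apply: (hmin (f t')); apply: map_f.
  by rewrite hh mulrDl; lra.
Qed.

Lemma gacoverP J0 : {subset J0 <= E} ->
  [/\ {subset gacover ask cl J0 <= E}, uniq (gacover ask cl J0), forall S, S \in F -> ~~ unc (gacover ask cl J0) S
   & ((ccost (gacover ask cl J0))%:~R <= (ccost J0)%:~R + harm (size (mintrans ask J0)) * LP)%R].
Proof.
move=> sJ0; have [m1 m2 m3] := mintransP J0.
set B := ((ccost J0)%:~R + _)%R.
have i0 : gainv B (mintrans ask J0, ecanon cl J0).
  split=> //=; first exact: ecanon_sub.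
    apply/istransP => S SF; rewrite (unc_eq _ (ecanon_eq sJ0)); exact: (elimT (istransP _ _) m2).
  by rewrite (ccost_eq (ecanon_eq sJ0)).
rewrite /gacover.
have H (s : seq V) : let st := foldl (fun st _ => gastep ask cl st) (mintrans ask J0, ecanon cl J0) s in
   [/\ gainv B st, size st.1 = size (mintrans ask J0) - size s & uniq st.2].
  elim/last_ind: s => [|s v]; rewrite ?foldl_rcons => /=.
    by rewrite subn0; split=> //; exact: ecanon_uniq.
  set st := foldl _ _ s => -[h1 h2 h3]; have [h4 h5] := gastepP h1; split=> //.
    by rewrite h5 h2 size_rcons subnS.
  rewrite /gastep; case: argmin => //= tJ; exact: ecanon_uniq.
have [[h1 h2 h3 h4] h5 h6] := H (enum V).
set st := foldl _ _ _ in h1 h2 h3 h4 h5 h6 *.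
(* Each step removes a vertex from the transversal, which has at most [#|V|] of them. *)
have e0 : st.1 = [::].
  apply/nilP; rewrite /nilp h5 subn_eq0; apply: uniq_leq_size => // x _.
  by rewrite mem_enum.
split=> //.
- by move=> S SF; apply/negP => /(elimT (istransP _ _) h3 S SF); rewrite e0.
- by move: h4; rewrite e0 /harm big_ord0 mul0r addr0.
Qed.

(** A core inside the private member of [t] is met by the transversal, and only in [t], so [t] can
    be recovered from the core. *)
Lemma mintrans_nu : size (mintrans ask [::]) <= nu F.
Proof.
have [uT /istransP hT _] := mintransP [::].
set T := mintrans _ _ in uT hT *.
have H t : exists C : bis, t \in T -> [/\ C \in cores F, t \in C.1 & forall t', t' \in T -> t' \in C.1 -> t' = t].
  case tT : (t \in T); last by exists (finset.set0, finset.set0).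
  have [S [SF uS tS hS]] := mintrans_private tT; have [C hC CS] := core_exists SF.
  exists C => _; have sub : C.1 \subset S.1.
    by case/orP: CS => [/proper_sub //|/andP[/eqP -> _]].
  have hC' t' : t' \in T -> t' \in C.1 -> t' = t by move=> t'T /(subsetP sub); exact: hS.
  split=> //; have CF : C \in F by move: hC; rewrite inE => /andP[].
  have /hasP[t' t'T t'C] := hT C CF isT; by rewrite -(hC' t' t'T t'C).
have [f hf] := choice H.
have ui : uniq (map f T).
  rewrite map_inj_in_uniq // => t t' tT t'T e.
  have [_ a b] := hf t tT; have [_ a' b'] := hf t' t'T.
  by apply: b' => //; rewrite -e.
rewrite -(size_map f) /nu cardE; apply: uniq_leq_size => // C /mapP[t tT ->].
by rewrite mem_enum; case: (hf t tT).
Qed.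

(** A core is the least member separating any [u] in its inner part from any [v] outside its outer
    part, so cores are no more numerous than pairs. *)
Lemma nu_le : nu F <= #|V| ^ 2.
Proof.
rewrite /nu -mulnn -card_prod [X in X <= _]cardE.
have -> : #|{: V * V}| = size [seq (if ask [::] uv.1 uv.2 is Some XY then XY.1 else (finset.set0, finset.set0)) | uv <- enum {: V * V}].
  by rewrite size_map -cardE.
apply: uniq_leq_size; first exact: enum_uniq.
move=> C; rewrite mem_enum inE => /andP[CF /forallP hC].
have [u uC] := proper_in (p_proper P) CF; have [v vC] := proper_out (p_proper P) CF.
apply/mapP; exists (u, v); first by rewrite mem_enum.
have := @p_ask _ _ P [::] u v => /=; case: (ask _ _ _) => [[X Y]|] /=; last first.
  by move/(_ C); rewrite /sep CF uC vC.
case=> /and4P[XF _ _ _] /(_ C); rewrite /sep CF uC vC => /(_ isT) /andP[s1 s2] _ _.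
apply/eqP; rewrite eq_sym; apply/negPn/negP => ne.
have := hC X; rewrite !inE ne XF /= /bisub.
by case: (eqVneq X.1 C.1) => [_|h]; rewrite ?s2 ?orbT // properEneq h s1.
Qed.

End GA.

(** * Partial covers of k-regular families *)

Lemma count_enum (V : finType) (p : pred V) : count p (enum V) = #|[set x | p x]|.
Proof. by rewrite -sum1_count big_enum_cond sum1dep_card. Qed.

Lemma count_all_enum (V : finType) (p : pred V) (s : seq V) :
  uniq s -> {in s, forall x, p x} -> size s <= count p (enum V).
Proof.
move=> us hs; rewrite -size_filter; apply: uniq_leq_size => // x xs.
by rewrite mem_filter hs ?mem_enum.
Qed.

Lemma disjoint_count (I : eqType) (V : finType) (T : seq I) (f : I -> {set V}) m : uniq T ->
  (forall t, t \in T -> m <= #|f t|) ->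
  (forall t t' u, t \in T -> t' \in T -> u \in f t -> u \in f t' -> t = t') ->
  size T * m <= #|V|.
Proof.
move=> uT hm hd.
have -> : #|V| = \sum_(u : V) 1 by rewrite sum1_card.
apply: (@leq_trans (\sum_(t <- T) #|f t|)).
  have -> : size T * m = \sum_(t <- T) m by rewrite big_const_seq count_predT iter_addn_0 mulnC.
  rewrite big_seq [X in _ <= X]big_seq; exact: leq_sum.
under eq_bigr do rewrite -sum1_card.
rewrite (exchange_big_dep xpredT) //=; apply: leq_sum => u _.
rewrite -big_filter sum1_size.
have hu := filter_uniq (fun t => u \in f t) uT.
have hh t : t \in [seq t <- T | u \in f t] -> t \in T /\ u \in f t by rewrite mem_filter => /andP[].
case: [seq _ <- _ | _] hu hh => [|t [|t' l]] // /andP[tt _] hh.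
have [a b] := hh t (mem_head _ _).
have [a' b'] : t' \in T /\ u \in f t' by apply: hh; rewrite inE mem_head orbT.
by rewrite (hd t t' u a a' b b') mem_head in tt.
Qed.

Section PC.
Variables (V : finType) (R : realType) (P : prob V R).
Notation edge := (V * V)%type.
Notation bis := (biset V).
Implicit Types (X Y S W D : bis) (K J : seq edge) (T Rs : seq V) (tr : seq (item V)).
Local Notation F := (pfam P).
Local Notation ask := (pask P).
Local Notation E := (pedg P).
Local Notation cl := (pcl P).
Local Notation LP := (lpval P xpredT).
Variable q : nat.
Hypothesis qV : q + q < #|V|.
Hypothesis Hreg : forall X Y u, X \in F -> Y \in F -> #|X.1| <= q + q -> #|Y.1| <= q + q ->
  u \in X.1 -> u \in Y.1 -> bicap X Y \in F /\ bicup X Y \in F.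

Definition hit T X := has (fun t => t \in X.1) T.

Lemma hitPn T X : reflect (forall t, t \in T -> t \notin X.1) (~~ hit T X).
Proof. exact: hasPn. Qed.

Lemma hit_sub T T' X Y : {subset T <= T'} -> {subset X.1 <= Y.1} -> ~~ hit T' Y -> ~~ hit T X.
Proof. by move=> h1 h2 /hitPn h; apply/hitPn => t /h1/h; apply: contra; exact: h2. Qed.

Lemma inpc_cpiece J Rs c X : inpc F (cpiece J Rs c q) X =
  [&& X \in F, unc J X, ~~ hit (del Rs c) X, c \in X.1 & #|X.1| <= q].
Proof.
rewrite /inpc /= orbF; case XF : (X \in F) => //=.
rewrite unc_cat (unc_star (p_proper P)) // -andbA.
have [v vX] := proper_out (p_proper P) XF.
by rewrite (_ : has (fun b => b \notin X.2) _ = true) //; apply/hasP; exists v; rewrite ?mem_enum.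
Qed.

(** For [w] in [S.1] every counted [x] lies in [S.1], since otherwise [S] itself contains [w] and
    avoids [x]. So each [w] of [S.1] passes the inner test, and the outer count bounds the size of
    [S.1]. *)
Lemma thinP J Rs c S : thin ask J Rs q c -> S \in F -> unc J S -> ~~ hit (del Rs c) S ->
  c \in S.1 -> #|S.1| <= q + q -> #|S.1| <= q.
Proof.
move=> /allP h SF uS hS cS S2; have [v vS] := proper_out (p_proper P) SF.
apply: leq_trans (h v _); last by rewrite mem_enum.
rewrite cardE; apply: count_all_enum; first exact: enum_uniq.
move=> w; rewrite mem_enum => wS; apply: leq_trans S2; rewrite count_enum.
apply: subset_leq_card; apply/subsetP => x; rewrite inE; apply: contraR => xS.
rewrite /inmax; set K := _ ++ _.
have sS : sep F K c v S.
  rewrite /sep SF /K !unc_cat uS (unc_star (p_proper P)) // -/(hit _ _) hS /=.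
  by rewrite coversE /= (negbTE xS) cS vS.
have := @p_ask _ _ P K c v; case: (ask _ _ _) => [[X Y]|]; last by move/(_ S); rewrite sS.
case=> _ _ _ /(_ S sS) /andP[/subsetP /(_ w wS)]; by rewrite inE.
Qed.

(** More than [q] vertices [w] pass the inner test for some [v]. For each of them, intersecting
    members that avoid the uncounted vertices gives a member through [w] with at most [2q] inner
    vertices. Unless one of these is already large, they are united one at a time; a union of two
    sets of size at most [q] cannot jump past [2q]. *)
Lemma thinN J Rs c : ~~ thin ask J Rs q c -> exists S, [/\ S \in F, unc J S, ~~ hit (del Rs c) S,
  c \in S.1 & q < #|S.1| <= q + q].
Proof.
case/allPn => v _; rewrite -ltnNge => hq.
set Kx := fun x => J ++ star (del Rs c) ++ [:: (x, v)] in hq.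
pose K := J ++ star (del Rs c).
suff [S sS hS] : exists2 S, sep F K c v S & q < #|S.1| <= q + q.
  case/and4P: sS => SF; rewrite unc_cat (unc_star (p_proper P)) // => /andP[uS hS'] cS _.
  by exists S.
have hw w : count (fun x => ~~ inmax ask (Kx x) c v w) (enum V) <= q + q ->
    exists S, [/\ sep F K c v S, w \in S.1 & #|S.1| <= q + q].
  move=> hc.
  have hx x : inmax ask (Kx x) c v w -> exists S, [/\ sep F K c v S, w \in S.1 & x \notin S.1].
    rewrite /inmax; have := @p_ask _ _ P (Kx x) c v; case: (ask _ _ _) => [[X Y]|] // [_ _ + _] wY.
    move=> /and4P[a b c' d]; exists (cobiset Y); move: b; rewrite /Kx catA unc_cat => /andP[b1 b2].
    split; first by apply/and4P.
      by rewrite /= inE.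
    apply/negP => xS; move: b2; rewrite /unc /= andbT coversE /= xS.
    by move: d; rewrite /= => ->.
  have hxs (xs : seq V) : xs != [::] -> (forall x, x \in xs -> inmax ask (Kx x) c v w) ->
     exists S, [/\ sep F K c v S, w \in S.1 & forall x, x \in xs -> x \notin S.1].
    elim: xs => // x xs IH _ hall.
    have [Sx [a b c']] := hx x (hall x (mem_head _ _)).
    case: (eqVneq xs [::]) => [->|ne].
      by exists Sx; split=> // y; rewrite inE => /eqP ->.
    have [|S [a' b' c'']] := IH ne.
      by move=> y yx; apply: hall; rewrite inE yx orbT.
    exists (bicap Sx S); split; first exact: (sep_cap (p_crossing P)).
      by rewrite inE b.
    move=> y; rewrite !inE negb_and => /orP[/eqP ->|/c'' ->]; first by rewrite c'.
    by rewrite orbT.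
  have [||S [a b c']] := hxs [seq x <- enum V | inmax ask (Kx x) c v w].
  (* Some vertex is uncounted because at most [2q < #|V|] are counted. *)
  - apply/eqP => e; have := count_predC (fun x => inmax ask (Kx x) c v w) (enum V).
    rewrite -size_filter e /= add0n -cardE => e1; move: hc; rewrite leqNgt => /negP; apply.
    by apply: leq_trans qV _; rewrite -e1 leq_eqVlt; apply/orP; left; apply/eqP; apply: eq_count.
  - by move=> x; rewrite mem_filter => /andP[].
  exists S; split=> //; apply: leq_trans hc; rewrite count_enum.
  apply: subset_leq_card; apply/subsetP => x xS; rewrite inE; apply: contraL xS => hx'.
  by apply: c'; rewrite mem_filter hx' mem_enum.
set ws := [seq w <- enum V | count (fun x => ~~ inmax ask (Kx x) c v w) (enum V) <= q + q].
have qws : q < size ws by rewrite size_filter.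
have uws : uniq ws by rewrite filter_uniq // enum_uniq.
have hws w : w \in ws -> exists S, [/\ sep F K c v S, w \in S.1 & #|S.1| <= q + q].
  by rewrite mem_filter => /andP[/hw].
have H (s : seq V) : s != [::] -> {subset s <= ws} -> (exists2 S, sep F K c v S & q < #|S.1| <= q + q) \/
   exists S, [/\ sep F K c v S, {subset s <= S.1} & #|S.1| <= q].
  elim: s => // w s IH _ hs.
  have [Sw [a b c']] := hws w (hs w (mem_head _ _)).
  case: (leqP #|Sw.1| q) => hSw; last by left; exists Sw; rewrite ?hSw.
  case: (eqVneq s [::]) => [->|ne].
    by right; exists Sw; split=> // x; rewrite inE => /eqP ->.
  case: (IH ne); first by move=> x xs; apply: hs; rewrite inE xs orbT.
    by left.
  move=> [S [a1 b1 c1]]; have hU := sep_cup (p_crossing P) a a1.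
  have sU : #|(bicup Sw S).1| <= q + q.
    by apply: leq_trans (leq_card_setU _ _) _; apply: leq_add.
  case: (leqP #|(bicup Sw S).1| q) => hq'; last by left; exists (bicup Sw S); rewrite ?hq'.
  right; exists (bicup Sw S); split=> // x; rewrite !inE => /orP[/eqP ->|/b1 ->]; by rewrite ?b ?orbT.
case: (H ws); [by case: (ws) qws | by [] | by [] | move=> [S [_ b c']]].
have : size ws <= #|S.1| by rewrite cardE; apply: uniq_leq_size => // x /b; rewrite mem_enum.
by lia.
Qed.

(** The history at the start of the phase, the set [R] at that time, and the vertex that the phase
    removes from it, called its centre below. *)
Definition phase := (seq (item V) * (seq V * V))%type.
Definition pieceof (ph : phase) := cpiece (bought ph.1) ph.2.1 ph.2.2 q.
Implicit Types (ph : phase) (phs : seq phase).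

(** The bound is [2q], not [q], so that it applies to the union of two members with at most [q]
    inner vertices. *)
Definition transv J Rs := forall S, S \in F -> unc J S -> #|S.1| <= q + q -> hit Rs S.
Definition bef ph ph' := {subset ph'.2.1 <= del ph.2.1 ph.2.2} /\ {subset bought ph.1 <= bought ph'.1}.

(** [pc_tr] persists by thinness: an uncovered member with at most [2q] inner vertices that meets
    [R] in the removed vertex alone has at most [q] of them, so it belongs to the piece and gets
    covered. [pc_item] assigns each charge to its phase; every phase either started after the charge
    or had a set [R] containing that of the charging phase. *)
Record pcinv tr phs (st : pc_state V) : Prop := PcInv {
  pc_pd : pdinv E (pcst P) tr st.2.2;
  pc_pcs : st.2.1 = map pieceof phs;
  pc_tr : transv (bought tr) st.1;
  pc_uR : uniq st.1;
  pc_pre : forall ph, ph \in phs -> exists t', tr = ph.1 ++ t';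
  pc_c : forall ph, ph \in phs -> ph.2.2 \in ph.2.1;
  pc_ptr : forall ph, ph \in phs -> transv (bought ph.1) ph.2.1;
  pc_thin : forall ph, ph \in phs -> thin ask (bought ph.1) ph.2.1 q ph.2.2;
  pc_cov : forall ph X, ph \in phs -> inpc F (pieceof ph) X -> ~~ unc (bought tr) X;
  pc_R : forall ph, ph \in phs -> {subset st.1 <= del ph.2.1 ph.2.2};
  pc_ord : forall ph ph', ph \in phs -> ph' \in phs -> [\/ ph = ph', bef ph ph' | bef ph' ph];
  pc_item : forall t1 g t2, tr = t1 ++ g :: t2 -> exists ph, [/\ ph \in phs,
     findmin ask (bought t1) (pieceof ph) = Some g.1.1, {subset bought ph.1 <= bought t1}
     & forall ph', ph' \in phs -> (exists t3, ph'.1 = t1 ++ g :: t3) \/ {subset ph.2.1 <= ph'.2.1}] }.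

Lemma cat_mid (T : eqType) (s1 s2 s3 s4 : seq T) x : s1 ++ s2 = s3 ++ x :: s4 ->
  (exists s, s1 = s3 ++ x :: s) \/ (exists s, s3 = s1 ++ s /\ s2 = s ++ x :: s4).
Proof.
elim: s1 s3 => [|y s1 IH] [|z s3] /=.
- by move=> ->; right; exists [::].
- by move=> ->; right; exists (z :: s3).
- by case=> <- _; left; exists s1.
- by case=> <- /IH [[s ->]|[s [-> ->]]]; [left; exists s | right; exists s].
Qed.

Lemma pcinv0 : pcinv [::] [::] (enum V, ([::], (cl, [::]))).
Proof.
split=> //=.
- exact: (pdinv0 (@p_cst0 _ _ P)).
- move=> S SF _ _; have [u uS] := proper_in (p_proper P) SF.
  by apply/hasP; exists u; rewrite ?mem_enum.
- exact: enum_uniq.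
- by case.
Qed.

Lemma pcstep_inv tr phs st c : pcinv tr phs st -> ohd [seq c <- st.1 | thin ask st.2.2.2 st.1 q c] = Some c ->
  exists tr' phs', pcinv tr' phs' (pcstep ask cl q st).
Proof.
move=> inv hc; rewrite /pcstep hc.
have := ohdP [seq c <- st.1 | thin ask st.2.2.2 st.1 q c]; rewrite hc mem_filter => /andP[thc cR].
have hE := @p_cov _ _ P.
set p := cpiece _ _ _ _; pose ph0 : phase := (tr, (st.1, c)).
have eJ : st.2.2.2 = bought tr by case: (pc_pd inv).
have ep : p = pieceof ph0 by rewrite /p eJ.
have [tr' [i1 i2 i3]] := pdrun_inv (p_ask P) (p_uniq P) hE p (pc_pd inv).
rewrite -/cl in i1 i2.
set st' := pdrun _ _ _ _ in i1 i2 *.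
have eJ' : st'.2 = bought (tr ++ tr') by case: i1.
have mono X : unc (bought (tr ++ tr')) X -> unc (bought tr) X.
  by apply: unc_sub => e; rewrite /bought map_cat mem_cat => ->.
have cov0 X : inpc F p X -> ~~ unc (bought (tr ++ tr')) X.
  by rewrite -eJ'; exact: (findmin_none (p_ask P)).
exists (tr ++ tr'), (ph0 :: phs); split=> //=.
- by rewrite (pc_pcs inv) ep.
- move=> S SF uS S2; have := pc_tr inv SF (mono _ uS) S2; apply: contraLR => hn.
  apply/negP => /hasP[c' c'R c'S].
  have e : c' = c.
    by apply/eqP/negPn/negP => ne; move/hitPn: hn => /(_ c'); rewrite mem_del ne c'R c'S => /(_ isT).
  subst c'; have := cov0 S; rewrite ep inpc_cpiece SF (mono _ uS) hn c'S uS /= (thinP thc) ?eJ //.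
    by move=> /(_ isT).
  exact: mono.
- by rewrite filter_uniq // (pc_uR inv).
- move=> ph; rewrite inE => /orP[/eqP -> /=|/(pc_pre inv)[t' ->]]; first by exists tr'.
  by exists (t' ++ tr'); rewrite catA.
- by move=> ph; rewrite inE => /orP[/eqP ->|/(pc_c inv)].
- by move=> ph; rewrite inE => /orP[/eqP ->|/(pc_ptr inv)//]; exact: (pc_tr inv).
- by move=> ph; rewrite inE => /orP[/eqP ->|/(pc_thin inv)//]; rewrite /= -eJ.
- move=> ph X; rewrite inE => /orP[/eqP -> |ph1 h]; first by rewrite -ep; exact: cov0.
  by apply: contra (pc_cov inv ph1 h); exact: mono.
- move=> ph; rewrite inE => /orP[/eqP ->//|/(pc_R inv) h] x; rewrite mem_del => /andP[_]; exact: h.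
- have hb ph : ph \in phs -> bef ph ph0.
    move=> h; split; first exact: (pc_R inv).
    by have [t' /= ->] := pc_pre inv h; move=> e; rewrite /bought map_cat mem_cat => ->.
  move=> ph ph'; rewrite !inE => /orP[/eqP ->|h] /orP[/eqP ->|h'].
  + by constructor 1.
  + by constructor 3; apply: hb.
  + by constructor 2; apply: hb.
  + exact: (pc_ord inv).
- move=> t1 g t2 /cat_mid[[s es]|[s [es es']]].
    have [ph [a b c' d]] := pc_item inv es.
    exists ph; split=> //; first by rewrite inE a orbT.
    move=> ph'; rewrite inE => /orP[/eqP ->|/d //]; left; by exists s.
  exists ph0; split.
  + exact: mem_head.
  + by rewrite -ep es; exact: i3 es'.
  + by move=> e; rewrite es /bought map_cat mem_cat => ->.
  + move=> ph'; rewrite inE => /orP[/eqP ->|h]; right=> //= x /(pc_R inv h).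
    by rewrite mem_del => /andP[].
Qed.

Lemma pcrunP : exists tr phs, pcinv tr phs (pcrun ask cl q) /\
  forall c, c \in (pcrun ask cl q).1 -> ~~ thin ask (pcrun ask cl q).2.2.2 (pcrun ask cl q).1 q c.
Proof.
rewrite /pcrun.
have H (s : seq V) : let st := foldl (fun st _ => pcstep ask cl q st) (enum V, ([::], (cl, [::]))) s in
  (exists tr phs, pcinv tr phs st) /\
  (size st.1 + size s <= #|V| \/ ohd [seq c <- st.1 | thin ask st.2.2.2 st.1 q c] = None).
  elim/last_ind: s => [|s v]; rewrite ?foldl_rcons => /=.
    split; first by exists [::], [::]; exact: pcinv0.
    by left; rewrite addn0 -cardE.
  set st := foldl _ _ s => -[[tr [phs inv]] h].
  case ec : (ohd [seq c <- st.1 | thin ask st.2.2.2 st.1 q c]) => [c|]; last first.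
    by rewrite /pcstep ec; split; [exists tr, phs | right].
  split; first exact: (pcstep_inv inv ec).
  left; case: h => [h|]; last by rewrite ec.
  have := ohdP [seq c <- st.1 | thin ask st.2.2.2 st.1 q c]; rewrite ec mem_filter => /andP[_ cR].
  rewrite /pcstep ec /= size_rcons addnS; apply: leq_trans h; rewrite ltn_add2r.
  by rewrite /del -rem_filter ?(pc_uR inv) // size_rem //; case: (st.1) cR.
have [[tr [phs inv]] h] := H (enum V); set st := foldl _ _ _ in inv h *.
exists tr, phs; split=> // c cR; apply/negP => th.
case: h => [h|h].
  by have : st.1 = [::]; [apply/nilP; move: h; rewrite cardE -[X in _ <= X]add0n leq_add2r leqn0 | move=> e; rewrite e in cR].
by have := ohdP [seq c <- st.1 | thin ask st.2.2.2 st.1 q c]; rewrite h => e; have : c \in [::] by rewrite -e mem_filter th.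
Qed.

End PC.

Lemma measure_step a b m n : m - a < n.+1 -> a < b -> b <= m -> m - b < n.
Proof. lia. Qed.

Section Measure.
Variable V : finType.
Implicit Types (X Y : biset V).

Definition msz X := #|X.1| + #|X.2|.
Lemma msz_lt X Y : bile X Y -> ~~ bile Y X -> msz X < msz Y.
Proof.
move=> /andP[a b]; rewrite /bile negb_and /msz => /orP[h|h].
  have : X.1 \proper Y.1 by rewrite properE a h.
  by move/proper_card; have := subset_leq_card b; lia.
have : X.2 \proper Y.2 by rewrite properE b h.
by move/proper_card; have := subset_leq_card a; lia.
Qed.
Lemma msz_max X : msz X <= #|V| + #|V|.
Proof. by rewrite leq_add // max_card. Qed.

End Measure.

(** * Cost and quality of the partial cover *)

Section PC2.
Variables (V : finType) (R : realType) (P : prob V R).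
Notation edge := (V * V)%type.
Notation bis := (biset V).
Implicit Types (X Y S W D C G : bis) (K J : seq edge) (T Rs : seq V).
Local Notation F := (pfam P).
Local Notation ask := (pask P).
Local Notation E := (pedg P).
Local Notation cl := (pcl P).
Local Notation LP := (lpval P xpredT).
Variable q : nat.
Hypothesis qV : q + q < #|V|.
Hypothesis Hreg : forall X Y u, X \in F -> Y \in F -> #|X.1| <= q + q -> #|Y.1| <= q + q ->
  u \in X.1 -> u \in Y.1 -> bicap X Y \in F /\ bicup X Y \in F.

Variables (tr : seq (item V)) (phs : seq (phase V)) (st : pc_state V).
Hypothesis inv : pcinv P q tr phs st.
Hypothesis fat : forall c, c \in st.1 -> ~~ thin ask st.2.2.2 st.1 q c.

Let small2 n : n <= q -> n <= q + q. Proof. by move=> h; apply: leq_trans h (leq_addr _ _). Qed.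

Definition inA X := exists2 ph, ph \in phs & inpc F (pieceof q ph) X.

Lemma inA_F X : inA X -> X \in F. Proof. by case=> ph _ /and5P[]. Qed.
Lemma inA_q X : inA X -> #|X.1| <= q.
Proof. by case=> ph _; rewrite inpc_cpiece => /and5P[]. Qed.

Lemma bought_mid (t1 t2 : seq (item V)) g : bought (t1 ++ g :: t2) = bought t1 ++ g.2 :: bought t2.
Proof. by rewrite /bought map_cat. Qed.

(* The bisets charged by the primal-dual procedure act as cores of the current residual family. *)
Lemma least t1 g t2 X u : tr = t1 ++ g :: t2 -> X \in F -> #|X.1| <= q + q -> unc (bought t1) X ->
  u \in g.1.1.1 -> u \in X.1 -> bile g.1.1 X.
Proof.
move=> etr XF X2 uX ug uX1; have [ph [h1 h2 h3 h4]] := pc_item inv etr.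
have [pg ug'] := findmin_some (p_ask P) h2.
move: (pg); rewrite inpc_cpiece => /and5P[gF gu gh gc gq].
have [IF _] := Hreg gF XF (small2 gq) X2 ug uX1.
apply: bile_trans (bile_capr g.1.1 X).
apply: (findmin_min (p_ask P) h2 _ _ (bile_capl _ _)); last exact: unc_cap.
have Iq : #|(bicap g.1.1 X).1| <= q.
  by apply: leq_trans gq; apply: subset_leq_card; exact: subsetIl.
have uI : unc (bought ph.1) (bicap g.1.1 X) by apply: unc_cap gu _; exact: unc_sub h3 uX.
rewrite inpc_cpiece IF uI Iq andbT /=.
have hI : ~~ hit (del ph.2.1 ph.2.2) (bicap g.1.1 X).
  by apply: hit_sub gh => // x; rewrite inE => /andP[].
rewrite hI /=; have /hasP[c' c'R c'I] := pc_ptr inv h1 IF uI (small2 Iq).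
case: (eqVneq c' ph.2.2) => [<- //|ne]; move/hitPn: hI => /(_ c').
by rewrite mem_del ne c'R c'I => /(_ isT).
Qed.

Lemma first_cover (s : seq (item V)) X : ~~ unc (bought s) X ->
  exists t1 g t2, [/\ s = t1 ++ g :: t2, unc (bought t1) X & covers g.2 X].
Proof.
elim/last_ind: s => // s g IH.
case uX : (unc (bought s) X).
  move=> h; exists s, g, [::]; rewrite cats1; split=> //.
  move: h; rewrite -cats1 bought_mid -cat_rcons cats0 /unc all_rcons.
  by rewrite [all _ _]uX andbT negbK.
move=> _; have [|t1 [g' [t2 [-> h1 h2]]]] := IH; first by rewrite uX.
by exists t1, g', (rcons t2 g); rewrite rcons_cat.
Qed.

(** The intersection still meets the earlier [R], and only in its centre. For the union the issue is
    an edge [g] bought before the later phase that covers it. The biset charged for [g] lies below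
    the union and is disjoint from [Y], hence inside [X]. Its centre is then forced to be that of
    the earlier phase, which lies in [Y] too, a contradiction. *)
Lemma piece_cap ph ph' X Y u : ph \in phs -> ph' \in phs -> ph = ph' \/ bef ph ph' ->
  inpc F (pieceof q ph) X -> inpc F (pieceof q ph') Y -> u \in X.1 -> u \in Y.1 ->
  inpc F (pieceof q ph) (bicap X Y) /\ inpc F (pieceof q ph') (bicup X Y).
Proof.
move=> hp hp' ord pX pY uX1 uY1.
move: (pX) (pY); rewrite !inpc_cpiece => /and5P[XF Xu Xh Xc Xq] /and5P[YF Yu Yh Yc Yq].
have [IF UF] := Hreg XF YF (small2 Xq) (small2 Yq) uX1 uY1.
have Yu' : unc (bought ph.1) Y.
  by case: ord => [-> //|[_ h]]; exact: unc_sub h Yu.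
have Iq : #|(bicap X Y).1| <= q by apply: leq_trans Xq; apply: subset_leq_card; exact: subsetIl.
have hI : ~~ hit (del ph.2.1 ph.2.2) (bicap X Y) by apply: hit_sub Xh => // x; rewrite inE => /andP[].
have cI : ph.2.2 \in (bicap X Y).1.
  have /hasP[c' c'R c'I] := pc_ptr inv hp IF (unc_cap Xu Yu') (small2 Iq).
  case: (eqVneq c' ph.2.2) => [<- //|ne]; move/hitPn: hI => /(_ c').
  by rewrite mem_del ne c'R c'I => /(_ isT).
split; first by rewrite IF hI cI Iq unc_cap.
have U2 : #|(bicup X Y).1| <= q + q.
  by apply: leq_trans (leq_card_setU _ _) _; apply: leq_add.
have hU : ~~ hit (del ph'.2.1 ph'.2.2) (bicup X Y).
  apply/hitPn => t tR; rewrite inE negb_or.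
  move/hitPn: Yh => /(_ t tR) ->; rewrite andbT; move/hitPn: Xh; apply.
  case: ord => [-> //|[h _]]; apply: h; by move: tR; rewrite mem_del => /andP[].
have cU : ph'.2.2 \in (bicup X Y).1 by rewrite inE Yc orbT.
have uU : unc (bought ph'.1) (bicup X Y).
  apply/negPn/negP => /first_cover[t1 [g [t2 [e1 u1 cg]]]].
  have [t' etr] := pc_pre inv hp'; rewrite e1 -catA /= in etr.
  have YuE : unc (bought t1) Y.
    by apply: unc_sub Yu => e; rewrite e1 bought_mid mem_cat => ->.
  have [m [m1 m2 m3 m4]] := pc_item inv etr.
  have [pg _] := findmin_some (p_ask P) m2.
  move: pg; rewrite inpc_cpiece => /and5P[gF gu gh gc gq].
  have ggS : covers g.2 g.1.1.
    by case: (pc_pd inv) => _ _ _ /(_ _ _ _ etr)[].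
  move: (cg) (ggS); rewrite !coversE => /andP[a b] /andP[a' b'].
  move: b; rewrite !inE negb_or => /andP[bX bY].
  (* [Y] is not covered by [g], whose head avoids [Y.2]; so the tail of [g] comes from [X]. *)
  have aY : g.2.1 \notin Y.1.
    apply: contraTN Yu => aY; rewrite e1 bought_mid unc_cat /= negb_and coversE aY bY.
    by rewrite orbT.
  have aX : g.2.1 \in X.1 by move: a; rewrite inE (negbTE aY) orbF.
  have gU := least etr UF U2 u1 a' a.
  (* If the charged biset met [Y], it would lie below [Y], and the tail of [g] with it. *)
  have gY x : x \in g.1.1.1 -> x \notin Y.1.
    move=> xg; apply: contra aY => xY; have := least etr YF (small2 Yq) YuE xg xY.
    by case/andP => /subsetP h _; exact: h.
  have gX x : x \in g.1.1.1 -> x \in X.1.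
    move=> xg; case/andP: gU => /subsetP /(_ x xg) + _.
    by rewrite inE (negbTE (gY x xg)) orbF.
  (* Either [g] was bought before the earlier phase, and then [X] would be covered at its start, or
     the centre of the charging phase belongs to the [R] of the earlier phase. *)
  case: (m4 ph hp) => [[t3 e3]|h].
    move: Xu; rewrite e3 bought_mid unc_cat /= coversE aX bX.
    by rewrite andbF.
  have cm := gX _ gc; have := gY _ gc; apply/negP; rewrite negbK.
  suff -> : m.2.2 = ph.2.2 by move: cI; rewrite inE => /andP[].
  apply/eqP/negPn/negP => ne; move/hitPn: Xh => /(_ m.2.2); rewrite mem_del ne h ?(pc_c inv) //.
  by rewrite cm => /(_ isT).
(* The union has at most [2q] inner vertices; thinness of the later centre lowers this to [q]. *)
rewrite UF uU hU cU /=; exact: (thinP (pc_thin inv hp') UF uU hU cU U2).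
Qed.

Lemma bicapC X Y : bicap X Y = bicap Y X.
Proof. by rewrite /bicap finset.setIC (finset.setIC X.2). Qed.
Lemma bicupC X Y : bicup X Y = bicup Y X.
Proof. by rewrite /bicup finset.setUC (finset.setUC X.2). Qed.

Lemma Acap X Y u : inA X -> inA Y -> u \in X.1 -> u \in Y.1 -> inA (bicap X Y) /\ inA (bicup X Y).
Proof.
move=> [ph hp pX] [ph' hp' pY] uX uY.
have [h|h|h] := pc_ord inv hp hp'.
- have [a b] := piece_cap hp hp' (or_introl h) pX pY uX uY; by split; [exists ph | exists ph'].
- have [a b] := piece_cap hp hp' (or_intror h) pX pY uX uY; by split; [exists ph | exists ph'].
- have [a b] := piece_cap hp' hp (or_intror h) pY pX uY uX.
  by rewrite bicapC bicupC; split; [exists ph' | exists ph].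
Qed.

Let J := rdel ask st.2.1 st.2.2.2.
Let eJ : st.2.2.2 = bought tr. Proof. by case: (pc_pd inv). Qed.

(* W is the reason why the reverse deletion keeps h. *)
Definition wit h W := [/\ inA W, unc (take (index h (bought tr)) (bought tr)) W, covers h W
  & forall f, f \in J -> covers f W -> f = h].

Lemma rdel_facts : [/\ {subset J <= bought tr}, uniq J, forall X, inA X -> ~~ unc J X
  & forall h, h \in J -> exists W, wit h W].
Proof.
have [ub _] := bought_uniq (pc_pd inv); rewrite -eJ in ub.
have ck : chk ask st.2.1 st.2.2.2.
  apply/(chkP (p_ask P)) => p X; rewrite (pc_pcs inv) => /mapP[ph hp ->] pX.
  by rewrite eJ; exact: (pc_cov inv hp pX).
have [s1 s2 s3 s4] := rdel_spec (p_ask P) ub ck.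
have s3' X : inA X -> ~~ unc J X.
  move=> [ph hp pX]; move/(chkP (p_ask P)): s3 => /(_ (pieceof q ph) X); apply=> //.
  by rewrite (pc_pcs inv) map_f.
split=> //; first by rewrite -eJ.
move=> h hJ; have [p [W [+ pW uW hW]]] := s4 h hJ.
rewrite (pc_pcs inv) => /mapP[ph hp ep].
have AW : inA W by exists ph => //; rewrite -ep.
have ho f : f \in J -> covers f W -> f = h.
  move=> fJ cf; apply/eqP/negPn/negP => ne; by have := hW f fJ ne; rewrite cf.
exists W; split=> //; first by rewrite -eJ.
have := s3' W AW; rewrite /unc -has_predC => /hasP[f fJ /=]; rewrite negbK => cf.
by rewrite -(ho f fJ cf).
Qed.

Lemma pc_cost : ((ecost P J)%:~R <= LP)%R.
Proof.
have [s1 s2 s3 s4] := rdel_facts.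
apply: (@pd_exact _ _ P inA tr st.2.2 J xpredT) => //.
- exact: Acap.
- exact: (pc_pd inv).
- move=> it /mem_split[t1 [t2 etr]]; have [ph [h1 h2 _ _]] := pc_item inv etr.
  by exists ph => //; have [] := findmin_some (p_ask P) h2.
- move=> t1 it t2 X u etr AX uX u1 u2.
  exact: (least etr (inA_F AX) (small2 (inA_q AX)) uX u1 u2).
- exact: inA_F.
- move=> e /s4[W [AW uW cW hW]]; exists W; split=> // f fJ ne.
  by apply: contra ne => cf; rewrite (hW f fJ cf).
Qed.

Lemma pc_sub : {subset J <= E}.
Proof.
have [s1 _ _ _] := rdel_facts; have [_ sE] := bought_uniq (pc_pd inv).
by move=> e /s1/sE.
Qed.

Lemma inA_noend X : inA X -> ~~ hit st.1 X.
Proof.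
move=> [ph hp]; rewrite inpc_cpiece => /and5P[_ _ h _ _].
by apply: hit_sub h => //; exact: (pc_R inv hp).
Qed.

(** The edge [h] was bought after [g], so its witness is uncovered by all purchases up to and
    including [g]. *)
Lemma pos_h t1 g t2 h W : tr = t1 ++ g :: t2 -> h \in bought tr -> h \notin bought t1 -> h != g.2 ->
  unc (take (index h (bought tr)) (bought tr)) W -> unc (bought t1) W /\ ~~ covers g.2 W.
Proof.
move=> etr hin hn hg uW.
have e : exists s, take (index h (bought tr)) (bought tr) = bought t1 ++ g.2 :: s.
  rewrite etr bought_mid index_cat (negbTE hn) /= eq_sym (negbTE hg) take_cat ltnNge leq_addr /= addKn /=.
  by eexists.
case: e uW => s ->; rewrite unc_cat /= => /andP[u1 /andP[u2 _]]; by split.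
Qed.

(** Before the deletion [S] was covered, first by some [g], which was then deleted. The biset
    charged for [g] is still covered, by a kept edge [h], and the witness [W] of [h] contains that
    biset. Since [h] starts in [S] and is the only kept edge covering [W], the union of [S] and [W]
    stays uncovered. It is strictly larger, because its outer part gains the head of [g]. *)
Lemma extend S : S \in F -> unc J S -> #|S.1| <= q -> ~~ hit st.1 S ->
  exists W h t1 g t2, [/\ wit h W, h \in J /\ (h.1 \in S.1 /\ h.1 \in W.1),
    [/\ tr = t1 ++ g :: t2, unc (bought t1) S, covers g.2 S & bile g.1.1 S],
    g.2.1 \in W.1 /\ g.2.2 \in W.2 &
    [/\ bicup S W \in F, unc J (bicup S W) & ~~ hit st.1 (bicup S W)]].
Proof.
move=> SF uS Sq Sh; have [s1 s2 s3 s4] := rdel_facts.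
have nS : ~~ unc (bought tr) S by apply: contra Sh => h; exact: (pc_tr inv SF h (small2 Sq)).
have [t1 [g [t2 [etr u1 cg]]]] := first_cover nS.
have [ph [h1 h2 h3 h4]] := pc_item inv etr.
have [pg ug] := findmin_some (p_ask P) h2.
have Ag : inA g.1.1 by exists ph.
have cgg : covers g.2 g.1.1 by case: (pc_pd inv) => _ _ _ /(_ _ _ _ etr)[].
move: (cg) (cgg); rewrite !coversE => /andP[gS gS'] /andP[gg gg'].
have gleS := least etr SF (small2 Sq) u1 gg gS.
have := s3 _ Ag; rewrite /unc -has_predC => /hasP[h hJ /=]; rewrite negbK => chg.
have [W wW] := s4 h hJ; case: (wW) => AW uW chW hW.
have hn : h \notin bought t1 by apply: contraL chg => ht; move/uncP: ug; apply.
have hg : h != g.2 by apply: contraTneq cg => <-; move/uncP: uS; apply.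
have [uW1 ngW] := pos_h etr (s1 _ hJ) hn hg uW.
move: chg chW; rewrite !coversE => /andP[hg1 hg2] /andP[hW1 hW2].
have gleW := least etr (inA_F AW) (small2 (inA_q AW)) uW1 hg1 hW1.
have hS : h.1 \in S.1 by case/andP: gleS => /subsetP x _; exact: x.
have gW : g.2.1 \in W.1 by case/andP: gleW => /subsetP x _; exact: x.
have [_ UF] := Hreg SF (inA_F AW) (small2 Sq) (small2 (inA_q AW)) hS hW1.
exists W, h, t1, g, t2; split=> //.
- by split=> //; move: ngW; rewrite coversE gW /= negbK.
- split=> //.
    apply/uncP => e eJ'; rewrite coversE !inE negb_or; apply/negP => /andP[a /andP[b c]].
    have eS : e.1 \notin S.1.
      by apply/negP => eS; move/uncP: uS => /(_ e eJ'); rewrite coversE eS b.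
    have eW : e.1 \in W.1 by move: a; rewrite (negbTE eS).
    have ee : e = h by apply: hW => //; rewrite coversE eW.
    by rewrite ee hS in eS.
  apply/hitPn => t tR; rewrite inE negb_or.
  by move/hitPn: Sh => -> //; move/hitPn: (inA_noend AW) => ->.
Qed.

(* Otherwise let D be maximal and extend it by a witness W': then (D U W') n W
   is a larger such set. *)
Lemma no_inside h W D : h \in J -> wit h W -> D \in F -> unc J D -> bile D W -> False.
Proof.
move=> hJ wW; have [s1 s2 s3 s4] := rdel_facts.
have [n] := ubnP (#|V| + #|V| - msz D); elim: n => // n IH in D *.
move=> hn DF uD DW; case: (wW) => AW uW chW hW.
have DW1 : {subset D.1 <= W.1} by case/andP: DW => /subsetP.
have DW2 : {subset D.2 <= W.2} by case/andP: DW => _ /subsetP.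
have Dq : #|D.1| <= q.
  by apply: leq_trans (inA_q AW); apply: subset_leq_card; apply/subsetP.
have Dh : ~~ hit st.1 D by apply: hit_sub (inA_noend AW).
have [W' [h' [t1 [g [t2 [wW' [h'J [h'D h'W']] [etr u1 cg gD] [gW1 gW2] [UF uU hU]]]]]]] := extend DF uD Dq Dh.
case: (wW') => AW' uW' ch' hW'.
have [m [m1 m2 m3 m4]] := pc_item inv etr.
have [pg ug] := findmin_some (p_ask P) m2.
move: (pg); rewrite inpc_cpiece => /and5P[gF gu gh gc gq].
case: (AW) => ph hp; rewrite inpc_cpiece => /and5P[WF Wu Wh Wc Wq].
(* If the [R] of the charging phase lies in that of the phase of [W], then [D] itself belongs to the
   charging piece and is covered by [J]. Otherwise [g] was bought before the phase of [W]. *)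
case: (m4 ph hp) => [[t3 e3]|hsub]; last first.
  have cD : m.2.2 \in D.1 by case/andP: gD => /subsetP x _; exact: x.
  have AD : inA D.
    exists m => //; rewrite inpc_cpiece DF (unc_sub m3 u1) cD Dq /= andbT.
    apply/hitPn => t; rewrite mem_del => /andP[tm tR]; apply/negP => tD.
    have ec x : x \in m.2.1 -> x \in D.1 -> x = ph.2.2.
      move=> xm xD; apply/eqP/negPn/negP => ne; move/hitPn: Wh => /(_ x).
      by rewrite mem_del ne hsub // (DW1 _ xD) => /(_ isT).
    by rewrite (ec t tR tD) (ec _ (pc_c inv m1) cD) eqxx in tm.
  by have := s3 _ AD; rewrite uD.
move: (cg); rewrite coversE => /andP[gD1 gD2].
(* [W] contains the tail of [g] and was uncovered by [g] when its phase began. This head is the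
   vertex gained by the larger set. *)
have gW : g.2.2 \in W.2.
  move: Wu; rewrite e3 bought_mid unc_cat /= coversE (DW1 _ gD1) /=.
  by case/andP => _ /andP[]; rewrite negbK.
have h'D2 : h'.2 \in D.2.
  by move/uncP: uD => /(_ _ h'J); rewrite coversE h'D /= negbK.
(* Otherwise the union of [W] and [W'] is covered by [h] or [h']. The head of [h'] lies in [D.2],
   which excludes [h']; and [h] would also cover [W'], which forces it to be [h']. *)
have hnW' : h.1 \notin W'.1.
  apply/negP => hW1; have [_ AU] := Acap AW AW' (DW1 _ h'D) h'W'.
  have := s3 _ AU; rewrite /unc -has_predC => /hasP[e eJ' /=]; rewrite negbK coversE !inE negb_or.
  case/andP => e1 /andP[e2 e3'].
  have : e = h \/ e = h'.
    case/orP: e1 => e1; [left; apply: hW => // | right; apply: hW' => //]; by rewrite coversE e1.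
  case=> ee; last by rewrite ee (DW2 _ h'D2) in e2.
  have eh : h = h' by apply: hW' => //; rewrite coversE hW1 -ee.
  by rewrite ee eh (DW2 _ h'D2) in e2.
have hnD : h.1 \notin D.1.
  apply/negP => hD; move/uncP: uD => /(_ _ hJ); rewrite coversE hD /= negbK => /DW2.
  by move: chW; rewrite coversE => /andP[_ /negbTE ->].
pose D2 := bicap (bicup D W') W.
have U2 : #|(bicup D W').1| <= q + q.
  by apply: leq_trans (leq_card_setU _ _) _; apply: leq_add => //; exact: inA_q AW'.
have hU1 : h'.1 \in (bicup D W').1 by rewrite inE h'D.
have [D2F _] := Hreg UF WF U2 (small2 Wq) hU1 (DW1 _ h'D).
have uD2 : unc J D2.
  apply/uncP => e eJ'; rewrite coversE; apply/negP; rewrite /D2 /= [in X in X && _]inE.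
  case/andP => /andP[e1 e2]; rewrite inE negb_and => /orP[e3'|e3'].
    by move/uncP: uU => /(_ e eJ'); rewrite coversE e1 e3'.
  have ee : e = h by apply: hW => //; rewrite coversE e2.
  by move: e1; rewrite ee inE (negbTE hnD) (negbTE hnW').
have DD2 : bile D D2 by apply: bile_bicap => //; exact: bile_cupl.
have nD2 : ~~ bile D2 D.
  apply/negP => /andP[_ /subsetP /(_ g.2.2)]; rewrite !inE gW2 gW orbT => /(_ isT).
  by rewrite (negbTE gD2).
apply: (IH D2) => //; last exact: bile_capr.
exact: measure_step hn (msz_lt DD2 nD2) (msz_max D2).
Qed.

(** Extension is repeated while there are at most [q] inner vertices; each witness adds at most [q],
    so the size ends between [q + 1] and [2q]. The last hypothesis survives a step: a [D] inside the
    union that meets [S] is handled by its intersection with [S], and one disjoint from [S] would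
    give an uncovered member below [W], against [no_inside]. *)
Lemma giant C S : C.1 \subset S.1 -> S \in F -> unc J S -> #|S.1| <= q + q -> ~~ hit st.1 S ->
  (forall D, D \in F -> unc J D -> D.1 \subset S.1 -> C.1 \subset D.1) ->
  exists G, [/\ G \in F, unc J G, q < #|G.1| <= q + q, C.1 \subset G.1 &
    forall D, D \in F -> unc J D -> D.1 \subset G.1 -> C.1 \subset D.1].
Proof.
have [n] := ubnP (#|V| + #|V| - msz S); elim: n => // n IH in S *.
move=> hn CS SF uS S2 Sh hS; case: (leqP #|S.1| q) => Sq; last by exists S; rewrite Sq.
have [W [h [t1 [g [t2 [wW [hJ [hS1 hW1]] [etr u1 cg gS] [gW1 gW2] [UF uU hU]]]]]]] := extend SF uS Sq Sh.
case: (wW) => AW uW chW hW; have Wq := inA_q AW.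
apply: (IH (bicup S W)) => //.
- have nb : ~~ bile (bicup S W) S.
    apply/negP => /andP[_ /subsetP /(_ g.2.2)]; rewrite inE gW2 orbT => /(_ isT).
    by move: cg; rewrite coversE => /andP[_ /negbTE ->].
  exact: measure_step hn (msz_lt (bile_cupl S W) nb) (msz_max (bicup S W)).
- by apply: subset_trans CS _; exact: subsetUl.
- by apply: leq_trans (leq_card_setU _ _) _; apply: leq_add.
- move=> D DF uD DU.
  have D2 : #|D.1| <= q + q.
    by apply: leq_trans (subset_leq_card DU) _; apply: leq_trans (leq_card_setU _ _) _; apply: leq_add.
  have [[x xD xS]|hdis] := pselect (exists2 x, x \in D.1 & x \in S.1).
    have [IF _] := Hreg DF SF D2 (small2 Sq) xD xS.
    apply: subset_trans (hS _ IF (unc_cap uD uS) (subsetIr _ _)) (subsetIl _ _).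
  exfalso; have DW : {subset D.1 <= W.1}.
    move=> x xD; move/subsetP: DU => /(_ x xD); rewrite inE => /orP[xS|//].
    by case: hdis; exists x.
  have [x xD] := proper_in (p_proper P) DF.
  have [IF _] := Hreg DF (inA_F AW) D2 (small2 Wq) xD (DW _ xD).
  apply: (no_inside hJ wW IF _ (bile_capr D W)).
  apply/uncP => e eJ'; rewrite coversE !inE; apply/negP => /andP[/andP[e1 e2]].
  rewrite negb_and => /orP[e3|e3].
    by move/uncP: uD => /(_ e eJ'); rewrite coversE e1 e3.
  have ee : e = h by apply: hW => //; rewrite coversE e2.
  by apply: hdis; exists h.1 => //; rewrite -ee.
Qed.

Lemma fat_set c : c \in st.1 -> exists S, [/\ S \in F, unc J S, ~~ hit (del st.1 c) S, c \in S.1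
  & q < #|S.1| <= q + q /\ unc (bought tr) S].
Proof.
move=> cR; have [S [SF uS hS cS hq]] := thinN qV (fat cR).
have [s1 _ _ _] := rdel_facts; rewrite eJ in uS.
by exists S; split=> //; apply: unc_sub uS.
Qed.

(** Members meeting the final [R] are matched with the large members of fat vertices, the others
    with giants grown from a minimal uncovered member inside them. Large members matched to
    different [t] are disjoint in both groups: a common vertex would give the two given members a
    common one. *)
Lemma pc_small T (S : V -> bis) : uniq T ->
  (forall t, t \in T -> [/\ S t \in F, unc J (S t) & #|(S t).1| <= q]) ->
  (forall t t' u, t \in T -> t' \in T -> u \in (S t).1 -> u \in (S t').1 -> t = t') ->
  size T * q.+1 <= 2 * #|V|.
Proof.
move=> uT hS hd.
pose T1 := [seq t <- T | hit st.1 (S t)]; pose T2 := [seq t <- T | ~~ hit st.1 (S t)].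
have eT : size T = size T1 + size T2.
  by rewrite /T1 /T2 !size_filter -(count_predC (fun t => hit st.1 (S t)) T).
rewrite eT mulnDl mul2n -addnn; apply: leq_add.
- have h1 t : exists G : {set V}, t \in T1 -> exists c X, [/\ c \in st.1, c \in (S t).1, G = X.1,
      [/\ X \in F, unc (bought tr) X, ~~ hit (del st.1 c) X & c \in X.1] & q < #|X.1| <= q + q].
    case tT : (t \in T1); last by exists finset.set0.
    move: tT; rewrite mem_filter => /andP[/hasP[c cR cS] tT].
    have [X [XF uX hX cX [hq uX']]] := fat_set cR.
    by exists X.1 => _; exists c, X.
  have [f hf] := choice h1.
  apply: (@disjoint_count _ _ _ f); first by rewrite filter_uniq.
    by move=> t /hf[c [X [_ _ -> _ hq]]]; case/andP: hq.
  move=> t t' u tT t'T.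
  have [c [X [cR cS -> [XF uX hX cX] hq]]] := hf t tT.
  have [c' [X' [cR' cS' -> [XF' uX' hX' cX'] hq']]] := hf t' t'T => u1 u2.
  move: hq hq' => /andP[hq hq2] /andP[hq' hq2'].
  have [IF _] := Hreg XF XF' hq2 hq2' u1 u2.
  have I2 : #|(bicap X X').1| <= q + q by apply: leq_trans hq2; apply: subset_leq_card; exact: subsetIl.
  have /hasP[r rR] := pc_tr inv IF (unc_cap uX uX') I2; rewrite inE => /andP[r1 r2].
  have rc d Y : ~~ hit (del st.1 d) Y -> r \in Y.1 -> r = d.
    move=> /hitPn hY rY; apply/eqP/negPn/negP => ne; have := hY r.
    by rewrite mem_del ne rR rY => /(_ isT).
  apply: (hd t t' r).
  + by move: tT; rewrite mem_filter => /andP[].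
  + by move: t'T; rewrite mem_filter => /andP[].
  + by rewrite (rc c X hX r1).
  + by rewrite (rc c' X' hX' r2).
- have h2 t : exists G : {set V}, t \in T2 -> exists C X, [/\ G = X.1, [/\ X \in F, unc J X & q < #|X.1| <= q + q],
      [/\ C \in F, unc J C, C.1 \subset (S t).1 & C.1 \subset X.1] &
      forall D, D \in F -> unc J D -> D.1 \subset X.1 -> C.1 \subset D.1].
    case tT : (t \in T2); last by exists finset.set0.
    move: tT; rewrite mem_filter => /andP[hh tT]; have [SF uS Sq] := hS t tT.
    pose Q (C : bis) := [&& C \in F, unc J C & C.1 \subset (S t).1].
    have Q0 : Q (S t) by rewrite /Q SF uS subxx.
    have [C /and3P[CF uC CS] Cmin] := arg_minnP (fun C : bis => #|C.1|) Q0.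
    have Cq : #|C.1| <= q by apply: leq_trans (subset_leq_card CS) Sq.
    have [||G [GF uG Gq CG hG]] := @giant C C (subxx _) CF uC (small2 Cq).
    + apply: hit_sub hh => //; exact/subsetP.
    + move=> D DF uD DC; have QD : Q D by rewrite /Q DF uD (subset_trans DC CS).
      by have := Cmin D QD; rewrite (geq_leqif (subset_leqif_cards DC)) => /eqP ->.
    by exists G.1 => _; exists C, G.
  have [f hf] := choice h2.
  apply: (@disjoint_count _ _ _ f); first by rewrite filter_uniq.
    by move=> t /hf[C [X [-> [_ _ hq] _ _]]]; case/andP: hq.
  move=> t t' u tT t'T.
  have [C [X [-> [XF uX hq] [CF uC CS CX] hX]]] := hf t tT.
  have [C' [X' [-> [XF' uX' hq'] [CF' uC' CS' CX'] hX']]] := hf t' t'T => u1 u2.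
  move: hq hq' => /andP[hq hq2] /andP[hq' hq2'].
  have [IF _] := Hreg XF XF' hq2 hq2' u1 u2.
  have s1 := hX _ IF (unc_cap uX uX') (subsetIl _ _).
  have s2 := hX' _ IF (unc_cap uX uX') (subsetIr _ _).
  have s3 : C'.1 \subset X.1 by apply: subset_trans s2 (subsetIl _ _).
  have s4 := hX _ CF' uC' s3.
  have [r rC] := proper_in (p_proper P) CF.
  apply: (hd t t' r).
  + by move: tT; rewrite mem_filter => /andP[].
  + by move: t'T; rewrite mem_filter => /andP[].
  + exact: (subsetP CS).
  + by apply: (subsetP CS'); exact: (subsetP s4).
Qed.

End PC2.

Section PC3.
Variables (V : finType) (R : realType) (P : prob V R) (q : nat).
Hypothesis qV : q + q < #|V|.
Hypothesis Hreg : forall (X Y : biset V) u, X \in pfam P -> Y \in pfam P -> #|X.1| <= q + q -> #|Y.1| <= q + q ->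
  u \in X.1 -> u \in Y.1 -> bicap X Y \in pfam P /\ bicup X Y \in pfam P.

Lemma pcoverP : let J := pcover (pask P) (pcl P) q in
  [/\ {subset J <= pedg P}, uniq J, ((ecost P J)%:~R <= lpval P xpredT)%R &
  forall (T : seq V) (S : V -> biset V), uniq T ->
  (forall t, t \in T -> [/\ S t \in pfam P, unc J (S t) & #|(S t).1| <= q]) ->
  (forall t t' u, t \in T -> t' \in T -> u \in (S t).1 -> u \in (S t').1 -> t = t') ->
  size T * q.+1 <= 2 * #|V|].
Proof.
have [tr [phs [inv fat]]] := pcrunP P q.
have [_ u _ _] := rdel_facts inv.
split=> //.
- exact: (pc_sub inv).
- exact: (pc_cost Hreg inv).
- exact: (pc_small qV Hreg inv fat).
Qed.
End PC3.

(** * Partial covers in both orientations *)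

Section Both.
Variables (V : finType) (R : realType) (P : prob V R) (q : nat).
Notation edge := (V * V)%type.
Notation bis := (biset V).
Implicit Types (X Y S W D C G : bis).
Local Notation F := (pfam P).
Local Notation ask := (pask P).
Local Notation E := (pedg P).
Local Notation cl := (pcl P).
Local Notation LP := (lpval P xpredT).
Definition reg (G : {set biset V}) := forall (X Y : bis) u, X \in G -> Y \in G -> #|X.1| <= q + q -> #|Y.1| <= q + q ->
  u \in X.1 -> u \in Y.1 -> bicap X Y \in G /\ bicup X Y \in G.

(** Two inner parts of size at most [2q] have a union of size at most [4q], which leaves more than
    [k] vertices outside. *)
Lemma k_regular_reg k (G : {set biset V}) : k_regular k G -> 4 * q < #|V| - k -> reg G.
Proof.
move=> h hq X Y u XG YG X2 Y2 uX uY; apply: h => //.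
  by apply/set0Pn; exists u; rewrite inE uX.
have := cardsC (X.1 :|: Y.1).
have : #|X.1 :|: Y.1| <= #|X.1| + #|Y.1| by exact: leq_card_setU.
move: X2 Y2 hq; move: #|_ :|: _| #|~: _| #|X.1| #|Y.1| #|V| => a b c d e; clear; lia.
Qed.

Hypothesis qV : q + q < #|V|.
Hypothesis Hreg : reg F.
Hypothesis Hreg' : reg (cofamily F).

Lemma pcboth_cost : {subset pcboth ask cl q <= E} /\ ((ccost P (pcboth ask cl q))%:~R <= LP + LP)%R.
Proof.
rewrite /pcboth -pcl_flip.
have [a1 a2 a3 _] := pcoverP qV Hreg.
have [b1 b2 b3 _] := @pcoverP V R (flip P) q qV Hreg'.
have b1' : {subset map (@fl V) (pcover (askr ask) (pcl (flip P)) q) <= E}.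
  by move=> e; rewrite mem_fl => /b1; rewrite /= mem_fl flK.
split; first by move=> e; rewrite mem_cat => /orP[/a1|/b1'].
apply: (@le_trans _ _ ((ccost P (pcover ask cl q))%:~R + (ccost P (map (@fl V) (pcover (askr ask) (pcl (flip P)) q)))%:~R)%R).
  by rewrite -intrD ler_int ccost_cat.
apply: lerD; first by rewrite ccost_ecost.
rewrite ccost_ecost //; last by rewrite map_inj_uniq //; exact: inv_inj (@flK V).
by rewrite -ecost_flip; apply: le_trans b3 _; rewrite lpval_flip.
Qed.

(** The 5 is 2 + 2 + 1: private members that are small in either orientation contribute at most
    [2n(q+1)], hence [2n^2], each, and the rectangles contribute [n^2]. *)
Lemma pcboth_T : size (mintrans ask (pcboth ask cl q)) * q.+1 ^ 2 <= 5 * #|V| ^ 2.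
Proof.
have [_ _ _ a4] := pcoverP qV Hreg.
have [_ _ _ b4] := @pcoverP V R (flip P) q qV Hreg'.
have [uT hT _] := mintransP P (pcboth ask cl q).
set J0 := pcboth _ _ _ in uT hT *; set T := mintrans _ _ in uT hT *.
have h t : exists S, t \in T -> [/\ S \in F, unc J0 S, t \in S.1 & forall t', t' \in T -> t' \in S.1 -> t' = t].
  case tT : (t \in T); last by exists (finset.set0, finset.set0).
  by have [S hS] := mintrans_private tT; exists S.
have [S hS] := choice h.
have same t t' : t \in T -> t' \in T -> bicap (S t) (S t') \in F -> t = t'.
  move=> tT t'T IF; have [_ u1 _ p1] := hS t tT; have [_ u2 _ p2] := hS t' t'T.
  have /hasP[r rT] := (elimT (istransP _ _ _) hT) _ IF (unc_cap u1 u2).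
  by rewrite inE => /andP[r1 r2]; rewrite -(p1 r rT r1) -(p2 r rT r2).
have qq : q <= q + q by exact: leq_addr.
pose T1 := [seq t <- T | #|(S t).1| <= q].
pose T2 := [seq t <- T | #|~: (S t).2| <= q].
pose T3 := [seq t <- T | (q < #|(S t).1|) && (q < #|~: (S t).2|)].
have eT : size T <= size T1 + size T2 + size T3.
  rewrite !size_filter; elim: (T) => //= t s; move: (count _ s) (count _ s) (count _ s) => a b c.
  rewrite !(ltnNge q); move: (size s) => m; case: (_ <= q); case: (_ <= q); clear; rewrite /=; lia.
have e1 : size T1 * q.+1 <= 2 * #|V|.
  apply: (a4 T1 S); first by rewrite filter_uniq.
    move=> t; rewrite mem_filter => /andP[hq /hS[SF + _ _]]; rewrite unc_cat => /andP[u _]; by split.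
  move=> t t' u; rewrite !mem_filter => /andP[hq tT] /andP[hq' t'T] u1 u2; apply: same => //.
  have [SF _ _ _] := hS t tT; have [SF' _ _ _] := hS t' t'T.
  by have [] := Hreg SF SF' (leq_trans hq qq) (leq_trans hq' qq) u1 u2.
have e2 : size T2 * q.+1 <= 2 * #|V|.
  apply: (b4 T2 (fun t => cobiset (S t))); first by rewrite filter_uniq.
    move=> t; rewrite mem_filter => /andP[hq /hS[SF + _ _]]; rewrite unc_cat -pcl_flip => /andP[_ u]; split=> //.
      by rewrite /= in_cofamily cobisetK.
    by rewrite unc_co.
  move=> t t' u; rewrite !mem_filter => /andP[hq tT] /andP[hq' t'T] u1 u2; apply: same => //.
  have [SF _ _ _] := hS t tT; have [SF' _ _ _] := hS t' t'T.
  have c1 : cobiset (S t) \in cofamily F by rewrite in_cofamily cobisetK.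
  have c2 : cobiset (S t') \in cofamily F by rewrite in_cofamily cobisetK.
  have [_] := Hreg' c1 c2 (leq_trans hq qq) (leq_trans hq' qq) u1 u2.
  by rewrite bicup_co in_cofamily cobisetK.
have e3 : size T3 * q.+1 ^ 2 <= #|V| ^ 2.
  rewrite -[#|V| ^ 2]mulnn -card_prod.
  (* A point common to two rectangles makes the bisets cross, so by [same] they belong to one
     vertex. *)
  apply: (@disjoint_count _ _ _ (fun t => finset.setX (S t).1 (~: (S t).2))); first by rewrite filter_uniq.
    move=> t; rewrite mem_filter => /andP[/andP[h1 h2] _].
    by rewrite cardsX -mulnn leq_mul.
  move=> t t' [u v]; rewrite !mem_filter !inE /= => /andP[_ tT] /andP[_ t'T] /andP[u1 v1] /andP[u2 v2].
  apply: same => //; have [SF _ _ _] := hS t tT; have [SF' _ _ _] := hS t' t'T.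
  by have [] := crossP (p_crossing P) SF SF' u1 u2 v1 v2.
have q1 : q.+1 <= #|V| by move: qV; move: #|V| => n; clear; lia.
move: e1 e2 e3 eT q1; rewrite -!mulnn.
move: (size T) (size T1) (size T2) (size T3) #|V| => a b c d n; clear; nia.
Qed.
End Both.

(** * Rounds of core covers *)

Section Rounds.
Variables (V : finType) (R : realType).
Notation edge := (V * V)%type.
Notation bis := (biset V).
Implicit Types (P : prob V R) (X Y S W D C G : bis) (J K : seq edge).

Lemma ohd_enum P X : X \in pfam P -> exists2 u, ohd (enum X.1) = Some u & u \in X.1.
Proof.
move=> XF; have [u uX] := proper_in (p_proper P) XF.
have := ohdP (enum X.1); case: (ohd _) => [w|e]; first by rewrite mem_enum; exists w.
by move: uX; rewrite -mem_enum e.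
Qed.

Lemma mem_mins P J X : X \in mins (pask P) J -> X \in pfam P /\ unc J X.
Proof.
case/flattenP => l /mapP[[u v] _ ->] /=; have := @p_ask _ _ P J u v.
by case: (pask P J u v) => [[Y Z]|] // [/and4P[a b _ _] _ _ _]; rewrite inE => /eqP ->.
Qed.

Lemma mins_below P J S : S \in pfam P -> unc J S -> exists2 X, X \in mins (pask P) J & bile X S.
Proof.
move=> SF uS; have [u uS1] := proper_in (p_proper P) SF; have [v vS] := proper_out (p_proper P) SF.
have := @p_ask _ _ P J u v; case E1 : (pask P J u v) => [[Y Z]|]; last first.
  by move/(_ S); rewrite /sep SF uS uS1 vS.
case=> _ /(_ S); rewrite /sep SF uS uS1 vS => /(_ isT) YS _ _.
exists Y => //; apply/flattenP; exists [:: Y]; last by rewrite inE.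
by apply/mapP; exists (u, v); rewrite ?mem_prs ?mem_enum //= E1.
Qed.

Lemma ncoresP P J C : C \in ncores (pask P) J -> [/\ C \in pfam P, unc J C
  & forall D, D \in pfam P -> unc J D -> bile D C -> D = C].
Proof.
rewrite mem_filter => /andP[/allP h /mem_mins[CF uC]]; split=> // D DF uD DC.
have [X Xm XD] := mins_below DF uD; have := h X Xm; rewrite (bile_trans XD DC) => CX.
by apply: bile_anti DC (bile_trans CX XD).
Qed.

Lemma ncores_below P J S : S \in pfam P -> unc J S -> exists2 C, C \in ncores (pask P) J & bile C S.
Proof.
move=> SF uS; have [X Xm XS] := mins_below SF uS.
pose Q (Y : bis) := (Y \in mins (pask P) J) && bile Y S.
have Q0 : Q X by rewrite /Q Xm.
have [C /andP[Cm CS] Cmin] := arg_minnP (@msz V) Q0.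
exists C => //; rewrite mem_filter Cm andbT; apply/allP => D Dm; case: ifP => // DC.
apply/negPn/negP => nCD; have := Cmin D; rewrite /Q Dm (bile_trans DC CS) => /(_ isT).
by rewrite leqNgt (msz_lt DC nCD).
Qed.

Lemma cap_unc P J X Y e : X \in pfam P -> Y \in pfam P -> unc J X -> unc J Y ->
  e.1 \in X.1 -> e.1 \in Y.1 -> e.2 \notin X.2 -> e.2 \notin Y.2 -> bicap X Y \in pfam P /\ unc J (bicap X Y).
Proof.
move=> XF YF uX uY a b c d; have [h _] := crossP (p_crossing P) XF YF a b c d.
by split=> //; exact: unc_cap.
Qed.

(** The first group of edges covers the members above a core not below [C], the second one those
    containing [u] but not all of [C.2]. Conversely, an edge of the first group covering [X] starts
    in a core [D] and ends outside [D.2], so [D] and [X] cross, and [D] lies below [X] by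
    minimality. *)
Lemma kcoreP P J C X u : C \in ncores (pask P) J -> X \in pfam P -> unc J X ->
  ohd (enum C.1) = Some u -> u \in C.1 ->
  unc (kcore (ncores (pask P) J) C) X && (u \in X.1) =
  bile C X && all (fun D => bile D X ==> (D == C)) (ncores (pask P) J).
Proof.
move=> hC XF uX eu uC; have [CF uC' mC] := ncoresP hC.
have bileP D d v : D \in ncores (pask P) J -> d \in D.1 -> d \in X.1 -> v \notin D.2 -> v \notin X.2 -> bile D X.
  move=> hD d1 d2 v1 v2; have [DF uD mD] := ncoresP hD.
  have [IF uI] := @cap_unc P J D X (d, v) DF XF uD uX d1 d2 v1 v2.
  by rewrite -(mD _ IF uI (bile_capl _ _)) bile_capr.
have [v vX] := proper_out (p_proper P) XF.
rewrite /kcore unc_cat eu; apply/idP/idP.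
- case/andP => /andP[/uncP u1 /uncP u2] uX1.
  have CX2 : C.2 \subset X.2.
    apply/subsetP => w wC; have := u2 (u, w); rewrite mem_prs /= mem_head mem_enum wC => /(_ isT).
    by rewrite coversE /= uX1 negbK.
  have CX : bile C X.
    apply: (bileP C u v hC uC uX1) => //; apply: contra vX; exact: (subsetP CX2).
  rewrite CX /=; apply/allP => D hD; apply/implyP => DX; apply/eqP.
  have [DF uD mD] := ncoresP hD; have [d ed dD] := ohd_enum DF.
  case DC : (bile D C); first by apply: mC.
  case/andP: DX => /subsetP DX1 /subsetP DX2.
  suff : ~~ covers (d, v) X by rewrite coversE /= vX (DX1 _ dD).
  apply: u1; apply/flattenP; exists (prs [:: d] [seq v <- enum V | ~~ (v \in D.2)]).
    by apply/mapP; exists D; rewrite // DC ed.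
  rewrite mem_prs mem_head mem_filter mem_enum andbT /=.
  by apply: contra vX; exact: DX2.
- case/andP => CX /allP hX; have uX1 : u \in X.1 by case/andP: CX => /subsetP h _; exact: h.
  rewrite uX1 andbT; apply/andP; split; last first.
    apply/uncP => -[a w]; rewrite mem_prs /= inE mem_enum => /andP[/eqP -> wC].
    rewrite coversE /= uX1 negbK; by case/andP: CX => _ /subsetP; apply.
  apply/uncP => -[a w] /flattenP[l /mapP[D hD ->]].
  case DC : (bile D C) => //; have [DF uD mD] := ncoresP hD; have [d ed dD] := ohd_enum DF.
  rewrite ed mem_prs /= inE mem_filter => /andP[/eqP -> /andP[wD _]].
  rewrite coversE /=; apply/negP => /andP[dX wX].
  have := hX D hD; rewrite (bileP D d w hD dD dX wD wX) /= => /eqP eD.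
  by rewrite eD bile_refl in DC.
Qed.

Definition sole P J C X := [&& X \in pfam P, unc J X, bile C X &
  all (fun D => bile D X ==> (D == C)) (ncores (pask P) J)].
Definition pround P J C : pred edge := fun e => [exists X : bis, sole P J C X && covers e X].

(** The two members cross along the edge; their intersection is uncovered and contains a core, which
    must be the sole core of both. *)
Lemma pround_disj P J C C' e : C \in ncores (pask P) J -> C' \in ncores (pask P) J ->
  pround P J C e -> pround P J C' e -> C = C'.
Proof.
move=> hC hC' /existsP[X /andP[/and4P[XF uX CX /allP aX] cX]] /existsP[Y /andP[/and4P[YF uY CY /allP aY] cY]].
move: cX cY; rewrite !coversE => /andP[a b] /andP[a' b'].
have [IF uI] := cap_unc XF YF uX uY a a' b b'.
have [D hD DI] := ncores_below IF uI.
have := aX D hD; rewrite (bile_trans DI (bile_capl _ _)) /= => /eqP <-.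
by have := aY D hD; rewrite (bile_trans DI (bile_capr _ _)) /= => /eqP <-.
Qed.

Definition rpart P J C := if ohd (enum C.1) is Some c then
  rcover (pask P) (pcl P) (J ++ kcore (ncores (pask P) J) C) c else [::].

Lemma rpartP P J C : C \in ncores (pask P) J ->
  [/\ {subset rpart P J C <= pedg P}, ((ccost P (rpart P J C))%:~R <= lpval P (pround P J C))%R
    & forall X, sole P J C X -> ~~ unc (rpart P J C) X].
Proof.
move=> hC; have [CF uC mC] := ncoresP hC; have [c ec cC] := ohd_enum CF.
rewrite /rpart ec.
have [|a b d f] := @rcoverP V R P (J ++ kcore (ncores (pask P) J) C) c (pround P J C).
  move=> e S eE SF; rewrite unc_cat => /andP[uS kS] cS ce.
  apply/existsP; exists S; rewrite ce andbT /sole SF uS /=.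
  by rewrite -(kcoreP hC SF uS ec cC) kS cS.
split=> //; first by rewrite ccost_ecost.
move=> X /and4P[XF uX h1 h2]; have := kcoreP hC XF uX ec cC; rewrite h1 h2 => /andP[h3 h4].
by apply: d => //; rewrite unc_cat uX.
Qed.

Lemma ccost_flatten P (I : eqType) (s : seq I) (f : I -> seq edge) :
  (ccost P (flatten [seq f i | i <- s]) <= \sum_(i <- undup s) ccost P (f i))%R.
Proof.
have e : flatten [seq f i | i <- s] =i flatten [seq f i | i <- undup s].
  move=> e; apply/flattenP/flattenP => -[l /mapP[i ii ->] el]; exists (f i) => //; apply/mapP; exists i => //.
    by rewrite mem_undup.
  by rewrite -mem_undup.
rewrite (ccost_eq _ e); elim: (undup s) => [|i s' IH] /=.
  by rewrite big_nil ccostE big1 // => e' /andP[].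
by rewrite big_cons; apply: le_trans (ccost_cat _ _ _) _; rewrite lerD2l.
Qed.

(** By [pround_disj] the cores use disjoint parts of the LP, so the round costs at most one LP. If
    nothing is uncovered there is no core and the cost does not change, which makes surplus rounds
    free. *)
Lemma roundP P J : {subset J <= pedg P} -> let J' := round (pask P) (pcl P) J in
  [/\ {subset J' <= pedg P}, ((ccost P J')%:~R <= (ccost P J)%:~R + lpval P xpredT)%R,
      ((forall S, S \in pfam P -> ~~ unc J S) -> ccost P J' = ccost P J),
      {subset J <= J'}
    & forall S, S \in pfam P -> unc J' S -> exists C D, [/\ C \in ncores (pask P) J, D \in ncores (pask P) J,
       C != D, bile C S & bile D S]].
Proof.
move=> sJ; rewrite /round; set cs := ncores _ J.
have eqp : [seq (if ohd (enum (C : bis).1) is Some c then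
     rcover (pask P) (pcl P) (J ++ kcore cs C) c else [::]) | C <- cs] = [seq rpart P J C | C <- cs] by [].
rewrite eqp; set J2 := J ++ _.
have sJ2 : {subset J2 <= pedg P}.
  move=> e; rewrite mem_cat => /orP[/sJ //|/flattenP[l /mapP[C hC ->]]].
  by have [h _ _] := rpartP hC; exact: h.
have ee := ecanon_eq sJ2.
split.
- exact: ecanon_sub.
- rewrite (ccost_eq _ ee).
  apply: (@le_trans _ _ ((ccost P J)%:~R + (\sum_(C <- undup cs) ccost P (rpart P J C))%:~R)%R).
    by rewrite -intrD ler_int; apply: le_trans (ccost_cat _ _ _) _; rewrite lerD2l ccost_flatten.
  rewrite lerD2l rmorph_sum /=.
  apply: (@le_trans _ _ (\sum_(C <- undup cs) lpval P (pround P J C))%R).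
    rewrite big_seq [X in (_ <= X)%R]big_seq; apply: ler_sum => C; rewrite mem_undup => hC.
    by have [_ h _] := rpartP hC.
  rewrite /lpval (exchange_big_dep xpredT) //= big_seq [X in (_ <= X)%R]big_seq.
  apply: ler_sum => e eE; rewrite -big_filter.
  have h0 : (0 <= (pcst P e)%:~R * plp P e)%R by rewrite mulr_ge0 ?ler0z ?p_cst0 ?p_lp0.
  have hu := filter_uniq (fun C => pround P J C e) (undup_uniq cs).
  have hm C : C \in [seq C <- undup cs | pround P J C e] -> C \in cs /\ pround P J C e.
    by rewrite mem_filter mem_undup => /andP[].
  case: [seq _ <- _ | _] hu hm => [|C [|D l]]; rewrite ?big_nil ?big_cons ?big_nil ?addr0 //.
  move=> /andP[tt _] hm; have [a b] := hm C (mem_head _ _).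
  have [a' b'] : D \in cs /\ pround P J D e by apply: hm; rewrite inE mem_head orbT.
  by rewrite (pround_disj a a' b b') mem_head in tt.
- move=> h; rewrite (ccost_eq _ ee); apply: ccost_eq.
  suff -> : J2 = J by [].
  rewrite /J2 (_ : cs = [::]) ?cats0 //; apply/eqP; rewrite -size_eq0 -leqn0 leqNgt -has_predT.
  apply/negP => /hasP[C hC _]; have [CF uC _] := ncoresP hC.
  by have := h C CF; rewrite uC.
- by move=> e eJ; rewrite ee mem_cat eJ.
- move=> S SF; rewrite (unc_eq _ ee) unc_cat => /andP[uS uF].
  have [C hC CS] := ncores_below SF uS.
  case hs : (all (fun D => bile D S ==> (D == C)) cs).
    have [_ _ /(_ S)] := rpartP hC; rewrite /sole SF uS CS [all _ _]hs => /(_ isT).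
    rewrite (unc_sub _ uF) // => e eC; apply/flattenP; exists (rpart P J C) => //.
    exact: map_f.
  move/negbT: hs => /allPn[D hD]; rewrite negb_imply => /andP[DS ne].
  by exists C, D; split=> //; rewrite eq_sym.
Qed.

(** Small means at most half of [s], so that when [#|S.1|] and [#|~: S.2|] add up to [s] one of the
    two orientations is small. *)
Definition lowsize P J s m := forall S, S \in pfam P -> unc J S -> 2 * #|S.1| <= s -> m <= #|S.1|.

(* A surviving small set contains two old cores, which k-regularity makes disjoint. *)
Lemma round_double P J k m : {subset J <= pedg P} -> k < #|V| -> k_regular k (pfam P) ->
  lowsize P J (#|V| - k) m -> lowsize P (round (pask P) (pcl P) J) (#|V| - k) (2 * m).
Proof.
move=> sJ kV reg low S SF uS S2.
have [_ _ _ sub h] := roundP sJ; have [C [D [hC hD ne CS DS]]] := h S SF uS.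
have [CF uC mC] := ncoresP hC; have [DF uD mD] := ncoresP hD.
have sm X : bile X S -> 2 * #|X.1| <= #|V| - k.
  by case/andP => /subset_leq_card h1 _; apply: leq_trans S2; rewrite leq_mul2l.
have mC' := low C CF uC (sm C CS); have mD' := low D DF uD (sm D DS).
case/andP: CS => CS _; case/andP: DS => DS _.
have US : C.1 :|: D.1 \subset S.1 by rewrite subUset CS.
have US' := subset_leq_card US.
apply: leq_trans US'; rewrite cardsU.
suff -> : C.1 :&: D.1 = finset.set0.
  by rewrite cards0 subn0 mul2n -addnn leq_add.
(* Both cores lie in the small [S], so their union leaves more than [k] vertices outside and
   regularity applies; by minimality the intersection would equal both cores. *)
apply/eqP/negPn/negP => hI; have [|IF _] := reg C D CF DF hI.
  have := cardsC (C.1 :|: D.1); have := subset_leq_card US.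
  have [u uS1] := proper_in (p_proper P) SF.
  have : 0 < #|S.1| by apply/card_gt0P; exists u.
  move: S2 kV; move: #|_ :|: _| #|~: _| #|S.1| #|V| => a b c d; clear; lia.
have uI := unc_cap uC uD.
by move: ne; rewrite -(mC _ IF uI (bile_capl _ _)) -{2}(mD _ IF uI (bile_capr _ _)) eqxx.
Qed.

Lemma lowsize_sub P J J' s m : {subset J <= J'} -> lowsize P J s m -> lowsize P J' s m.
Proof. by move=> h l S SF uS; apply: l => //; exact: unc_sub uS. Qed.

(** * Families with constant boundary size *)

Section Exactly.
Variables (P : prob V R) (k : nat).
Hypothesis kV : k < #|V|.
Hypothesis reg1 : k_regular k (pfam P).
Hypothesis reg2 : k_regular k (cofamily (pfam P)).
Hypothesis bd : forall S, S \in pfam P -> #|boundary S| = k.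
Local Notation s := (#|V| - k).
Local Notation LP := (lpval P xpredT).

Definition low2 J m := lowsize P J s m /\ lowsize (flip P) (map (@fl V) J) s m.

Lemma flip_sub J : {subset J <= pedg P} -> {subset map (@fl V) J <= pedg (flip P)}.
Proof. by move=> h e; rewrite mem_fl => /h; rewrite /= mem_fl. Qed.

Lemma ccost_flip J : {subset J <= pedg P} -> uniq J -> ccost (flip P) (map (@fl V) J) = ccost P J.
Proof.
move=> sJ uJ; rewrite ccost_ecost; last exact: flip_sub.
  by rewrite ecost_flip mapK ?ccost_ecost //; exact: flK.
by rewrite map_inj_uniq //; exact: inv_inj (@flK V).
Qed.

Lemma droundP J m : {subset J <= pedg P} -> uniq J -> low2 J m ->
  let J' := dround (pask P) (pcl P) J in
  [/\ {subset J' <= pedg P}, uniq J', low2 J' (2 * m),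
   ((ccost P J')%:~R <= (ccost P J)%:~R + 2%:R * LP)%R
  & (forall S, S \in pfam P -> ~~ unc J S) -> ccost P J' = ccost P J].
Proof.
move=> sJ uJ [l1 l2]; rewrite /dround -pcl_flip.
set J1 := round (pask P) _ J; set J2 := round _ _ (map _ J1).
have [a1 a2 a3 a4 _] := roundP sJ; rewrite -/J1 in a1 a2 a3 a4.
have sJ1 := flip_sub a1.
have uJ1 : uniq J1 by exact: ecanon_uniq.
have [b1 b2 b3 b4 _] := @roundP (flip P) _ sJ1; rewrite -/J2 in b1 b2 b3 b4.
have uJ2 : uniq J2 by exact: (@ecanon_uniq _ _ (flip P)).
have sJ2 : {subset map (@fl V) J2 <= pedg P}.
  by move=> e; rewrite mem_fl => /b1; rewrite /= mem_fl flK.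
have uJ2' : uniq (map (@fl V) J2) by rewrite map_inj_uniq //; exact: inv_inj (@flK V).
have c2 : ccost P (map (@fl V) J2) = ccost (flip P) J2.
  by rewrite -(ccost_flip sJ2 uJ2') mapK //; exact: flK.
have c1 : ccost (flip P) (map (@fl V) J1) = ccost P J1 by exact: ccost_flip.
split=> //.
- split.
    apply: (@lowsize_sub P J1); last exact: (round_double sJ kV reg1 l1).
    by move=> e eJ1; rewrite mem_fl; apply: b4; rewrite mem_fl flK.
  rewrite mapK; last exact: flK.
  apply: (@round_double (flip P) _ k m sJ1 kV reg2).
  by apply: lowsize_sub l2 => e; rewrite !mem_fl; exact: a4.
- rewrite c2; apply: le_trans b2 _; rewrite c1 lpval_flip.
  by move: a2; rewrite /=; lra.
- move=> h; rewrite c2 b3 ?c1 ?a3 // => S; rewrite /= in_cofamily => SF; apply/negP => uS.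
  have := h _ SF; rewrite unc_co => /negP; apply; apply: unc_sub uS => e.
  by rewrite !mem_fl; exact: a4.
Qed.

(** As the boundary has exactly [k] vertices, [#|S.1|] and [#|~: S.2|] add up to [s]. The smaller
    one is at most [s/2], yet at least [m] if [S] is uncovered. *)
Lemma low2_empty J m : low2 J m -> s < 2 * m -> forall S, S \in pfam P -> ~~ unc J S.
Proof.
move=> [l1 l2] hm S SF; apply/negP => uS.
have := bd SF; rewrite /boundary cardsD (setIidPr _); last exact: (biset_sub (p_proper P) SF).
have e1 := cardsC S.2; have h3 := subset_leq_card (biset_sub (p_proper P) SF).
have h1 := l1 S SF uS.
have h2 : 2 * #|~: S.2| <= s -> m <= #|~: S.2|.
  apply: (l2 (cobiset S)); first by rewrite /= in_cofamily cobisetK.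
  by rewrite unc_co mapK //; exact: flK.
move: h1 h2 e1 h3 hm; move: #|S.1| #|S.2| #|~: _| #|V| => a b c d; clear; lia.
Qed.

(** The least size starts at 1 and doubles, so after [trunc_log 2 s] double rounds it exceeds [s/2]
    and nothing is left. The [minn] in the invariant expresses that further rounds are free. *)
Lemma roundsP : let J := rounds (pask P) (pcl P) in
  [/\ {subset J <= pedg P}, forall S, S \in pfam P -> ~~ unc J S
    & ((ccost P J)%:~R <= (2 * trunc_log 2 s)%:R * LP)%R].
Proof.
rewrite /rounds; set i0 := trunc_log 2 s.
have s0 : 0 < s by rewrite subn_gt0.
have hi0 : s < 2 * 2 ^ i0 by rewrite -expnS; exact: trunc_log_ltn.
have H (l : seq V) : let J := foldl (fun J _ => dround (pask P) (pcl P) J) [::] l in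
  [/\ {subset J <= pedg P}, uniq J, low2 J (2 ^ size l)
    & ((ccost P J)%:~R <= (2 * minn (size l) i0)%:R * LP)%R].
  elim/last_ind: l => [|l v]; rewrite ?foldl_rcons => /=.
    split=> //; last by rewrite min0n muln0 mul0r ccostE big1 // => e /andP[].
    split=> S SF _ _; rewrite expn0; apply/card_gt0P.
      exact: (proper_in (p_proper P) SF).
    exact: (proper_in (p_proper (flip P)) SF).
  set J := foldl _ _ l => -[h1 h2 h3 h4]; have [g1 g2 g3 g4 g5] := droundP h1 h2 h3.
  split=> //; first by rewrite size_rcons expnS.
  rewrite size_rcons; case: (leqP i0 (size l)) => hl.
    rewrite g5; first by move: h4; rewrite !(minn_idPr _) //; exact: leqW.
    apply: (low2_empty h3); apply: leq_trans hi0 _; rewrite leq_mul2l /=; exact: leq_pexp2l.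
  apply: le_trans g4 _; move: h4; rewrite !(minn_idPl _) //; last exact: ltnW.
  by rewrite mulnS natrD mulrDl; lra.
have [g1 g2 g3 g4] := H (enum V); split=> //.
- apply: (low2_empty g3); apply: leq_trans hi0 _; rewrite leq_mul2l /=; apply: leq_pexp2l => //.
  rewrite -cardE; apply: leq_trans (leq_subr k #|V|); apply: ltnW.
  by apply: leq_trans (ltn_expl i0 (isT : 1 < 2)) _; exact: trunc_logP.
- apply: le_trans g4 _; apply: ler_wpM2r; first exact: lpval_ge0.
  by rewrite ler_nat leq_mul2l /= geq_minr.
Qed.
End Exactly.
End Rounds.

(** * The approximation ratios *)

Section Logs.
Variable R : realType.
Local Open Scope ring_scope.

Lemma ln_leB1 (x : R) : 0 < x -> ln x <= x - 1.
Proof. by move=> x0; rewrite -[X in ln X](subrK 1 x) addrC; apply: le_ln1Dx; lra. Qed.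

(** The step is [ln x <= x - 1] at [x = (m+1)/(m+2)]. *)
Lemma harm_le m : (0 < m)%N -> harm R m <= 1 + ln m%:R.
Proof.
elim: m => // -[_ _|m IH _]; first by rewrite /harm big_ord_recr big_ord0 /= ln1 add0r addr0 invr1.
rewrite /harm big_ord_recr /=.
have h := IH isT; rewrite /harm in h.
apply: (le_trans (lerD h (lexx _))); rewrite -addrA lerD2l.
have m0 : 0 < m.+1%:R :> R by rewrite ltr0n.
have m1 : 0 < m.+2%:R :> R by rewrite ltr0n.
have e : ln m.+1%:R = ln m.+2%:R + ln (m.+1%:R / m.+2%:R) :> R.
  by rewrite ln_div ?posrE // addrC subrK.
have l := ln_leB1 (divr_gt0 m0 m1).
have e2 : m.+1%:R / m.+2%:R - 1 = - m.+2%:R^-1 :> R.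
  by rewrite -[X in _ - X](divff (lt0r_neq0 m1)) -mulrBl (_ : _ - _ = -1) ?mulN1r // -(natr1 m.+1) opprD addrA subrr sub0r.
rewrite e2 in l; have key (a b c d : R) : a = b + d -> d <= - c -> a + c <= b by move=> -> ?; lra.
exact: key e l.
Qed.

Lemma log1_ge1 (y : R) : 1 <= log1 y. Proof. by rewrite /log1 le_max lexx. Qed.
Lemma log1_ln (y : R) : ln y <= log1 y. Proof. by rewrite /log1 le_max lexx orbT. Qed.

Lemma harm_log1 m : harm R m <= 2%:R * log1 m%:R.
Proof.
case: m => [|m]; first by rewrite /harm big_ord0; have := log1_ge1 (0%:R); lra.
have := @harm_le m.+1 isT; have := log1_ge1 (m.+1%:R); have := log1_ln (m.+1%:R); lra.
Qed.

Lemma trunc_log_ln m : (0 < m)%N -> (2 * trunc_log 2 m)%:R <= 4%:R * log1 m%:R :> R.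
Proof.
move=> m0; set i := trunc_log 2 m.
have h : ln ((2 ^ i)%:R : R) <= ln (m%:R : R).
  by rewrite ler_ln ?posrE ?ltr0n ?expn_gt0 // ler_nat; exact: trunc_logP.
(* A crude bound, from [ln x <= x - 1] at [x = 1/2]; it turns the factor 2 into 4. *)
have l2 : (1 / 2%:R : R) <= ln 2%:R.
  suff : (- ln (2%:R : R) <= 2%:R^-1 - 1)%R by lra.
  rewrite -lnV ?posrE ?ltr0n //; apply: ln_leB1.
  by rewrite invr_gt0 ltr0n.
rewrite natrX lnXn ?ltr0n // -[_ *+ i]mulr_natr in h.
have hi : (0 : R) <= i%:R by rewrite ler0n.
have h3 := ler_wpM2r hi l2; have := log1_ln (m%:R : R); rewrite natrM; lra.
Qed.

(** With [r = n/s] the bound is [1 + ln 80 + 2 ln r], where [ln 80 <= 79]; the resulting 82 is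
    rounded up. *)
Lemma harm_ratio t n s : (0 < s)%N -> (s <= n)%N -> (t * s ^ 2 <= 80 * n ^ 2)%N ->
  harm R t <= 85%:R * log1 (n%:R / s%:R).
Proof.
move=> s0 sn ht; set r : R := n%:R / s%:R.
have L := log1_ge1 r; have Ln := log1_ln r.
case: t ht => [|t] ht; first by rewrite /harm big_ord0; lra.
apply: le_trans (harm_le _) _ => //.
have s0R : 0 < s%:R :> R by rewrite ltr0n.
have n0R : 0 < n%:R :> R by rewrite ltr0n; exact: leq_trans s0 sn.
have r0 : 0 < r by apply: divr_gt0.
have hr : t.+1%:R <= 80%:R * r ^+ 2.
  rewrite /r exprMn exprVn mulrA ler_pdivlMr ?exprn_gt0 //.
  by rewrite -!natrX -!natrM ler_nat.
have h1 : ln (t.+1%:R : R) <= ln (80%:R * r ^+ 2).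
  by rewrite ler_ln ?posrE ?ltr0n //; apply: mulr_gt0; rewrite ?ltr0n ?exprn_gt0.
rewrite lnM ?posrE ?ltr0n ?exprn_gt0 // lnXn // in h1.
have h2 : ln (80%:R : R) <= 79%:R.
  by apply: le_trans (ln_leB1 _) _; [rewrite ltr0n | lra].
rewrite mulr2n in h1; lra.
Qed.

Lemma log1_nu m n : (m <= n ^ 2)%N -> log1 (m%:R : R) <= 2%:R * log1 (n%:R).
Proof.
move=> h; have L := log1_ge1 (n%:R); rewrite {1}/log1 ge_max; apply/andP; split; first by lra.
case: m h => [|m] h; first by rewrite ln0 //; lra.
have n0 : (0 < n)%N by case: n h L.
have : ln (m.+1%:R : R) <= ln ((n ^ 2)%:R : R).
  by rewrite ler_ln ?posrE ?ltr0n ?expn_gt0 ?n0 // ler_nat.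
rewrite natrX lnXn ?ltr0n // mulr2n; have := log1_ln (n%:R); lra.
Qed.
End Logs.

(** * Comparing the returned cover with each candidate *)

Section Best.
Variables (V : finType) (R : realType) (P : prob V R) (qs : seq nat).
Notation edge := (V * V)%type.
Local Notation F := (pfam P).
Local Notation ask := (pask P).
Local Notation E := (pedg P).
Local Notation cl := (pcl P).
Local Notation LP := (lpval P xpredT).
Local Notation n := #|V|.

Lemma pcover_sub q : {subset pcover ask cl q <= E}.
Proof. by have [tr [phs [inv _]]] := pcrunP P q; exact: (pc_sub inv). Qed.

Definition cands := [:: [::], rounds ask cl & [seq pcboth ask cl q | q <- qs]].

Lemma dround_sub J : {subset J <= E} -> {subset dround ask cl J <= E}.
Proof.
move=> sJ; have [a _ _ _ _] := roundP sJ; rewrite /dround -pcl_flip.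
have [b _ _ _ _] := @roundP V R (flip P) _ (flip_sub a).
by move=> e; rewrite mem_fl => /b; rewrite /= mem_fl flK.
Qed.

Lemma cands_sub J : J \in cands -> {subset J <= E}.
Proof.
rewrite !inE => /or3P[/eqP -> //|/eqP ->|/mapP[q _ ->]].
  rewrite /rounds; have : {subset [::] <= E} by [].
  elim: (enum V) [::] => //= v s IH J' sJ; apply: IH; exact: dround_sub.
move=> e; rewrite /pcboth mem_cat => /orP[/pcover_sub //|].
rewrite mem_fl -pcl_flip => h; have [tr [phs [inv _]]] := pcrunP (flip P) q.
by have := pc_sub inv h; rewrite /= mem_fl flK.
Qed.

Lemma bestcoverP : let J := bestcover ask cl qs in
  [/\ {subset J <= E}, forall S, S \in F -> ~~ unc J S
    & forall J0, J0 \in cands -> ((ccost P J)%:~R <= (ccost P J0)%:~R + harm R (size (mintrans ask J0)) * LP)%R].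
Proof.
rewrite /bestcover -/cands.
have := argminP (costof cl) [seq gacover ask cl J | J <- cands].
case: (argmin _ _) => [J|]; last by [].
move=> [/mapP[J0 J0c ->] hmin].
have [g1 g2 g3 g4] := gacoverP (cands_sub J0c); split=> // J1 J1c.
have [_ _ _ h] := gacoverP (cands_sub J1c); apply: le_trans h; rewrite ler_int.
by apply: hmin; exact: map_f.
Qed.

Local Notation Jb := (bestcover ask cl qs).

Lemma ccost0 : ccost P [::] = 0%R. Proof. by rewrite ccostE big1 // => e /andP[]. Qed.

Lemma harmS m p : m <= p -> (harm R m <= harm R p)%R.
Proof.
move=> /subnK <-; elim: (p - m) => // d IH; apply: le_trans IH _.
by rewrite addSn /harm [X in (_ <= X)%R]big_ord_recr /= lerDl invr_ge0 ler0n.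
Qed.

Lemma best_nu : ((ccost P Jb)%:~R <= 2%:R * log1 (nu F)%:R * LP)%R.
Proof.
have [_ _ /(_ [::] (mem_head _ _)) h] := bestcoverP; apply: le_trans h _.
rewrite ccost0 add0r; apply: ler_wpM2r; first exact: lpval_ge0.
by apply: le_trans (harmS (mintrans_nu P)) _; exact: harm_log1.
Qed.

Hypothesis hqs : forall q, 0 < q <= n -> q \in qs.
Variable k : nat.
Hypotheses (kn : k < n) (reg1 : k_regular k F) (reg2 : k_regular k (cofamily F)).
Local Notation s := (n - k).

Lemma best_ratio : ((ccost P Jb)%:~R <= 90%:R * log1 (n%:R / s%:R) * LP)%R.
Proof.
have s0 : 0 < s by rewrite subn_gt0.
have sn : s <= n by exact: leq_subr.
have [J0 [J0c hc ht]] : exists J0, [/\ J0 \in cands, ((ccost P J0)%:~R <= LP + LP)%R &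
    size (mintrans ask J0) * s ^ 2 <= 80 * n ^ 2].
  (* For the smallest [s] the [q] chosen below would be 0. Here the empty candidate suffices: its
     transversal has at most [n^2] vertices, and [7^2 <= 80]. *)
  case: (leqP s 7) => hs.
    exists [::]; split; first exact: mem_head.
      by rewrite ccost0 addr_ge0 // lpval_ge0.
    have h : s ^ 2 <= 7 ^ 2 by rewrite leq_exp2r.
    apply: leq_trans (leq_mul (leq_trans (mintrans_nu P) (nu_le P)) h) _.
    by rewrite mulnC leq_mul2r orbT.
  (* The largest [q] with [4q < s], as regularity demands. Then [s <= 4(q+1)], so the 5 of
     [pcboth_T] becomes [16 * 5 = 80]. *)
  pose q := s.-1 %/ 4.
  have hq : 4 * q < s by rewrite /q; move: (s) hs => x; clear; lia.
  have hq1 : s <= 4 * q.+1 by rewrite /q; move: (s) hs => x; clear; lia.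
  have q0 : 0 < q by rewrite /q; move: (s) hs => x; clear; lia.
  have qV : q + q < n by move: hq sn; move: (n - k) #|V| => x y; clear; lia.
  have qin : q \in qs by apply: hqs; rewrite q0 /=; move: qV; move: #|V| => y; clear; lia.
  have r1 := k_regular_reg reg1 hq; have r2 := k_regular_reg reg2 hq.
  exists (pcboth ask cl q); split.
  - by rewrite !inE map_f ?orbT.
  - by have [] := pcboth_cost qV r1 r2.
  - have h := pcboth_T qV r1 r2; move: (size _) h => t h.
    apply: (@leq_trans (t * (4 * q.+1) ^ 2)); first by rewrite leq_mul2l leq_exp2r // hq1 orbT.
    rewrite expnMn; move: h; move: (q.+1 ^ 2) (n ^ 2) => a b; clear; lia.
have [_ _ /(_ J0 J0c) h] := bestcoverP.
have hh := harm_ratio R s0 sn ht; have L := log1_ge1 (n%:R / s%:R : R)%R.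
have LP0 : (0 <= LP)%R by exact: lpval_ge0.
have h2 := ler_wpM2r LP0 hh; have h3 := ler_wpM2r LP0 L.
by rewrite mul1r in h3; rewrite -mulrA in h2 *; lra.
Qed.

Hypothesis bd : forall S, S \in F -> #|boundary S| = k.

(** The rounds leave nothing uncovered, so the transversal still to be paid for is empty and its
    harmonic number is 0. *)
Lemma best_gap : ((ccost P Jb)%:~R <= 4%:R * log1 (s%:R) * LP)%R.
Proof.
have s0 : 0 < s by rewrite subn_gt0.
have [a b d] := roundsP kn reg1 reg2 bd.
have J0c : rounds ask cl \in cands by rewrite !inE eqxx orbT.
have [_ _ /(_ _ J0c) h] := bestcoverP; apply: le_trans h _.
have -> : mintrans ask (rounds ask cl) = [::].
  case e : (mintrans ask (rounds ask cl)) => [|t T] //.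
  have [|S [SF uS _ _]] := @mintrans_private _ _ P (rounds ask cl) t; first by rewrite e mem_head.
  by have := b S SF; rewrite uS.
rewrite /harm big_ord0 mul0r addr0; apply: le_trans d _.
by apply: ler_wpM2r; [exact: lpval_ge0 | exact: trunc_log_ln].
Qed.
End Best.

(** * From integral costs back to the given LP *)

Section Final.
Variables (R : realType) (I : inst).
Local Notation n := (nv I).
Local Notation E := (Ed I).
Local Notation F := (Fm I).
Local Notation edge := (edg I).
Local Open Scope ring_scope.
Let cR : edge -> R := fun e => ratr (icst e).
Let cS (e : edge) : int := imul (numq (icst e)) (dprod e (ilist I)).
Let D : R := \prod_(e <- enum E) (denq (icst e))%:~R.

Lemma D_gt0 : 0 < D.
Proof. by rewrite /D; apply: prodr_gt0 => e _; rewrite ltr0z denq_gt0. Qed.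

Lemma dprodE (e : edge) (l : seq edge) :
  dprod e [seq (e, (numq (icst e), denq (icst e))) | e <- l] = \prod_(f <- l | f != e) denq (icst f).
Proof.
rewrite /dprod.
suff h p : foldl (fun p y => if eq_edge y.1 e then p else imul p y.2.2) p
    [seq (e, (numq (icst e), denq (icst e))) | e <- l] = p * \prod_(f <- l | f != e) denq (icst f).
  by rewrite h mul1r.
elim: l p => [|f l IH] p /=; first by rewrite big_nil mulr1.
rewrite IH big_cons /eq_edge -[_ && _]/(f == e); case: (f == e) => //=.
by rewrite /imul mulrA.
Qed.

Lemma cSE e : e \in E -> (cS e)%:~R = D * cR e.
Proof.
move=> eE; rewrite /cS /imul /ilist dprodE intrM /D /cR /ratr.
rewrite [X in X * (_ / _)](bigD1_seq e) ?enum_uniq ?mem_enum //= rmorph_prod /=.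
have h : (denq (icst e))%:~R != 0 :> R by rewrite intr_eq0 denq_neq0.
by set x := \prod_(_ <- _ | _) _; field.
Qed.

Lemma cS_ge0 e : e \in enum E -> 0 <= cS e.
Proof.
rewrite mem_enum => eE; rewrite -(ler0z R) cSE //.
by rewrite mulr_ge0 ?(ltW D_gt0) // /cR ler0q (inst_cost_ge0 eE).
Qed.

Lemma delta_sum (x : edge -> R) S :
  \sum_(e in delta E S) x e = \sum_(e <- enum E | covers e S) x e.
Proof. by rewrite big_enum_cond; apply: eq_bigl => e; rewrite inE. Qed.

Section LP.
Variables (x : edge -> R) (hx : fractional_cover E F x).

Lemma x_ge0 e : e \in enum E -> 0 <= x e.
Proof. by rewrite mem_enum; exact: hx.1. Qed.
Lemma x_ge1 S : S \in F -> 1 <= \sum_(e <- enum E | covers e S) x e.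
Proof. by rewrite -delta_sum; exact: hx.2. Qed.

Definition probI : prob 'I_n R :=
  Prob (@inst_proper I) (@inst_crossing I) (@asks_ok I) (enum_uniq (mem E)) cS_ge0 x_ge0 x_ge1.

Lemma clS_probI : clS I = pcl probI.
Proof. by rewrite /clS /scaled {2}/ilist -map_comp. Qed.

Lemma lpval_probI : lpval probI xpredT = D * \sum_(e in E) cR e * x e.
Proof.
rewrite /lpval /= mulr_sumr -big_enum /= big_seq [RHS]big_seq; apply: eq_bigr => e.
by rewrite mem_enum => eE; rewrite cSE // mulrA.
Qed.

Lemma ccost_probI (J : seq edge) : {subset J <= E} -> (ccost probI J)%:~R = D * cost cR [set e in J].
Proof.
move=> sJ; rewrite ccostE rmorph_sum /cost mulr_sumr /= big_seq_cond.
rewrite (eq_bigr (fun e => D * cR e)); last by move=> e /andP[]; rewrite mem_enum => eE _; exact: cSE.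
rewrite -big_seq_cond big_enum_cond; apply: eq_bigl => e; rewrite inE.
by case eJ : (e \in J); rewrite ?andbF ?andbT //; exact: sJ.
Qed.
End LP.

(** Shows that the infimum in [tau] ranges over a nonempty set. *)
Lemma feasible1 : fractional_cover E F (fun=> 1 : R).
Proof.
split=> [e _|S SF]; first exact: ler01.
have [e eE ce] := inst_cover SF.
have eD : e \in delta E S by rewrite inE eE.
by rewrite (bigD1 e eD) /= lerDl sumr_ge0.
Qed.

(** The scaling factor [D] cancels between cost and LP value. Dividing by [K] makes the cost a lower
    bound of all LP values, hence of their infimum. *)
Lemma tau_bound (J : seq edge) K : {subset J <= E} -> 0 < K ->
  (forall x (hx : fractional_cover E F x), (ccost (probI hx) J)%:~R <= K * lpval (probI hx) xpredT) ->
  cost cR [set e in J] <= K * tau E cR F.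
Proof.
move=> sJ K0 h; rewrite mulrC -ler_pdivrMr //; apply: lb_le_inf.
  by exists (\sum_(e in E) cR e * 1), (fun=> 1); first exact: feasible1.
move=> _ [x hx ->]; rewrite ler_pdivrMr //; have := h x hx.
by rewrite ccost_probI // lpval_probI mulrCA ler_pM2l ?D_gt0 // mulrC.
Qed.

Lemma qlistP q : (0 < q <= #|'I_n|)%N -> q \in qlist I.
Proof.
rewrite card_ord => /andP[q0 qn]; have h : (q.-1 < n)%N by rewrite prednK.
by apply/mapP; exists (Ordinal h); rewrite ?mem_enum //= prednK.
Qed.

Lemma solveP : let l := solve I in let J : {set edge} := [set e in l] in
  let n_over : nat -> R := fun k => n%:R / (n - k)%:R in
  [/\ J \subset E /\ edge_cover J F,
      cost cR J <= 100%:R * log1 (nu F)%:R * tau E cR F /\ log1 (nu F)%:R <= 100%:R * log1 n%:R :> R,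
      forall k : nat, (k < n)%N -> k_regular k F -> k_regular k (cofamily F) ->
        (forall S, S \in F -> #|boundary S| = k) ->
        cost cR J <= 100%:R * log1 (Num.min (n_over k) (n - k)%:R) * tau E cR F
    & forall k : nat, (k < n)%N -> k_regular k F -> k_regular k (cofamily F) ->
        cost cR J <= 100%:R * (n_over k * log1 (n_over k)) * tau E cR F].
Proof.
have sE (x : edge -> R) (hx : fractional_cover E F x) : solve I = bestcover (pask (probI hx)) (pcl (probI hx)) (qlist I).
  by rewrite /solve (clS_probI hx).
move=> l J n_over.
have [b1 b2 _] := bestcoverP (probI feasible1) (qlist I); rewrite -(sE _ feasible1) -/l in b1 b2.
have sJ : {subset l <= E} by move=> e /b1; rewrite /= mem_enum.
have pos (y : R) : 0 < 100%:R * log1 y by rewrite mulr_gt0 ?ltr0n // (lt_le_trans ltr01) // log1_ge1.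
have mono (a b L : R) : 0 <= L -> a <= b -> a * L <= b * L by move=> L0 ab; exact: ler_wpM2r.
have ratio k : (k < n)%N -> k_regular k F -> k_regular k (cofamily F) ->
    cost cR J <= 100%:R * log1 (n_over k) * tau E cR F.
  move=> kn r1 r2; apply: tau_bound => // x hx; rewrite /l (sE x hx).
  have kn' : (k < #|'I_n|)%N by rewrite card_ord.
  apply: le_trans (@best_ratio _ _ (probI hx) (qlist I) qlistP k kn' r1 r2) _; apply: mono; first exact: lpval_ge0.
  by rewrite card_ord; apply: ler_wpM2r; [apply: le_trans ler01 (log1_ge1 _) | lra].
split.
- split; first by apply/subsetP => e; rewrite inE; exact: sJ.
  move=> S /b2; rewrite /unc -has_predC => /hasP[e el /=]; rewrite negbK => ce.
  by exists e; rewrite // inE.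
- split; last first.
    apply: le_trans (log1_nu R (_ : (nu F <= n ^ 2)%N)) _.
      by have := nu_le (probI feasible1); rewrite card_ord.
    by apply: ler_wpM2r; [apply: le_trans ler01 (log1_ge1 _) | lra].
  apply: tau_bound => // x hx; rewrite /l (sE x hx).
  apply: le_trans (best_nu _ _) _; apply: mono; first exact: lpval_ge0.
  by apply: ler_wpM2r; [apply: le_trans ler01 (log1_ge1 _) | lra].
(* Either argument of the minimum has its own bound: partial covers give the first one, rounds the
   second. *)
- move=> k kn r1 r2 bd; rewrite /Num.min; case: ifP => _; first exact: ratio.
  apply: tau_bound => // x hx; rewrite /l (sE x hx).
  have kn' : (k < #|'I_n|)%N by rewrite card_ord.
  apply: le_trans (@best_gap _ _ (probI hx) (qlist I) k kn' r1 r2 bd) _; apply: mono; first exact: lpval_ge0.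
  by rewrite card_ord; apply: ler_wpM2r; [apply: le_trans ler01 (log1_ge1 _) | lra].
- move=> k kn r1 r2.
  (* This allows the logarithmic bound of [best_ratio] to be multiplied by [n_over k]. *)
  have r0 : 1 <= n_over k.
    by rewrite /n_over ler_pdivlMr ?ltr0n ?subn_gt0 // mul1r ler_nat leq_subr.
  apply: tau_bound => //; first by rewrite mulrCA mulr_gt0 // (lt_le_trans ltr01).
  move=> x hx; rewrite /l (sE x hx).
  have kn' : (k < #|'I_n|)%N by rewrite card_ord.
  apply: le_trans (@best_ratio _ _ (probI hx) (qlist I) qlistP k kn' r1 r2) _; apply: mono; first exact: lpval_ge0.
  rewrite card_ord -/(n_over k) mulrA; apply: ler_wpM2r; first by apply: le_trans ler01 (log1_ge1 _).
  by lra.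
Qed.
End Final.

Local Open Scope ring_scope.

Theorem theorem1 (R : realType) :
  exists (A : program) (p : {poly nat}) (C : R),
  forall (n : nat) (F : {set biset 'I_n}) (E : {set 'I_n * 'I_n})
         (c : 'I_n * 'I_n -> rat) (O : data -> data),
  proper_family F -> crossing F ->
  (forall e, e \in E -> 0 <= c e) ->
  core_oracle F O ->
  edge_cover E F ->
  exists (l : seq ('I_n * 'I_n)) (t : nat),
  let J : {set 'I_n * 'I_n} := [set e in l]%SET in
  let cR : 'I_n * 'I_n -> R := fun e => ratr (c e) in
  let n_over : nat -> R := fun k => n%:R / (n - k)%:R in
  [/\ computes O A (enc_instance E c) (enc_edges l) t /\
        (t <= p.[dsize (enc_instance E c)])%N,
      J \subset E /\ edge_cover J F,
      cost cR J <= C * log1 (nu F)%:R * tau E cR F /\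
        log1 (nu F)%:R <= C * log1 n%:R,
      forall k : nat, (k < n)%N -> k_regular k F -> k_regular k (cofamily F) ->
        (forall S, S \in F -> #|boundary S| = k) ->
        cost cR J <= C * log1 (Num.min (n_over k) (n - k)%:R) * tau E cR F
    & forall k : nat, (k < n)%N -> k_regular k F -> k_regular k (cofamily F) ->
        (gamma F <= k)%N ->
        cost cR J <= C * (n_over k * log1 (n_over k)) * tau E cR F].
Proof.
have [A [p hA]] := solve_program; exists A, p, 100%:R => n F E c O pF cF c0 hO hE.
pose I := Inst pF cF c0 hO hE; have [t ht] := hA I.
have [h1 h2 h3 h4] := solveP R I.
exists (solve I), t; split=> // k kn r1 r2 _; exact: h4.
Qed.
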